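(* Let $X=\mathbb{V}(xy_1^{a_1}\cdots y_m^{a_m}+z_1^{b_1}\cdots z_p^{b_p}+s_1^{c_1}\cdots s_q^{c_q})$ with $m\ge1$, $p\ge1$, $q\ge0$, all $a_i\ge 2$, all $b_j\ge2$, all $c_l\ge 2$, and $X$ not of type $H_4$. Then the $\mathrm{Aut}_{alg}(X)$-orbits on $X$ are the following sets. (1) The set $\mathcal{O}$ of all points of $X$ at which all $y_1,\ldots,y_m$ are nonzero is one $\mathrm{Aut}_{alg}(X)$-orbit. (2) Let $\varnothing\ne M\subseteq\{1,\ldots,m\}$, $d=\gcd(b_1,\ldots,b_p,c_1,\ldots,c_q)$, and let $\varepsilon\in\mathbb{K}$ satisfy $\varepsilon^d=-1$. Then $$\mathcal{O}(M,\varepsilon)=\{\text{points of }X\mid y_i=0\Leftrightarrow i\in M,\ z_1^{b_1/d}\cdots z_p^{b_p/d}=\varepsilon s_1^{c_1/d}\cdots s_q^{c_q/d}\ne0\}$$ is an $\mathrm{Aut}_{alg}(X)$-orbit. (3) Let $\varnothing\ne M\subseteq\{1,\ldots,m\}$, $\varnothing\neq P\subseteq\{1,\ldots,p\}$ and $\varnothing\ne Q\subseteq\{1,\ldots,q\}$. Then $$\mathcal{O}_1(M,P,Q)=\{\text{points of }X\mid y_i=0\Leftrightarrow i\in M,\ z_j=0\Leftrightarrow j\in P,\ s_l=0\Leftrightarrow l\in Q,\ x\ne0\}$$ is an $\mathrm{Aut}_{alg}(X)$-orbit, and $$\mathcal{O}_2(M,P,Q)=\{\text{points of }X\mid y_i=0\Leftrightarrow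 i\in M,\ z_j=0\Leftrightarrow j\in P,\ s_l=0\Leftrightarrow l\in Q,\ x=0\}$$ is an $\mathrm{Aut}_{alg}(X)$-orbit.
   Context: $\mathbb{K}$ is an algebraically closed field of characteristic zero. $X$ is the hypersurface in the affine space with coordinates $x,y_1,\ldots,y_m,z_1,\ldots,z_p,s_1,\ldots,s_q$ defined by the displayed polynomial; if $q=0$ the monomial in the $s_l$ means $1$ (and no sets $Q$ as in (3) exist). For these $X$, ''type $H_4$'' means: $q\ge1$, all $b_j$ and all $c_l$ are even, at least one $b_j$ equals $2$ and at least one $c_l$ equals $2$. $\mathrm{Aut}_{alg}(X)$ is the subgroup of the group $\mathrm{Aut}(X)$ of regular automorphisms generated by all connected algebraic subgroups of $\mathrm{Aut}(X)$. *)

(* Defs.v *)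
From HB Require Import structures.
From mathcomp Require Import all_boot all_order all_algebra mpoly.
Set Implicit Arguments.
Unset Strict Implicit.
Unset Printing Implicit Defensive.
Import GRing.Theory.
Local Open Scope ring_scope.

(* Over an algebraically closed field an affine variety is identified with    *)
(* its set of closed points, and the regular maps between affine varieties    *)
(* are the restrictions of polynomial maps.                                   *)

Section AffineVarieties.
Variable K : closedFieldType.

Definition vanish (n : nat) (s : seq {mpoly K[n]}) (v : 'rV[K]_n) : bool :=
  all (fun f : {mpoly K[n]} => f.@[v 0] == 0) s.

Definition variety (n : nat) (s : seq {mpoly K[n]}) : Type :=
  {v : 'rV[K]_n | vanish s v}.

Definition coord (n : nat) (s : seq {mpoly K[n]}) (v : variety s) (i : 'I_n) : K :=
  (val v) 0 i.

Definition regular (n k : nat) (s : seq {mpoly K[n]}) (t : seq {mpoly K[k]})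
    (f : variety s -> variety t) : Prop :=
  exists F : 'I_k -> {mpoly K[n]},
    forall (v : variety s) (j : 'I_k), coord (f v) j = (F j).@[coord v].

(* Regularity of a map V(s) x V(t) -> V(u), where V(s) x V(t) is embedded in  *)
(* the affine space of dimension n + k.                                       *)
Definition regular2 (n k l : nat) (s : seq {mpoly K[n]}) (t : seq {mpoly K[k]})
    (u : seq {mpoly K[l]}) (f : variety s -> variety t -> variety u) : Prop :=
  exists F : 'I_l -> {mpoly K[n + k]},
    forall (v : variety s) (w : variety t) (j : 'I_l),
      coord (f v w) j = (F j).@[(row_mx (val v) (val w)) 0].

Definition zariski_closed (n : nat) (s : seq {mpoly K[n]})
    (C : variety s -> Prop) : Prop :=
  exists I : {mpoly K[n]} -> Prop,
    forall v : variety s, C v <-> (forall f, I f -> f.@[coord v] = 0).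

(* The empty variety counts as connected here; algebraic groups are nonempty. *)
Definition zariski_connected (n : nat) (s : seq {mpoly K[n]}) : Prop :=
  forall C D : variety s -> Prop,
    zariski_closed C -> zariski_closed D ->
    (forall v, C v \/ D v) -> (forall v, ~ (C v /\ D v)) ->
    (forall v, C v) \/ (forall v, D v).

(* Affine algebraic groups, not assumed connected. *)
Record algebraic_group : Type := AlgebraicGroup {
  ag_ambient : nat;
  ag_eqs : seq {mpoly K[ag_ambient]};
  ag_mul : variety ag_eqs -> variety ag_eqs -> variety ag_eqs;
  ag_one : variety ag_eqs;
  ag_inv : variety ag_eqs -> variety ag_eqs;
  ag_mulA : associative ag_mul;
  ag_mul1 : left_id ag_one ag_mul;
  ag_mulV : left_inverse ag_one ag_inv ag_mul;
  ag_mul_regular : regular2 ag_mul;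
  ag_inv_regular : regular ag_inv
}.

Definition ag_point (G : algebraic_group) : Type := variety (ag_eqs G).

Section Automorphisms.
Variables (n : nat) (s : seq {mpoly K[n]}).
Local Notation X := (variety s).

Definition is_aut (f : X -> X) : Prop :=
  regular f /\ exists g : X -> X, [/\ regular g, cancel f g & cancel g f].

Record faithful_action (G : algebraic_group) (act : ag_point G -> X -> X) :
    Prop := FaithfulAction {
  act_regular : regular2 act;
  act_one : forall x, act (ag_one G) x = x;
  act_mul : forall g h x, act (ag_mul g h) x = act g (act h x);
  act_faithful : forall g h, act g =1 act h -> g = h
}.

(* Subsets of Aut(X) are predicates on maps X -> X; maps are compared         *)
(* pointwise.                                                                 *)
Definition connected_algebraic_subgroup (H : (X -> X) -> Prop) : Prop :=
  exists (G : algebraic_group) (act : ag_point G -> X -> X),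
    [/\ zariski_connected (ag_eqs G),
        faithful_action act,
        (forall f, H f -> is_aut f)
      & forall f, H f <-> exists g : ag_point G, f =1 act g].

Inductive Aut_alg : (X -> X) -> Prop :=
| Aut_alg_gen H f : connected_algebraic_subgroup H -> H f -> Aut_alg f
| Aut_alg_id : Aut_alg id
| Aut_alg_comp f g : Aut_alg f -> Aut_alg g -> Aut_alg (f \o g)
| Aut_alg_inv f g : Aut_alg f -> cancel f g -> cancel g f -> Aut_alg g.

Definition is_orbit (S : X -> Prop) : Prop :=
  exists x : X, forall y : X, S y <-> exists2 f, Aut_alg f & f x = y.

End Automorphisms.

Section Trinomial.
Variables (m p q : nat).
Variables (a : 'I_m -> nat) (b : 'I_p -> nat) (c : 'I_q -> nat).

Definition ambient : nat := (1 + (m + (p + q)))%N.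

Definition idx_x : 'I_ambient := lshift (m + (p + q)) (ord0 : 'I_1).
Definition idx_y (i : 'I_m) : 'I_ambient := rshift 1 (lshift (p + q) i).
Definition idx_z (j : 'I_p) : 'I_ambient := rshift 1 (rshift m (lshift q j)).
Definition idx_s (l : 'I_q) : 'I_ambient := rshift 1 (rshift m (rshift p l)).

Definition trinomial : {mpoly K[ambient]} :=
  'X_idx_x * (\prod_(i < m) 'X_(idx_y i) ^+ a i)
  + \prod_(j < p) 'X_(idx_z j) ^+ b j + \prod_(l < q) 'X_(idx_s l) ^+ c l.

Definition X_tri : Type := variety [:: trinomial].

Definition type_H4 : Prop :=
  [/\ (0 < q)%N,
      (forall j, ~~ odd (b j)),
      (forall l, ~~ odd (c l)),
      (exists j, b j = 2%N)
    & (exists l, c l = 2%N)].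

(* The gcd over an empty family is 0, so for q = 0 this is the gcd of the b_j. *)
Definition gcd_exp : nat :=
  gcdn (\big[gcdn/0%N]_(j < p) b j) (\big[gcdn/0%N]_(l < q) c l).

Definition orbit_open (v : X_tri) : Prop := forall i, coord v (idx_y i) != 0.

Definition y_vanish (M : {set 'I_m}) (v : X_tri) : Prop :=
  forall i, (coord v (idx_y i) == 0) = (i \in M).
Definition z_vanish (P : {set 'I_p}) (v : X_tri) : Prop :=
  forall j, (coord v (idx_z j) == 0) = (j \in P).
Definition s_vanish (Q : {set 'I_q}) (v : X_tri) : Prop :=
  forall l, (coord v (idx_s l) == 0) = (l \in Q).

Definition orbit_eps (M : {set 'I_m}) (eps : K) (v : X_tri) : Prop :=
  [/\ y_vanish M v,
      \prod_(j < p) coord v (idx_z j) ^+ (b j %/ gcd_exp)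
        = eps * \prod_(l < q) coord v (idx_s l) ^+ (c l %/ gcd_exp)
    & eps * \prod_(l < q) coord v (idx_s l) ^+ (c l %/ gcd_exp) != 0].

Definition orbit_1 (M : {set 'I_m}) (P : {set 'I_p}) (Q : {set 'I_q})
    (v : X_tri) : Prop :=
  [/\ y_vanish M v, z_vanish P v, s_vanish Q v & coord v idx_x != 0].

Definition orbit_2 (M : {set 'I_m}) (P : {set 'I_p}) (Q : {set 'I_q})
    (v : X_tri) : Prop :=
  [/\ y_vanish M v, z_vanish P v, s_vanish Q v & coord v idx_x = 0].

End Trinomial.
End AffineVarieties.

(* Main.v *)
From HB Require Import structures.
From mathcomp Require Import all_boot all_order all_algebra mpoly.
From mathcomp Require Import ring zify.
From Stdlib Require Import Classical.
Require Import Defs.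
Set Implicit Arguments.
Unset Strict Implicit.
Unset Printing Implicit Defensive.
Import Order.TTheory GRing.Theory Num.Theory.
Local Open Scope ring_scope.

(** The orbits are described by two independent arguments.

    Invariance of the sets. It is enough to treat a connected algebraic group
    acting on X. The key fact is that every locally nilpotent derivation of the
    coordinate ring kills all the y_i, unless X is of type H_4 (lnd_kills_y).
    Passing to lowest homogeneous components, one may assume the derivation
    homogeneous for the tori scaling y_i and x inversely to each other; if it
    does not kill y_i then it kills x, and after division by powers of x at most
    one of the y_i moves along its flow, linearly in the time. The flow then
    draws a polynomial curve on z^b + s^c = C y^A over a field of rational
    functions, and a Wronskian argument in the style of Mason and Stothers
    (mason) shows that this curve is constant, or that the exponents of its
    moving coordinates are 2; in the latter case the leading coefficients obey a
    multiplicative relation, from which a parity argument (even_exponents)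
    produces type H_4.

    Let f be an automorphism. The vector fields dk move the points along the
    fibres of y. Transported by f they are still locally nilpotent, so they kill
    the y_i; hence y o f is constant along the general fibres of y, and it is a
    polynomial in the y_i. Since f preserves the singular locus, or, if q = 0,
    since nonvanishing functions distinguish the special fibres of y from the
    general ones, f preserves the locus where some y_i vanishes (mu0_bi). It
    follows that f permutes the divisors y_i = 0 and the components of the
    singular locus (biregular_y, biregular_stratum). A connected group cannot
    permute finitely many sets nontrivially (connected_permutation), and for
    the same reason it fixes the d-th root eps of -1 (act_eps). On the singular
    locus the zeros of x are preserved, because x = 0 cuts out the points where
    all vector fields have no component along x (act_x).

    Transitivity. Multiplicative groups scale the coordinates with weights for
    which the equation is homogeneous, and additive groups translate a
    coordinate z_j or s_l by a multiple of the monomial in the y_i, at the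
    expense of x. Additive groups move the points with nonzero y_i
    (reach_open); at the other points they only move x, as long as no z_j
    vanishes (reach_x). Everything else is done by the torus. Its
    one-parameter subgroups involving two of the z_j and s_l generate the kernel
    of the character that is the quotient of the two monomials, their exponents
    divided by d (scal_zs): this gives the sets indexed by eps. On the singular
    locus a vanishing coordinate can be scaled freely to compensate for the
    other ones (reach_singular). *)

(** * Derivations of polynomial rings *)

Lemma mderiv_var (n : nat) (A : comNzRingType) (i j : 'I_n) :
  ('X_i : {mpoly A[n]})^`M(j) = (i == j)%:R.
Proof.
rewrite mderivX mnm1E; case: eqP => [->|_]; last by rewrite scale0r.
suff -> : (U_(j) - U_(j) = 0)%MM by rewrite mpolyX0 scale1r.
by apply/mnmP => k; rewrite mnmBE subnn mnm0E.
Qed.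

Lemma mmap_ind n (A : comNzRingType) (Q : {mpoly A[n]} -> Prop) :
  (forall c, Q c%:MP) -> (forall i, Q 'X_i) ->
  (forall p q, Q p -> Q q -> Q (p + q)) ->
  (forall p q, Q p -> Q q -> Q (p * q)) -> forall p, Q p.
Proof.
move=> QC QX QD QM; elim/mpolyind => [|c m p _ _ Qp]; first by rewrite -mpolyC0.
apply: QD => //; rewrite -mul_mpolyC; apply: (QM _ _ (QC c)).
rewrite mpolyXE_id; elim/big_ind: _ => //; first by rewrite -mpolyC1.
by move=> i _; elim: (m i) => [|k IH]; rewrite ?expr0 -?mpolyC1 // exprS; apply: QM.
Qed.

Section MmapComp.
Variables (n : nat) (A B C : comNzRingType).
Variables (h : {rmorphism A -> B}) (rho : {rmorphism B -> C}) (g : 'I_n -> B).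

Lemma mmap_comp (f : {mpoly A[n]}) :
  rho (mmap h g f) = mmap (rho \o h) (rho \o g) f.
Proof.
elim/mmap_ind: f => [u|k|f f' IH IH'|f f' IH IH'].
- by rewrite !mmapC.
- by rewrite !mmapX !mmap1U.
- by rewrite !mmapD rmorphD IH IH'.
- by rewrite !rmorphM /= IH IH'.
Qed.

End MmapComp.

Lemma mmap_id n (A : comNzRingType) (f : {mpoly A[n]}) :
  mmap (@mpolyC n A) (fun k => 'X_k) f = f.
Proof.
rewrite -[RHS]comp_mpoly_id /comp_mpoly; apply: eq_bigr => mm _.
by congr (_ * _); apply: mmap1_eq => k; rewrite tnth_mktuple.
Qed.

Lemma meval_mmap n k (A : comNzRingType) (gamma : 'I_n -> {mpoly A[k]}) (f : {mpoly A[n]}) v :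
  (mmap (@mpolyC k A) gamma f).@[v] = f.@[fun i => (gamma i).@[v]].
Proof.
elim/mmap_ind: f => [u|i|f g IHf IHg|f g IHf IHg].
- by rewrite mmapC !mevalC.
- by rewrite mmapX mmap1U mevalXU.
- by rewrite mmapD !mevalD IHf IHg.
- by rewrite [mmap _ _ _]rmorphM !mevalM IHf IHg.
Qed.

(** The derivation d of the target is arbitrary: it will be the derivative of
    a curve, a partial derivative of a substitution, or a vector field. *)
Section ChainRule.
Variables (n : nat) (A : comNzRingType) (B : comNzRingType).
Variables (h : {rmorphism A -> B}) (gamma : 'I_n -> B) (d : B -> B).
Hypothesis dD : {morph d : u v / u + v}.
Hypothesis dM : forall u v, d (u * v) = d u * v + u * d v.
Hypothesis dh : forall c, d (h c) = 0.

Lemma chain_rule f :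
  d (mmap h gamma f) = \sum_(i < n) mmap h gamma f^`M(i) * d (gamma i).
Proof.
elim/mmap_ind: f => [c|i|p q IHp IHq|p q IHp IHq].
- rewrite mmapC dh big1 // => i _.
  by rewrite mderivC mmap0 mul0r.
- rewrite mmapX mmap1U (bigD1 i) //= big1 => [|j ne_ji]; rewrite mderiv_var.
    by rewrite eqxx rmorph1 mul1r addr0.
  by rewrite eq_sym (negbTE ne_ji) mmap0 mul0r.
- rewrite mmapD dD IHp IHq -big_split; apply: eq_bigr => i _ /=.
  by rewrite mderivD mmapD mulrDl.
- rewrite rmorphM dM IHp IHq mulr_suml mulr_sumr -big_split.
  apply: eq_bigr => i _ /=; rewrite mderivM rmorphD !rmorphM /=; ring.
Qed.

End ChainRule.

Section Der.
Variables (n : nat) (A : comNzRingType).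
Implicit Types (g : 'I_n -> {mpoly A[n]}) (f p q : {mpoly A[n]}).

Definition Der g f := \sum_(i < n) f^`M(i) * g i.

Lemma DerD g : {morph Der g : p q / p + q}.
Proof.
move=> p q; rewrite /Der -big_split; apply: eq_bigr => i _ /=.
by rewrite mderivD mulrDl.
Qed.

Lemma DerM g p q : Der g (p * q) = Der g p * q + p * Der g q.
Proof.
rewrite /Der mulr_suml mulr_sumr -big_split; apply: eq_bigr => i _ /=.
rewrite mderivM; ring.
Qed.

Lemma DerC g c : Der g c%:MP = 0.
Proof. by rewrite /Der big1 // => i _; rewrite mderivC mul0r. Qed.

Lemma Der0 g : Der g 0 = 0.
Proof. by rewrite -mpolyC0 DerC. Qed.

Lemma Der1 g : Der g 1 = 0.
Proof. by rewrite -mpolyC1 DerC. Qed.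

Lemma DerN g : {morph Der g : p / - p}.
Proof. by move=> p; apply/eqP; rewrite -addr_eq0 -DerD addNr Der0. Qed.

Lemma DerB g : {morph Der g : p q / p - q}.
Proof. by move=> p q; rewrite DerD DerN. Qed.

Lemma DerX g i : Der g 'X_i = g i.
Proof.
rewrite /Der (bigD1 i) //= big1 => [|j ne_ji]; rewrite mderiv_var.
  by rewrite eqxx mul1r addr0.
by rewrite eq_sym (negbTE ne_ji) mul0r.
Qed.

Lemma Der_sum g (I : Type) (r : seq I) (P : pred I) (F : I -> {mpoly A[n]}) :
  Der g (\sum_(i <- r | P i) F i) = \sum_(i <- r | P i) Der g (F i).
Proof. exact: (big_morph _ (DerD g) (Der0 g)). Qed.

Lemma Der_iterD g r : {morph iter r (Der g) : p q / p + q}.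
Proof. by elim: r => // r IH p q /=; rewrite IH DerD. Qed.

Lemma Der_iterM g r p q :
  iter r (Der g) (p * q) =
  \sum_(i < r.+1) (iter i (Der g) p * iter (r - i) (Der g) q) *+ 'C(r, i).
Proof.
elim: r => [|r IH]; first by rewrite big_ord_recl big_ord0 addr0.
pose t (u v : nat) := iter u (Der g) p * iter v (Der g) q.
have DerMn u k : Der g (u *+ k) = Der g u *+ k.
  by elim: k => [|k IHk]; rewrite ?Der0 // !mulrS DerD IHk.
rewrite iterS IH Der_sum.
transitivity (\sum_(i < r.+1) t i.+1 (r - i)%N *+ 'C(r, i)
              + \sum_(i < r.+1) t i (r.+1 - i)%N *+ 'C(r, i)).
  rewrite -big_split; apply: eq_bigr => i _ /=.
  by rewrite DerMn DerM mulrnDl /t /= subSn // -ltnS.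
rewrite [in X in X + _ = _]big_ord_recr [in X in _ + X = _]big_ord_recl.
rewrite [RHS]big_ord_recl [in RHS]big_ord_recr /= !bin0 !binn /=.
rewrite [X in X + _ = _]addrC [RHS]addrCA !addrA -[LHS]addrA -!addrA.
rewrite subnn /t /= ?subn0 /=.
have split_i (i : 'I_r) : iter i.+1 (Der g) p * iter (r.+1 - i.+1) (Der g) q *+ 'C(r.+1, i.+1)
   = t i.+1 (r - i)%N *+ 'C(r, i) + t i.+1 (r - i)%N *+ 'C(r, i.+1).
  by rewrite binS mulrnDr subSS addrC.
under [in RHS]eq_bigr => i _ do rewrite /bump /= add1n split_i.
under [X in _ + (_ + (_ + X)) = _]eq_bigr => i _ do rewrite /bump /= add1n subSS.
rewrite big_split /= /t /= subSS subnn /=.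
ring.
Qed.

End Der.

(** * Polynomials and their values *)

Section Vanishing.
Variable K : closedFieldType.
Hypothesis charK0 : [pchar K] =i pred0.

Lemma natK_neq0 (k : nat) : (k.+1%:R : K) != 0.
Proof. by rewrite ((pcharf0P K).1 charK0). Qed.

Lemma poly_vanish0 (f : {poly K}) : (forall t, f.[t] = 0) -> f = 0.
Proof.
move=> f0; apply/eqP; case: eqP => // /eqP nz_f.
by have [t] := closed_nonrootP f nz_f; rewrite /root f0 eqxx.
Qed.

Lemma horner_mmap n (gamma : 'I_n -> {poly K}) (f : {mpoly K[n]}) t :
  (mmap polyC gamma f).[t] = f.@[fun i => (gamma i).[t]].
Proof.
elim/mmap_ind: f => [u|i|f g IHf IHg|f g IHf IHg].
- by rewrite mmapC hornerC mevalC.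
- by rewrite mmapX mmap1U mevalXU.
- by rewrite mmapD hornerD mevalD IHf IHg.
- by rewrite rmorphM hornerM mevalM IHf IHg.
Qed.

Lemma deriv_mmap n (gamma : 'I_n -> {poly K}) (f : {mpoly K[n]}) :
  (mmap polyC gamma f)^`() =
  \sum_(i < n) mmap polyC gamma f^`M(i) * (gamma i)^`().
Proof.
apply: (@chain_rule _ _ _ polyC gamma (@deriv K)) => [u v|u v|u]; first exact: derivD.
  exact: derivM.
exact: derivC.
Qed.

Lemma mderiv_all0 n (f : {mpoly K[n]}) :
  (forall i, f^`M(i) = 0) -> f = (f@_0%MM)%:MP.
Proof.
move=> df0; apply/mpolyP => mm; rewrite mcoeffC.
have [->|nz_m] := eqVneq mm 0%MM; first by rewrite mulr1.
rewrite mulr0; have [i nz_mi] : exists i, mm i != 0%N.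
  apply/existsP; rewrite -negb_forall; apply: contra nz_m => /forallP m0.
  by apply/eqP/mnmP => i; rewrite mnm0E; apply/eqP.
have := mcoeff_deriv i (mm - U_(i))%MM f; rewrite df0 mcoeff0 submK ?lep1mP //.
move/esym/eqP; rewrite -mulr_natr mulf_eq0 (negbTE (natK_neq0 _)) orbF.
by move/eqP.
Qed.

(** Restricting f to the lines in a coordinate direction shows that its
    partial derivatives vanish everywhere too, so the degree can be lowered. *)
Lemma mpoly_vanish0 n (f : {mpoly K[n]}) : (forall v, f.@[v] = 0) -> f = 0.
Proof.
have [k] := ubnP (msize f); elim: k f => // k IH f le_f_k f0.
suff df0 i : f^`M(i) = 0.
  have fC := mderiv_all0 df0; move: (f0 (fun=> 0)); rewrite {1}fC mevalC => c0.
  by rewrite fC c0 mpolyC0.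
have dfi0 v : f^`M(i).@[v] = 0.
  pose gamma j : {poly K} := (v j)%:P + (i == j)%:R *: 'X.
  have gam0 j : (gamma j).[0] = v j by rewrite hornerD hornerC hornerZ hornerX mulr0 addr0.
  have: mmap polyC gamma f = 0.
    by apply: poly_vanish0 => t; rewrite horner_mmap.
  move/(congr1 (@deriv K)); rewrite deriv_mmap deriv0 (bigD1 i) //= big1.
    rewrite derivD derivC derivZ derivX eqxx add0r scale1r mulr1 addr0.
    move/(congr1 (horner^~ 0)); rewrite horner_mmap horner0 => <-.
    by apply: meval_eq => j; rewrite gam0.
  move=> j ne_ji; rewrite derivD derivC derivZ derivX eq_sym (negbTE ne_ji).
  by rewrite scale0r add0r mulr0.
have [->|nz_df] := eqVneq f^`M(i) 0; first by [].
apply: IH dfi0; rewrite (leq_trans _ (_ : (msize f <= k)%N)) //.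
have: mlead f^`M(i) \in msupp f^`M(i) by apply: mlead_supp.
rewrite mcoeff_msupp mcoeff_deriv => nz_c.
have: (mlead f^`M(i) + U_(i))%MM \in msupp f.
  by rewrite mcoeff_msupp; apply: contraNneq nz_c => ->; rewrite mul0rn.
move/msize_mdeg_lt; rewrite mdegD mdeg1 addn1 => lt_f.
by rewrite -(mlead_deg nz_df).
Qed.

End Vanishing.

(** * Polynomials in part of the variables *)

(** Independence from the variables in S. Quantifying over all substitutions
    makes it stable under the ring operations without inspection of the
    monomials. *)
Definition indep n (K : comNzRingType) (S : pred 'I_n) (f : {mpoly K[n]}) :=
  forall (B : comNzRingType) (h : {rmorphism K -> B}) (g g' : 'I_n -> B),
    (forall k, ~~ S k -> g k = g' k) -> mmap h g f = mmap h g' f.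

Section Indep.
Variables (n : nat) (K : comNzRingType) (S : pred 'I_n).
Implicit Types f g : {mpoly K[n]}.

Lemma indepC u : indep S (u%:MP : {mpoly K[n]}).
Proof. by move=> B h g g' _; rewrite !mmapC. Qed.

Lemma indep1 : indep S (1 : {mpoly K[n]}).
Proof. by rewrite -mpolyC1; apply: indepC. Qed.

Lemma indepX k : ~~ S k -> indep S ('X_k : {mpoly K[n]}).
Proof. by move=> Sk B h g g' eq_g; rewrite !mmapX !mmap1U eq_g. Qed.

Lemma indepD f g : indep S f -> indep S g -> indep S (f + g).
Proof.
by move=> If Ig B h u u' eq_u; rewrite !mmapD (If _ _ _ _ eq_u) (Ig _ _ _ _ eq_u).
Qed.

Lemma indepM f g : indep S f -> indep S g -> indep S (f * g).
Proof.
by move=> If Ig B h u u' eq_u; rewrite !rmorphM /= (If _ _ _ _ eq_u) (Ig _ _ _ _ eq_u).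
Qed.

Lemma indepE f e : indep S f -> indep S (f ^+ e).
Proof.
move=> If; elim: e => [|e IH]; first exact: indep1.
by rewrite exprS; apply: indepM.
Qed.

Lemma indep_prod (I : finType) (P : pred I) (E : I -> {mpoly K[n]}) :
  (forall i, P i -> indep S (E i)) -> indep S (\prod_(i | P i) E i).
Proof. by move=> IE; elim/big_ind: _ => //; [apply: indep1|apply: indepM]. Qed.

Lemma indep_meval f (v v' : 'I_n -> K) :
  indep S f -> (forall k, ~~ S k -> v k = v' k) -> f.@[v] = f.@[v'].
Proof. by move=> If; apply: (If K idfun). Qed.

Lemma indep_deriv f k : indep S f -> S k -> f^`M(k) = 0.
Proof.
move=> If Sk; pose g i : {mpoly K[n]} := if S i then 0 else 'X_i.
have Ef : f = mmap (@mpolyC n K) g f.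
  by rewrite -[LHS]mmap_id; apply: If => i Si; rewrite /g (negbTE Si).
rewrite Ef (@chain_rule _ _ _ (@mpolyC n K) g (mderiv k)).
- rewrite big1 // => i _; rewrite /g; case: ifP => Si; first by rewrite mderiv0 mulr0.
  have ne : i != k by apply: contraFneq Si => ->.
  by rewrite mderiv_var (negbTE ne) mulr0.
- exact: mderivD.
- exact: mderivM.
- exact: mderivC.
Qed.

End Indep.

Section Subst.
Variables (n : nat) (K : comNzRingType).
Implicit Types (Phi Psi : 'I_n -> {mpoly K[n]}) (f : {mpoly K[n]}).

(** Locked, so that conversion never unfolds the substitution. *)
Definition subst Phi : {rmorphism {mpoly K[n]} -> {mpoly K[n]}} :=
  locked (mmap (@mpolyC n K) Phi : {rmorphism {mpoly K[n]} -> {mpoly K[n]}}).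

Lemma substE Phi f : subst Phi f = mmap (@mpolyC n K) Phi f.
Proof. by rewrite /subst -lock. Qed.

Lemma meval_subst Phi f v : (subst Phi f).@[v] = f.@[fun k => (Phi k).@[v]].
Proof. by rewrite substE meval_mmap. Qed.

Lemma mderiv_subst Phi f k :
  (subst Phi f)^`M(k) = \sum_j subst Phi f^`M(j) * (Phi j)^`M(k).
Proof.
rewrite substE (@chain_rule _ _ _ (@mpolyC n K) Phi (mderiv k)).
- by apply: eq_bigr => j _; rewrite substE.
- exact: mderivD.
- exact: mderivM.
- exact: mderivC.
Qed.

Lemma Der_subst g Phi f :
  Der g (subst Phi f) = \sum_j subst Phi f^`M(j) * Der g (Phi j).
Proof.
rewrite substE (@chain_rule _ _ _ (@mpolyC n K) Phi (Der g)).
- by apply: eq_bigr => j _; rewrite substE.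
- exact: DerD.
- exact: DerM.
- exact: DerC.
Qed.

End Subst.

Section KillVar.
Variables (n : nat) (K : comNzRingType) (i : 'I_n).

Definition kill : {rmorphism {mpoly K[n]} -> {mpoly K[n]}} :=
  subst (fun k => if k == i then 0 else 'X_k).

Lemma killX k : kill 'X_k = if k == i then 0 else 'X_k.
Proof. by rewrite /kill substE mmapX mmap1U. Qed.

Lemma kill_div f : exists h, f = kill f + 'X_i * h.
Proof.
elim/mmap_ind: f => [u|k|f g [h1 E1] [h2 E2]|f g [h1 E1] [h2 E2]].
- by exists 0; rewrite /kill substE mmapC mulr0 addr0.
- rewrite killX; case: eqP => [->|_].
    by exists 1; rewrite add0r mulr1.
  by exists 0; rewrite mulr0 addr0.
- by exists (h1 + h2); rewrite rmorphD /= {1}E1 {1}E2; ring.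
- exists (h1 * kill g + kill f * h2 + 'X_i * h1 * h2).
  by rewrite {1}E1 {1}E2 rmorphM /=; ring.
Qed.

Lemma kill_indep (S : pred 'I_n) f : indep S f -> S i -> kill f = f.
Proof.
move=> If Si; rewrite /kill substE -[RHS]mmap_id; apply: If => k Sk.
by case: eqP Sk => // ->; rewrite Si.
Qed.

End KillVar.
Arguments kill {n K} i.

(** * Polynomial curves on trinomials *)

Section Degrees.
Variable L : fieldType.
Hypothesis natL : forall k, (k.+1%:R : L) != 0.
Implicit Types u v w : {poly L}.

Definition dg u := (size u).-1.

Lemma dg_size u : u != 0 -> size u = (dg u).+1.
Proof. by move=> nz; rewrite /dg prednK // size_poly_gt0. Qed.

Lemma dgM u v : u != 0 -> v != 0 -> dg (u * v) = (dg u + dg v)%N.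
Proof. by move=> nzu nzv; rewrite /dg size_mul // !dg_size // addnS. Qed.

Lemma dgX u k : u != 0 -> dg (u ^+ k) = (k * dg u)%N.
Proof.
move=> nz; elim: k => [|k IH]; first by rewrite /dg expr0 size_poly1.
by rewrite exprS dgM ?expf_neq0 // IH mulSn.
Qed.

Lemma dg_prod (I : finType) (E : I -> {poly L}) :
  (forall i, E i != 0) -> dg (\prod_i E i) = (\sum_i dg (E i))%N.
Proof.
move=> nzE; suff [] : \prod_i E i != 0 /\ dg (\prod_i E i) = (\sum_i dg (E i))%N by [].
elim/big_ind2: _ => [|u1 x1 u2 x2 [nz1 E1] [nz2 E2]|//].
  by rewrite oner_neq0 /dg size_poly1.
by rewrite mulf_neq0 // dgM // E1 E2.
Qed.

Lemma dg_le u v : v != 0 -> (size u <= size v)%N -> (dg u <= dg v)%N.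
Proof. by rewrite /dg => nz le; lia. Qed.

Lemma size_deriv0 u : size u^`() = (size u).-1.
Proof.
have [le1|gt1] := leqP (size u) 1.
  by rewrite [u]size1_polyC // derivC size_poly0 size_polyC; case: (_ != _).
apply/eqP; rewrite eqn_leq; apply/andP; split.
  have nzu : u != 0 by rewrite -size_poly_gt0; lia.
  by have := lt_size_deriv nzu; lia.
rewrite leqNgt; apply/negP => lt_u'.
have: u^`()`_(size u).-2 = 0.
  by apply: nth_default; move: lt_u'; case: (size u) gt1 => [|[|k]].
rewrite coef_deriv; have -> : (size u).-2.+1 = (size u).-1 by lia.
rewrite -lead_coefE => /eqP; rewrite -mulr_natr mulf_eq0 lead_coef_eq0.
by rewrite -size_poly_eq0; case: (size u) gt1 => [|[|k]] // _; rewrite (negbTE (natL _)).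
Qed.

Lemma dg_deriv u : (0 < dg u)%N -> u^`() != 0 /\ dg u^`() = (dg u).-1.
Proof.
by rewrite /dg => gt0; rewrite -size_poly_gt0 !size_deriv0; split=> //; lia.
Qed.

Lemma dg0_deriv u : (dg u == 0)%N = (u^`() == 0).
Proof. by rewrite -size_poly_eq0 size_deriv0. Qed.

(** A nonzero derivative has smaller degree than u. *)
Lemma deriv_dvd_const u v : u^`() = u * v -> u^`() = 0.
Proof.
move=> E; have [->|nz] := eqVneq u^`() 0; first by [].
have nzu : u != 0 by apply: contraNneq nz => u0; rewrite u0 deriv0.
have nzv : v != 0 by apply: contraNneq nz => v0; rewrite E v0 mulr0.
have := lt_size_deriv nzu.
by rewrite {1}E size_mul // (dg_size nzv) addnS ltnNge leq_addr.
Qed.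

Lemma natr_inj k l : k%:R = l%:R :> L -> k = l.
Proof.
wlog le_kl : k l / (k <= l)%N => [W E|E].
  by case: (leqP k l) => [le|/ltnW le]; [apply: W|apply/esym/W].
have : (l - k)%:R = 0 :> L by rewrite natrB // E subrr.
case Er: (l - k)%N => [|r] /eqP; last by rewrite (negbTE (natL r)).
by move=> _; lia.
Qed.

Lemma lead_coef_deriv u : lead_coef u^`() = lead_coef u *+ dg u.
Proof.
have [le1|gt1] := leqP (size u) 1.
  have -> : dg u = 0%N by move: le1; rewrite /dg; case: (size u) => [|[]].
  by rewrite mulr0n {1}[u]size1_polyC // derivC lead_coef0.
rewrite !lead_coefE size_deriv0 coef_deriv /dg.
by move: gt1; case: (size u) => [|[]].
Qed.

(** Comparison of the leading coefficients. *)
Lemma wronskian_dg u v : u != 0 -> v != 0 -> u * v^`() = v * u^`() -> dg u = dg v.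
Proof.
move=> nzu nzv /(congr1 lead_coef); rewrite !lead_coefM !lead_coef_deriv !mulrnAr.
rewrite [lead_coef v * _]mulrC -[LHS]mulr_natr -[RHS]mulr_natr.
by move/mulfI => E; apply/esym/natr_inj/E; rewrite mulf_neq0 ?lead_coef_eq0.
Qed.

(** A factor of the monomial of multiplicity b_i keeps multiplicity b_i - 1 in
    the derivative, and a common factor Y of the derivatives of the variables
    is gained on top. *)
Lemma deriv_monomial (I : finType) (z : I -> {poly L}) (b : I -> nat) Y :
  (forall i, 0 < b i)%N -> (forall i, exists w, (z i)^`() = Y * w) ->
  exists w, (\prod_i z i ^+ b i)^`() = \prod_i z i ^+ (b i).-1 * (Y * w).
Proof.
move=> b_gt0 zY; elim: (index_enum I) => [|i s [w IH]].
  by exists 0; rewrite !big_nil derivC !mulr0.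
have [wi Ei] := zY i; rewrite !big_cons derivM IH deriv_exp Ei.
exists ((b i)%:R * wi * \prod_(j <- s) z j + z i * w).
have -> : \prod_(j <- s) z j ^+ b j = \prod_(j <- s) z j ^+ (b j).-1 * \prod_(j <- s) z j.
  by rewrite -big_split; apply: eq_bigr => j _; rewrite /= -exprSr prednK.
have -> : z i ^+ b i = z i ^+ (b i).-1 * z i by rewrite -exprSr prednK.
by rewrite -mulr_natr; ring.
Qed.

End Degrees.

(** The setting is the curve traced by the flow of a locally nilpotent
    derivation that kills x: y is the only one of the y_i that moves, or y = 1
    when none does, and C gathers x and the resting y_i. *)
Section Mason.
Variable L : fieldType.
Hypothesis natL : forall k, (k.+1%:R : L) != 0.

Lemma sum_double_le (I : finType) (b d : I -> nat) : (forall i, 2 <= b i)%N ->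
  (2 * \sum_i d i <= \sum_i b i * d i)%N.
Proof.
by move=> b2; rewrite big_distrr; apply: leq_sum => i _; rewrite leq_mul2r b2 orbT.
Qed.

Lemma sum_double_eq (I : finType) (b d : I -> nat) : (forall i, 2 <= b i)%N ->
  (\sum_i b i * d i <= 2 * \sum_i d i)%N -> forall i, d i = 0%N \/ b i = 2%N.
Proof.
move=> b2 le i.
have: (\sum_i (b i - 2) * d i = 0)%N.
  have: (\sum_i b i * d i = \sum_i (b i - 2) * d i + 2 * \sum_i d i)%N.
    rewrite big_distrr -big_split; apply: eq_bigr => k _ /=.
    by rewrite -mulnDl subnK.
  by move=> E; lia.
move/eqP; rewrite sum_nat_eq0 => /forallP /(_ i) /=.
rewrite muln_eq0 subn_eq0 => /orP [le2|/eqP ->]; last by left.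
by right; apply/eqP; rewrite eqn_leq le2 b2.
Qed.

Variables (p q : nat) (b : 'I_p -> nat) (c : 'I_q -> nat).
Variables (z : 'I_p -> {poly L}) (s : 'I_q -> {poly L}).
Variables (y : {poly L}) (A : nat) (C : L).
Hypothesis b_ge2 : forall j, (2 <= b j)%N.
Hypothesis c_ge2 : forall l, (2 <= c l)%N.
Hypothesis nz_z : forall j, z j != 0.
Hypothesis nz_s : forall l, s l != 0.
Hypothesis nz_y : y != 0.
Hypothesis size_y : (size y <= 2)%N.
Hypothesis A_gt0 : (0 < A)%N.
Hypothesis nz_C : C != 0.
Hypothesis zY : forall j, exists w, (z j)^`() = y ^+ A.-1 * w.
Hypothesis sY : forall l, exists w, (s l)^`() = y ^+ A.-1 * w.
Hypothesis curve :
  \prod_j z j ^+ b j + \prod_l s l ^+ c l = C *: y ^+ A.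

Local Notation f := (\prod_j z j ^+ b j).
Local Notation g := (\prod_l s l ^+ c l).

(** If y is not constant, y ^ (A - 1) divides the nonzero derivative of u,
    which has degree deg u - 1; hence deg u is at least A. *)
Lemma nonconst_dg u w : u != 0 -> (0 < dg u)%N -> u^`() = y ^+ A.-1 * w ->
  (A * dg y < 2 * dg u)%N.
Proof.
move=> nzu gt0 E; have [nzu' Eu'] := dg_deriv natL gt0.
have nzw : w != 0 by apply: contraNneq nzu' => w0; rewrite E w0 mulr0.
have := Eu'; rewrite E dgM ?expf_neq0 // dgX // => Ed.
have : (dg y <= 1)%N by rewrite /dg; lia.
case: (dg y) Ed => [|[|k]] // Ed _; first by rewrite muln0; lia.
by move: Ed; rewrite !muln1; lia.
Qed.

Lemma f_neq0 : f != 0.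
Proof. by apply/prodf_neq0 => j _; rewrite expf_neq0. Qed.
Lemma g_neq0 : g != 0.
Proof. by apply/prodf_neq0 => j _; rewrite expf_neq0. Qed.
Lemma P_neq0 : C *: y ^+ A != 0.
Proof. by rewrite scaler_eq0 negb_or nz_C expf_neq0. Qed.
Lemma dgP : dg (C *: y ^+ A) = (A * dg y)%N.
Proof. by rewrite -mul_polyC dgM ?polyC_eq0 ?expf_neq0 // dgX // /dg size_polyC nz_C. Qed.
Lemma dgf : dg f = (\sum_j b j * dg (z j))%N.
Proof. by rewrite dg_prod => [|j]; [apply: eq_bigr => j _; rewrite dgX|rewrite expf_neq0]. Qed.
Lemma dgg : dg g = (\sum_l c l * dg (s l))%N.
Proof. by rewrite dg_prod => [|j]; [apply: eq_bigr => j _; rewrite dgX|rewrite expf_neq0]. Qed.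

Lemma lead_cancel (u v w : {poly L}) : u != 0 -> u + v = w -> (size w < size u)%N ->
  size v = size u /\ lead_coef u + lead_coef v = 0.
Proof.
move=> nzu E lt; have Ev : v = w - u by rewrite -E addrC addKr.
have sv : size v = size u by rewrite Ev addrC size_polyDl size_polyN.
split=> //; rewrite !lead_coefE sv -coefD E nth_default //.
by rewrite -ltnS prednK // size_poly_gt0.
Qed.

(** An inequality of the kind of Mason and Stothers. The Wronskian of f and f
    + g = C y ^ A is divisible by the repeated factors of f and g and by y ^
    (A - 1). What remains after removing y ^ (A - 1) has degree at most deg f,
    since y has degree at most 1; so the repeated factors, of degree 2 deg f
    minus the sum of the degrees of the z_j and s_l, have degree at most deg
    f. *)
Lemma moving_curve : (dg (C *: y ^+ A) < dg f)%N -> dg g = dg f ->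
  (dg f <= \sum_j dg (z j) + \sum_l dg (s l))%N.
Proof.
move=> lt_f eq_g; have [v Ev] := deriv_monomial (fun j => ltnW (b_ge2 j)) zY.
have [w Ew] := deriv_monomial (fun l => ltnW (c_ge2 l)) sY.
pose f1 := \prod_j z j ^+ (b j).-1; pose g1 := \prod_l s l ^+ (c l).-1.
rewrite -/f1 in Ev; rewrite -/g1 in Ew.
have nzf1 : f1 != 0 by apply/prodf_neq0 => j _; rewrite expf_neq0.
have nzg1 : g1 != 0 by apply/prodf_neq0 => j _; rewrite expf_neq0.
pose f0 := \prod_j z j; pose g0 := \prod_l s l.
have Ef : f = f1 * f0.
  rewrite /f1 /f0 -big_split; apply: eq_bigr => j _.
  by rewrite /= -exprSr prednK // ltnW.
have Eg : g = g1 * g0.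
  rewrite /g1 /g0 -big_split; apply: eq_bigr => j _.
  by rewrite /= -exprSr prednK // ltnW.
have nzY : y ^+ A.-1 != 0 by rewrite expf_neq0.
pose P : {poly L} := C *: y ^+ A.
have EP : P^`() = (C *+ A) *: (y^`() * y ^+ A.-1).
  by rewrite derivZ deriv_exp -scaler_nat scalerA mulr_natr mulrC.
pose W0 := (C *+ A) *: (y^`() * f) - C *: (y * f^`()).
have EW : y ^+ A.-1 * W0 = f * P^`() - P * f^`().
  have EyA : y ^+ A = y * y ^+ A.-1 by rewrite -exprS prednK.
  rewrite EP /W0 /P EyA -!mul_polyC; move: (y ^+ A.-1) (C *+ A)%:P => Y CA; ring.
have EW1 : W0 = f1 * g1 * (f0 * w - g0 * v).
  apply: (mulfI nzY); rewrite EW.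
  have -> : P = f + g by rewrite curve.
  by rewrite derivD Ev Ew Ef Eg; ring.
have nzW0 : W0 != 0.
  apply/eqP => W00; move/eqP: EW; rewrite W00 mulr0 eq_sym subr_eq0 => /eqP.
  by move/(wronskian_dg natL f_neq0 P_neq0) => E; rewrite E ltnn in lt_f.
have le1 : (dg f1 + dg g1 <= dg W0)%N.
  rewrite EW1 dgM ?mulf_neq0 //; first by rewrite dgM // leq_addr.
  by apply: contraNneq nzW0 => E; rewrite EW1 E mulr0.
have le2 : (dg W0 <= dg f)%N.
  apply: dg_le; first exact: f_neq0.
  rewrite (leq_trans (size_polyD _ _)) // geq_max size_polyN.
  rewrite !(leq_trans (size_scale_leq _ _)) // (leq_trans (size_polyMleq _ _)) //.
    rewrite size_deriv0 // (dg_size f_neq0); move: size_y.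
    by move: (dg f) (size y) => k k' /= ?; lia.
  rewrite size_deriv0 // (dg_size f_neq0); move: size_y.
  by move: (dg f) (size y) => k k' /= ?; lia.
have := dg_prod (fun j => expf_neq0 (b j).-1 (nz_z j)).
have := dg_prod (fun j => expf_neq0 (c j).-1 (nz_s j)).
rewrite -/f1 -/g1 => Eg1 Ef1.
have := dgM nzf1 (_ : f0 != 0); rewrite -Ef => -> //; last exact/prodf_neq0.
have := dgM nzg1 (_ : g0 != 0); rewrite -Eg => Egg.
have {}Egg := Egg ltac:(exact/prodf_neq0).
rewrite -!dg_prod //-/f0 -/g0.
have Eff : dg f = (dg f1 + dg f0)%N by rewrite Ef dgM //; apply/prodf_neq0.
by lia.
Qed.

(** All exponents being at least 2, twice the sum of the degrees of the z_j
    and s_l is at most deg f + deg g = 2 deg f; thus moving_curve is an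
    equality, and so is each of these estimates. *)
Lemma moving_curve_exponents : (dg (C *: y ^+ A) < dg f)%N -> dg g = dg f ->
  [/\ forall j, dg (z j) = 0%N \/ b j = 2%N,
      forall l, dg (s l) = 0%N \/ c l = 2%N,
      exists j, b j = 2%N &
      exists l, c l = 2%N].
Proof.
move=> lt_f eq_g; have le := moving_curve lt_f eq_g.
have b2 := sum_double_le (fun j => dg (z j)) b_ge2.
have c2 := sum_double_le (fun l => dg (s l)) c_ge2.
have Ef := dgf; have Eg := dgg; rewrite -Ef -Eg in b2 c2.
have Hz : forall j, dg (z j) = 0%N \/ b j = 2%N.
  by apply: sum_double_eq => //; rewrite -Ef; lia.
have Hs : forall j, dg (s j) = 0%N \/ c j = 2%N.
  by apply: sum_double_eq => //; rewrite -Eg; lia.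
have pos (I : finType) (d e : I -> nat) : (0 < \sum_i e i * d i)%N ->
    (forall i, d i = 0%N \/ e i = 2%N) -> exists i, e i = 2%N.
  rewrite lt0n sum_nat_eq0 negb_forall => /existsP [i]; rewrite muln_eq0 negb_or.
  by move=> /andP [_ nz] /(_ i) [d0|]; [rewrite d0 in nz|exists i].
split=> //; first by apply: pos Hz; rewrite -Ef; lia.
by apply: pos Hs; rewrite -Eg eq_g; lia.
Qed.

(** If a coordinate moves, nonconst_dg makes the degree of its monomial larger
    than that of C y ^ A. The two monomials then have the same degree and
    cancelling leading terms, and moving_curve_exponents applies. *)
Lemma mason :
  ((forall j, (z j)^`() = 0) /\ (forall l, (s l)^`() = 0)) \/
  [/\ [/\ forall j, dg (z j) = 0%N \/ b j = 2%N,
      forall l, dg (s l) = 0%N \/ c l = 2%N,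
      exists j, b j = 2%N &
      exists l, c l = 2%N] &
      \prod_j lead_coef (z j) ^+ b j + \prod_l lead_coef (s l) ^+ c l = 0].
Proof.
have lcE : lead_coef f + lead_coef g = 0 ->
    \prod_j lead_coef (z j) ^+ b j + \prod_l lead_coef (s l) ^+ c l = 0.
  by rewrite !lead_coef_prod => <-; congr (_ + _); apply: eq_bigr => i _;
     rewrite lead_coef_exp.
have szP := dg_size P_neq0; have szf := dg_size f_neq0; have szg := dg_size g_neq0.
have [/forallP z0|] := boolP [forall j, dg (z j) == 0%N]; last first.
  rewrite negb_forall => /existsP [j]; rewrite -lt0n => gt0; right.
  have lt_f : (dg (C *: y ^+ A) < dg f)%N.
    have [w Ew] := zY j; have := nonconst_dg (nz_z j) gt0 Ew.
    rewrite dgP dgf (bigD1 j) //= => /leq_trans -> //.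
    by rewrite (leq_trans _ (leq_addr _ _)) // leq_mul2r b_ge2 orbT.
  have [|szE lc] := lead_cancel f_neq0 curve; first by lia.
  by split; [apply: moving_curve_exponents => //; lia|apply: lcE].
have [/forallP s0|] := boolP [forall l, dg (s l) == 0%N].
  by left; split=> i; apply/eqP; rewrite -dg0_deriv.
rewrite negb_forall => /existsP [l]; rewrite -lt0n => gt0; right.
have lt_g : (dg (C *: y ^+ A) < dg g)%N.
  have [w Ew] := sY l; have := nonconst_dg (nz_s l) gt0 Ew.
  rewrite dgP dgg (bigD1 l) //= => /leq_trans -> //.
  by rewrite (leq_trans _ (leq_addr _ _)) // leq_mul2r c_ge2 orbT.
have [|szE lc] := lead_cancel g_neq0 (etrans (addrC _ _) curve); first by lia.
by split; [apply: moving_curve_exponents => //; lia|apply: lcE; rewrite addrC].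
Qed.

End Mason.

(** * Exponentials of locally nilpotent derivations *)

Section Nilpotent.
Variables (n : nat) (K : comNzRingType) (L : fieldType).
Hypothesis natL : forall k, (k.+1%:R : L) != 0.
Variable rho : {rmorphism {mpoly K[n]} -> L}.

(** The derivation with components g induces a derivation of the image of
    rho. *)
Definition tangent (g : 'I_n -> {mpoly K[n]}) :=
  forall f, rho f = 0 -> rho (Der g f) = 0.

Definition nilp_at (g : 'I_n -> {mpoly K[n]}) f :=
  exists r, rho (iter r (Der g) f) = 0.

Variable g : 'I_n -> {mpoly K[n]}.
Hypothesis tang : tangent g.
Local Notation D := (Der g).

Lemma tangent_iter f r : rho f = 0 -> rho (iter r D f) = 0.
Proof. by move=> f0; elim: r => //= r IH; apply: tang. Qed.

Lemma tangent_iter_ge f r s : (r <= s)%N -> rho (iter r D f) = 0 -> rho (iter s D f) = 0.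
Proof. by move=> /subnK <- ?; rewrite iterD; apply: tangent_iter. Qed.

Lemma nilp_atD f h : nilp_at g f -> nilp_at g h -> nilp_at g (f + h).
Proof.
move=> [r r0] [s s0]; exists (r + s)%N.
rewrite Der_iterD rmorphD /= (tangent_iter_ge _ r0) ?leq_addr //.
by rewrite (tangent_iter_ge _ s0) ?leq_addl // addr0.
Qed.

Lemma nilp_atM f h : nilp_at g f -> nilp_at g h -> nilp_at g (f * h).
Proof.
move=> [r r0] [s s0]; exists (r + s)%N.
rewrite Der_iterM raddf_sum big1 // => i _ /=; rewrite rmorphMn rmorphM /=.
have [le_ri|lt_ir] := leqP r i.
  by rewrite (tangent_iter_ge le_ri r0) mul0r mul0rn.
by rewrite (tangent_iter_ge _ s0) ?mulr0 ?mul0rn //; lia.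
Qed.

Lemma nilp_atC u : nilp_at g u%:MP.
Proof. by exists 1%N; rewrite /= DerC rmorph0. Qed.

Lemma nilp_at_Der f : nilp_at g (D f) -> nilp_at g f.
Proof. by move=> [r r0]; exists r.+1; rewrite iterSr. Qed.

Lemma nilp_at_all : (forall k, nilp_at g 'X_k) -> forall f, nilp_at g f.
Proof.
move=> gX; elim/mmap_ind => // [u|f h|f h]; [exact: nilp_atC|exact: nilp_atD|].
exact: nilp_atM.
Qed.

Hypothesis nilpX : forall k, nilp_at g 'X_k.

Lemma nilp_ex f : exists r, rho (iter r D f) == 0.
Proof. by have [r r0] := nilp_at_all nilpX f; exists r; apply/eqP. Qed.

Definition nilp_order f := ex_minn (nilp_ex f).

Lemma nilp_orderP f r : (nilp_order f <= r)%N -> rho (iter r D f) = 0.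
Proof.
by rewrite /nilp_order; case: ex_minnP => s /eqP s0 _ /tangent_iter_ge; apply.
Qed.

(** The Taylor expansion of f along the flow of the derivation: a polynomial
    in the time, with coefficients in the field L. *)
Definition texp f : {poly L} :=
  \poly_(r < nilp_order f) (rho (iter r D f) / (r`!)%:R).

Lemma coef_texp f r : (texp f)`_r = rho (iter r D f) / (r`!)%:R.
Proof.
by rewrite coef_poly; case: leqP => // /nilp_orderP ->; rewrite mul0r.
Qed.

Lemma fact_neq0 r : (r`!%:R : L) != 0.
Proof. by have := fact_gt0 r; case: (r`!) => // k _; apply: natL. Qed.

Lemma texpD : {morph texp : f h / f + h}.
Proof.
by move=> f h; apply/polyP => r; rewrite coefD !coef_texp Der_iterD rmorphD mulrDl.
Qed.

Lemma texpM : {morph texp : f h / f * h}.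
Proof.
move=> f h; apply/polyP => r; rewrite coefM coef_texp Der_iterM raddf_sum mulr_suml.
apply: eq_bigr => i _; rewrite !coef_texp /= rmorphMn rmorphM /=.
have le_ir : (i <= r)%N by rewrite -ltnS.
rewrite -mulr_natr -(bin_fact le_ir) !natrM.
have nzC : ('C(r, i)%:R : L) != 0.
  by have := bin_gt0 r i; rewrite le_ir; case: ('C(r, i)) => // k _; apply: natL.
by field; rewrite nzC !fact_neq0.
Qed.

Lemma texpC u : texp u%:MP = (rho u%:MP)%:P.
Proof.
apply/polyP => -[|r]; rewrite coef_texp coefC //=; first by rewrite divr1.
have -> : D (iter r D u%:MP) = 0 by elim: r => [|r IH] /=; rewrite ?DerC // IH Der0.
by rewrite rmorph0 mul0r.
Qed.

Lemma texp1 : texp 1 = 1.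
Proof. by rewrite -mpolyC1 texpC mpolyC1 rmorph1. Qed.

Lemma texp_deriv f : (texp f)^`() = texp (D f).
Proof.
apply/polyP => r; rewrite coef_deriv !coef_texp -iterSr factS natrM -[LHS]mulr_natr.
by rewrite invfM [X in rho _ * X]mulrC mulrA divfK ?natL.
Qed.

Lemma texp_coef0 f : (texp f)`_0 = rho f.
Proof. by rewrite coef_texp divr1. Qed.

Lemma texp_eq0 f : rho f = 0 -> texp f = 0.
Proof.
by move=> f0; apply/polyP => r; rewrite coef_texp coef0 tangent_iter // mul0r.
Qed.

Lemma texp_neq0 f : rho f != 0 -> texp f != 0.
Proof. by apply: contraNneq => f0; rewrite -texp_coef0 f0 coef0. Qed.

Lemma texpX f k : texp (f ^+ k) = texp f ^+ k.
Proof. by elim: k => [|k IH]; rewrite ?expr0 ?texp1 // !exprS texpM IH. Qed.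

Lemma texp_prod (I : Type) (s : seq I) (P : pred I) E :
  texp (\prod_(i <- s | P i) E i) = \prod_(i <- s | P i) texp (E i).
Proof. exact: (big_morph _ texpM texp1). Qed.

(** Along the flow, f is a polynomial in the time that divides its derivative. *)
Lemma nilp_dvd f h : rho (D f) = rho (f * h) -> rho (D f) = 0.
Proof.
move=> E; have Et : texp (D f) = texp (f * h).
  apply/eqP; rewrite -subr_eq0; apply/eqP.
  have -> : texp (D f) - texp (f * h) = texp (D f - f * h).
    by apply/eqP; rewrite subr_eq -texpD subrK.
  by apply: texp_eq0; rewrite rmorphB E subrr.
by rewrite -texp_coef0 -texp_deriv (@deriv_dvd_const _ (texp f) (texp h)) ?coef0 //
  texp_deriv Et texpM.
Qed.

Lemma texp_const f : rho (D f) = 0 -> texp f = (rho f)%:P.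
Proof.
move=> Df; apply/polyP => -[|r]; rewrite coef_texp coefC //=; first by rewrite divr1.
by rewrite -iterS iterSr tangent_iter // mul0r.
Qed.

End Nilpotent.

(** * Weights and lowest components *)

Section Weights.
Variables (n : nat) (K : idomainType).
Local Notation M := {mpoly K[n]}.
Implicit Types (w : 'I_n -> int) (f h : M) (mm : 'X_{1..n}) (d e : int).

Definition wt w mm : int := \sum_(k < n) w k *+ mm k.

Lemma wtD w m1 m2 : wt w (m1 + m2)%MM = wt w m1 + wt w m2.
Proof. by rewrite -big_split; apply: eq_bigr => k _; rewrite mnmDE mulrnDr. Qed.

Lemma wt1 w k : wt w U_(k)%MM = w k.
Proof.
rewrite /wt (bigD1 k) //= mnm1E eqxx big1 ?addr0 // => j /negbTE ne.
by rewrite mnm1E eq_sym ne.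
Qed.

Definition whom w d f := forall mm, mm \in msupp f -> wt w mm = d.
Definition wge w d f := forall mm, mm \in msupp f -> d <= wt w mm.

Definition wcomp w d f : M :=
  \sum_(mm <- msupp f | wt w mm == d) f@_mm *: 'X_[mm].

Lemma mcoeff_wcomp w d f mm :
  (wcomp w d f)@_mm = if wt w mm == d then f@_mm else 0.
Proof.
rewrite /wcomp raddf_sum /=.
under eq_bigr => m' _ do rewrite mcoeffZ mcoeffX.
have [s_m|s_m] := boolP (mm \in msupp f); last first.
  rewrite (memN_msupp_eq0 s_m) if_same big1_seq // => m' /andP [_ s_m'].
  by case: eqP s_m' s_m => [->|_] => [-> //|]; rewrite mulr0.
rewrite -big_filter; case: ifP => [wm|/negbT wm].
  rewrite (bigD1_seq mm) ?filter_uniq ?msupp_uniq ?mem_filter ?wm //=.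
  by rewrite eqxx mulr1 big1 ?addr0 // => m' /negbTE ->; rewrite mulr0.
rewrite big1_seq // => m' /andP [_]; rewrite mem_filter => /andP [wm' _] /=.
have [Em|_] := eqVneq m' mm; last by rewrite mulr0.
by move: wm; rewrite -Em wm'.
Qed.

Lemma wcompB w d : {morph wcomp w d : f h / f - h}.
Proof.
move=> f h; apply/mpolyP => mm; rewrite mcoeffB !mcoeff_wcomp mcoeffB.
by case: ifP; rewrite ?subrr.
Qed.

Lemma wcompD w d : {morph wcomp w d : f h / f + h}.
Proof.
move=> f h; apply/mpolyP => mm; rewrite mcoeffD !mcoeff_wcomp mcoeffD.
by case: ifP; rewrite ?addr0.
Qed.

Lemma msupp_wcomp w d f mm :
  mm \in msupp (wcomp w d f) -> mm \in msupp f /\ wt w mm = d.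
Proof. by rewrite !mcoeff_msupp mcoeff_wcomp; case: ifP => [/eqP|]; rewrite ?eqxx. Qed.

Lemma whom_wcomp w d f : whom w d (wcomp w d f).
Proof. by move=> mm /msupp_wcomp []. Qed.

Lemma wcomp_id w d f : whom w d f -> wcomp w d f = f.
Proof.
move=> wf; apply/mpolyP => mm; rewrite mcoeff_wcomp; case: eqP => // ne.
by apply/esym/eqP; rewrite mcoeff_eq0; apply/negP => /wf.
Qed.

Lemma wcomp_eq0 w d f : (forall mm, mm \in msupp f -> wt w mm != d) -> wcomp w d f = 0.
Proof.
move=> wf; apply/mpolyP => mm; rewrite mcoeff_wcomp mcoeff0; case: eqP => // wm.
by apply/eqP; rewrite mcoeff_eq0; apply/negP => /wf; rewrite wm eqxx.
Qed.

Lemma msuppM f h mm : mm \in msupp (f * h) ->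
  exists m1 m2, [/\ m1 \in msupp f, m2 \in msupp h & mm = (m1 + m2)%MM].
Proof. by move/msuppM_le/allpairsP => [[m1 m2] /= [s1 s2 ->]]; exists m1, m2. Qed.

Lemma whomM w d e f h : whom w d f -> whom w e h -> whom w (d + e) (f * h).
Proof. by move=> wf wh mm /msuppM [m1 [m2 [s1 s2 ->]]]; rewrite wtD wf ?wh. Qed.

Lemma wgeM w d e f h : wge w d f -> wge w e h -> wge w (d + e) (f * h).
Proof. by move=> wf wh mm /msuppM [m1 [m2 [s1 s2 ->]]]; rewrite wtD lerD ?wf ?wh. Qed.

Lemma wgeD w d f h : wge w d f -> wge w d h -> wge w d (f + h).
Proof. by move=> wf wh mm /msuppD_le; rewrite mem_cat => /orP [/wf|/wh]. Qed.

Lemma whom_wge w d f : whom w d f -> wge w d f.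
Proof. by move=> wf mm /wf ->. Qed.

Lemma whom0 w d : whom w d 0.
Proof. by move=> mm; rewrite msupp0. Qed.

Lemma wge0 w d : wge w d 0.
Proof. by move=> mm; rewrite msupp0. Qed.

Lemma whomD w d f h : whom w d f -> whom w d h -> whom w d (f + h).
Proof. by move=> wf wh mm /msuppD_le; rewrite mem_cat => /orP [/wf|/wh]. Qed.

Lemma whomX w k : whom w (w k) 'X_k.
Proof. by move=> mm; rewrite msuppX inE => /eqP ->; rewrite wt1. Qed.

Lemma msupp_deriv k f mm : mm \in msupp f^`M(k) -> (mm + U_(k))%MM \in msupp f.
Proof.
rewrite !mcoeff_msupp mcoeff_deriv; apply: contraNneq => ->; by rewrite mul0rn.
Qed.

Lemma whom_deriv w d k f : whom w d f -> whom w (d - w k) f^`M(k).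
Proof. by move=> wf mm /msupp_deriv /wf; rewrite wtD wt1 => <-; rewrite addrK. Qed.

Lemma wge_deriv w d k f : wge w d f -> wge w (d - w k) f^`M(k).
Proof. by move=> wf mm /msupp_deriv /wf; rewrite wtD wt1 lerBlDr. Qed.

Lemma whom_Der w d e f (g : 'I_n -> M) :
  (forall k, whom w (w k + e) (g k)) -> whom w d f -> whom w (d + e) (Der g f).
Proof.
move=> wg wf; rewrite /Der; elim/big_ind: _ => [|u v|k _]; first exact: whom0.
  exact: whomD.
have -> : d + e = (d - w k) + (w k + e) by lia.
by apply: whomM; [apply: whom_deriv|].
Qed.

Lemma sum_wcomp w f :
  f = \sum_(d <- undup [seq wt w mm | mm <- msupp f]) wcomp w d f.
Proof.
apply/mpolyP => mm; rewrite raddf_sum /=.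
under eq_bigr => d _ do rewrite mcoeff_wcomp.
have [s_m|s_m] := boolP (mm \in msupp f); last first.
  by rewrite (memN_msupp_eq0 s_m) big1 // => d _; rewrite if_same.
rewrite (bigD1_seq (wt w mm)) ?undup_uniq //=; last first.
  by rewrite mem_undup; apply: map_f.
by rewrite eqxx big1 ?addr0 // => d /negbTE; rewrite eq_sym => ->.
Qed.

End Weights.

Section LowestComponent.
Variables (n : nat) (K : idomainType) (L : fieldType).
Local Notation M := {mpoly K[n]}.
Variables (rho : {rmorphism M -> L}) (F : M).
Hypothesis rho0 : forall f, rho f = 0 <-> exists h, f = h * F.
Variable w : 'I_n -> int.
Hypothesis F_hom : whom w 0 F.
Implicit Types (f h : M) (g : 'I_n -> M) (d e : int).

Lemma rho_mulF h : rho (h * F) = 0.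
Proof. by apply/rho0; exists h. Qed.

Lemma tangentP g : rho (Der g F) = 0 -> tangent rho g.
Proof.
move=> DF f /rho0 [h ->]; rewrite DerM rmorphD !rmorphM /= DF mulr0 addr0.
by rewrite -rmorphM rho_mulF.
Qed.

Lemma wcomp_mulF d h : wcomp w d (h * F) = wcomp w d h * F.
Proof.
rewrite -{1}(subrK (wcomp w d h) h) mulrDl wcompD.
rewrite (@wcomp_id _ _ _ _ (wcomp w d h * F)); last first.
  by have := whomM (@whom_wcomp _ _ w d h) F_hom; rewrite addr0.
rewrite wcomp_eq0 ?add0r // => mm /msuppM [m1 [m2 [s1 s2 ->]]].
rewrite wtD (F_hom s2) addr0; apply: contraTneq s1 => w1.
by rewrite mcoeff_msupp mcoeffB mcoeff_wcomp w1 eqxx subrr eqxx.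
Qed.

(** The filtration by weight of the quotient by F. *)
Definition fil d f := exists h, wge w d (f - h * F).

Lemma fil_wge d f : wge w d f -> fil d f.
Proof. by exists 0; rewrite mul0r subr0. Qed.

Lemma fil_rho0 d f : rho f = 0 -> fil d f.
Proof. by move/rho0 => [h ->]; exists h; rewrite subrr; apply: wge0. Qed.

Lemma filD d f h : fil d f -> fil d h -> fil d (f + h).
Proof.
move=> [h1 E1] [h2 E2]; exists (h1 + h2).
have -> : f + h - (h1 + h2) * F = (f - h1 * F) + (h - h2 * F) by ring.
exact: wgeD.
Qed.

Lemma filN d f : fil d f -> fil d (- f).
Proof.
move=> [h E]; exists (- h); have -> : - f - - h * F = - (f - h * F) by ring.
by move=> mm; rewrite (perm_mem (msuppN _)) => /E.
Qed.

Lemma filM d e f h : fil d f -> fil e h -> fil (d + e) (f * h).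
Proof.
move=> [h1 E1] [h2 E2]; exists (h1 * h + f * h2 - h1 * h2 * F).
have -> : f * h - (h1 * h + f * h2 - h1 * h2 * F) * F = (f - h1 * F) * (h - h2 * F).
  by ring.
exact: wgeM.
Qed.

Lemma fil_sum d (I : Type) (s : seq I) (E : I -> M) :
  (forall i, fil d (E i)) -> fil d (\sum_(i <- s) E i).
Proof.
by move=> fE; elim/big_ind: _ => // [|u v]; [apply: fil_rho0; rewrite rmorph0|apply: filD].
Qed.

Lemma fil_Der_wge g d e f : (forall k, fil (w k + e) (g k)) -> wge w d f ->
  fil (d + e) (Der g f).
Proof.
move=> fg wf; apply: fil_sum => k.
have -> : d + e = (d - w k) + (w k + e) by lia.
by apply: filM => //; apply/fil_wge/wge_deriv.
Qed.

Lemma fil_Der g d e f : tangent rho g -> (forall k, fil (w k + e) (g k)) ->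
  fil d f -> fil (d + e) (Der g f).
Proof.
move=> tg fg [h E]; rewrite -(subrK (h * F) f) DerD; apply: filD.
  exact: fil_Der_wge.
by apply: fil_rho0; apply: tg; apply: rho_mulF.
Qed.

Lemma fil_whom0 d e f : whom w d f -> d < e -> fil e f -> rho f = 0.
Proof.
move=> wf lt_de [h E]; apply/rho0; exists (wcomp w d h).
rewrite -wcomp_mulF -{1}(wcomp_id wf) -[f in LHS](subrK (h * F)) wcompD.
rewrite wcomp_eq0 ?add0r // => mm /E; apply: contraTneq => ->.
by rewrite -ltNge.
Qed.

Lemma fil_subcomp d f : fil d f -> fil (d + 1) (f - wcomp w d f).
Proof.
move=> [h E]; exists (h - wcomp w d h).
have -> : f - wcomp w d f - (h - wcomp w d h) * F =
   (f - h * F) - wcomp w d (f - h * F) by rewrite wcompB wcomp_mulF; ring.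
move=> mm; rewrite mcoeff_msupp mcoeffB mcoeff_wcomp.
case: (eqVneq (wt w mm) d) => [_|ne].
  by rewrite subrr eqxx.
rewrite subr0 -mcoeff_msupp => /E; move: ne; lia.
Qed.

Variable g : 'I_n -> M.
Hypothesis tang : tangent rho g.

(** The weights occurring in g are bounded below, which gives a starting
    degree. The degree can be raised as long as the components of that degree
    vanish modulo F, and this stops because some g k is nonzero. *)
Lemma lowest_degree : (exists k, rho (g k) != 0) ->
  exists e, (forall k, fil (w k + e) (g k)) /\
            (exists k, rho (wcomp w (w k + e) (g k)) != 0).
Proof.
move=> [k0 nz_k0].
pose B := (\sum_k \sum_(mm <- msupp (g k)) `|wt w mm - w k|)%N.
have leB k mm : mm \in msupp (g k) -> `|wt w mm - w k|%N%:Z <= B%:Z.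
  move=> s_mm; rewrite lez_nat /B (bigD1 k) //= (bigD1_seq mm) ?msupp_uniq //=.
  by rewrite -addnA leq_addr.
have start k : fil (w k + - B%:Z) (g k).
  by apply: fil_wge => mm /leB; lia.
suff [N [fN [k nz_k]]] : exists N : nat, (forall k, fil (w k + (N%:Z - B%:Z)) (g k)) /\
    (exists k, rho (wcomp w (w k + (N%:Z - B%:Z)) (g k)) != 0).
  by exists (N%:Z - B%:Z); split=> //; exists k.
have step N : (forall k, fil (w k + (N%:Z - B%:Z)) (g k)) ->
    (forall k, rho (wcomp w (w k + (N%:Z - B%:Z)) (g k)) = 0) ->
    forall k, fil (w k + (N.+1%:Z - B%:Z)) (g k).
  move=> fN c0 k; rewrite -(subrK (wcomp w (w k + (N%:Z - B%:Z)) (g k)) (g k)).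
  apply: filD; last exact: fil_rho0.
  have -> : w k + (N.+1%:Z - B%:Z) = w k + (N%:Z - B%:Z) + 1 by lia.
  exact: fil_subcomp.
pose bad N := [exists k, rho (wcomp w (w k + (N%:Z - B%:Z)) (g k)) != 0].
have [N badN] : exists N, bad N.
  have [d nzd] : exists d, rho (wcomp w d (g k0)) != 0.
    have := nz_k0; rewrite {1}(sum_wcomp w (g k0)) raddf_sum /=.
    elim: (undup _) => [|d s IH]; first by rewrite big_nil eqxx.
    rewrite big_cons; have [->|nz _] := eqVneq (rho (wcomp w d (g k0))) 0.
      by rewrite add0r => /IH.
    by exists d.
  have [mm s_mm] : exists mm, mm \in msupp (wcomp w d (g k0)).
    case E: (msupp _) => [|mm s]; last by exists mm; rewrite inE eqxx.
    by move: nzd; rewrite (msuppnil0 E) rmorph0 eqxx.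
  have [s_g wd] := msupp_wcomp s_mm; have := leB _ _ s_g; rewrite wd => leBd.
  exists (absz (d - w k0 + B%:Z)); apply/existsP; exists k0.
  suff -> : w k0 + ((absz (d - w k0 + B%:Z))%:Z - B%:Z) = d by [].
  by rewrite gez0_abs; lia.
have exb : exists N, bad N by exists N.
exists (ex_minn exb); case: ex_minnP => {N badN} N /existsP [k nzk] minN.
split; last by exists k.
elim: N minN {k nzk} => [|N IH] minN; first by move=> k; rewrite sub0r; apply: start.
apply: step => [|k]; first by apply: IH => N' /minN; apply: ltnW.
apply/eqP; rewrite -[_ == _]negbK; apply/negP => nz.
by have /minN : bad N by [apply/existsP; exists k]; rewrite ltnn.
Qed.

Variable e : int.
Hypothesis fil_g : forall k, fil (w k + e) (g k).

Definition low k := wcomp w (w k + e) (g k).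

Lemma low_hom k : whom w (w k + e) (low k).
Proof. exact: whom_wcomp. Qed.

Let hi k := g k - low k.

Lemma Der_hi f : Der hi f = Der g f - Der low f.
Proof. by rewrite /Der -sumrB; apply: eq_bigr => k _; rewrite mulrBr. Qed.

Lemma fil_hi k : fil (w k + (e + 1)) (hi k).
Proof. by rewrite addrA; apply: fil_subcomp. Qed.

(** As F has weight 0, the lowest component of Der g F is Der low F; so this
    lies in the ideal of F. *)
Lemma low_tangent : tangent rho low.
Proof.
apply: tangentP; apply: (@fil_whom0 (0 + e) (e + 1)); first exact: whom_Der low_hom F_hom.
  lia.
have -> : Der low F = Der g F - Der hi F by rewrite Der_hi opprB addrC subrK.
apply: filD; first by apply: fil_rho0; apply: tang; rewrite -[F]mul1r rho_mulF.
apply: filN; rewrite -[e + 1]add0r; apply: fil_Der_wge; first exact: fil_hi.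
exact: whom_wge.
Qed.

Lemma hi_tangent : tangent rho hi.
Proof. by move=> f f0; rewrite Der_hi rmorphB (tang f0) (low_tangent f0) subr0. Qed.

(** The iterates of g and of its lowest component differ on 'X_k by terms of
    larger weight; if the former vanish, so does the homogeneous latter. *)
Lemma low_nilp : (forall k, nilp_at rho g 'X_k) -> forall k, nilp_at rho low 'X_k.
Proof.
move=> ng k; have [r r0] := ng k; exists r.
have fB s : fil (w k + e *+ s) (iter s (Der g) 'X_k).
  elim: s => [|s IH] /=; first by rewrite mulr0n addr0; apply/fil_wge/whom_wge/whomX.
  by rewrite mulrSr addrA; apply: fil_Der.
have fA s : fil (w k + e *+ s + 1) (iter s (Der low) 'X_k - iter s (Der g) 'X_k).
  elim: s => [|s IH] /=; first by rewrite subrr; apply: fil_rho0; rewrite rmorph0.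
  set A := iter s _ _ in IH *; set B := iter s _ _ in IH *.
  have -> : Der low A - Der g B = Der low (A - B) - Der hi B.
    by rewrite Der_hi DerB; ring.
  apply: filD.
    have -> : w k + e *+ s.+1 + 1 = (w k + e *+ s + 1) + e by rewrite mulrSr; lia.
    by apply: fil_Der low_tangent _ IH => j; apply/fil_wge/whom_wge/low_hom.
  apply: filN.
  have -> : w k + e *+ s.+1 + 1 = (w k + e *+ s) + (e + 1) by rewrite mulrSr; lia.
  by apply: fil_Der hi_tangent fil_hi (fB s).
apply: (@fil_whom0 (w k + e *+ r) (w k + e *+ r + 1)).
- elim: r {r0} => [|r IH] /=; first by rewrite mulr0n addr0; apply: whomX.
  by rewrite mulrSr addrA; apply: whom_Der low_hom IH.
- lia.
rewrite -(subrK (iter r (Der g) 'X_k) (iter r _ _)); apply: filD; first exact: fA.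
exact: fil_rho0.
Qed.

End LowestComponent.

(** * Parity of exponents in fields of rational functions *)

Lemma frac_numden (R : idomainType) (x : {fraction R}) :
  exists N D, D != 0 /\ x = @tofrac R N / @tofrac R D.
Proof.
elim/quotW: x => r; exists (frac r).1, (frac r).2.
have nzd := denom_ratioP r; split=> //.
have nzd' : @tofrac R (frac r).2 != 0 by rewrite tofrac_eq0.
apply: (mulIf nzd'); rewrite divfK //.
rewrite /tofrac; unlock FracField.tofrac; rewrite -[LHS]FracField.pi_mul.
apply/eqP; rewrite piE /FracField.equivf /FracField.mulf /=.
by rewrite !numden_Ratio ?mulf_neq0 ?oner_eq0 ?oner_neq0 // !mulr1 mulrC.
Qed.

Section Parity.
Variables (n : nat) (K : idomainType).
Local Notation M := {mpoly K[n]}.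
Local Notation tf := (@tofrac M).
Variable k : 'I_n.

(** The exponent of 'X_k in the leading monomial, modulo 2. As leading
    monomials multiply, this is a homomorphism from the nonzero rational
    functions to the group of order 2. *)
Definition par (x : {fraction M}) (e : bool) :=
  exists N D : M, [/\ N != 0, D != 0, x = tf N / tf D &
    e = odd (mlead N k) (+) odd (mlead D k)].

Lemma par_ex x : x != 0 -> exists e, par x e.
Proof.
have [N [D [nzD ->]]] := frac_numden x => nz.
exists (odd (mlead N k) (+) odd (mlead D k)), N, D; split=> //.
by apply: contraNneq nz => ->; rewrite tofrac0 mul0r.
Qed.

Lemma parM x y e e' : par x e -> par y e' -> par (x * y) (e (+) e').
Proof.
move=> [N [D [nzN nzD -> ->]]] [N' [D' [nzN' nzD' -> ->]]].
exists (N * N'), (D * D'); rewrite !mulf_neq0 //; split=> //.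
  by rewrite !tofracM invfM mulrACA.
by rewrite !mleadM // !mnmDE !oddD addbACA.
Qed.

Lemma par_inj x e e' : par x e -> par x e' -> e = e'.
Proof.
move=> [N [D [nzN nzD -> ->]]] [N' [D' [nzN' nzD' E ->]]].
have : tf (N * D') = tf (N' * D).
  have nzd : tf D != 0 by rewrite tofrac_eq0.
  have nzd' : tf D' != 0 by rewrite tofrac_eq0.
  rewrite !tofracM.
  move/eqP: E.
  rewrite (eqr_div _ _ nzd nzd').
  by move/eqP.
move/eqP; rewrite tofrac_eq => /eqP /(congr1 (fun f => odd (mlead f k))).
rewrite !mleadM // !mnmDE !oddD.
by case: (odd (mlead N k)); case: (odd (mlead N' k));
  case: (odd (mlead D k)); case: (odd (mlead D' k)).
Qed.

Lemma par_mpoly (f : M) : f != 0 -> par (tf f) (odd (mlead f k)).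
Proof.
move=> nz; exists f, 1; rewrite oner_neq0 tofrac1 divr1 mlead1 mnm0E addbF.
by split.
Qed.

Lemma par1 : par 1 false.
Proof. by have := par_mpoly (oner_neq0 _); rewrite tofrac1 mlead1 mnm0E. Qed.

Lemma parN x e : par x e -> par (- x) e.
Proof.
move=> [N [D [nzN nzD -> ->]]]; exists (- N), D; rewrite oppr_eq0 mleadN.
by rewrite tofracN mulNr; split.
Qed.

Lemma parX x e i : par x e -> par (x ^+ i) (odd i && e).
Proof.
move=> px; elim: i => [|i IH]; first by rewrite expr0; apply: par1.
have -> : odd i.+1 && e = e (+) (odd i && e) by rewrite /=; clear; case: e; case: (odd i).
by rewrite exprS; apply: parM.
Qed.

Lemma par_prod (I : finType) (x : I -> {fraction M}) (e : I -> bool) :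
  (forall i, par (x i) (e i)) -> par (\prod_i x i) (\big[addb/false]_i e i).
Proof.
by move=> px; elim/big_ind2: _ => // [|? ? ? ? ? ?]; [apply: par1|apply: parM].
Qed.

Lemma mlead_var (i : 'I_n) : odd (mlead ('X_i : M) k) = (i == k).
Proof. by rewrite mleadXm mnm1E; case: eqP. Qed.

End Parity.

(** Compare the parities in the variable 'X_(u i0): factors with even
    exponents do not contribute, nor do the other variables, and what remains
    is the parity of b i0. *)
Lemma even_exponents n (K : idomainType) (I J : finType)
    (u : I -> 'I_n) (v : J -> 'I_n)
    (alpha : I -> {fraction {mpoly K[n]}}) (beta : J -> {fraction {mpoly K[n]}})
    (b : I -> nat) (c : J -> nat) :
  injective u -> (forall i j, u i != v j) ->
  (forall i, alpha i != 0) -> (forall j, beta j != 0) ->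
  (forall i, alpha i = @tofrac _ 'X_(u i) \/ ~~ odd (b i)) ->
  (forall j, beta j = @tofrac _ 'X_(v j) \/ ~~ odd (c j)) ->
  \prod_i alpha i ^+ b i + \prod_j beta j ^+ c j = 0 ->
  forall i, ~~ odd (b i).
Proof.
move=> inju uv nza nzb Ha Hb E i0.
have [ea Ea] := fin_all_exists (fun i => par_ex (u i0) (nza i)).
have [eb Eb] := fin_all_exists (fun j => par_ex (u i0) (nzb j)).
have nzX (k : 'I_n) : ('X_k : {mpoly K[n]}) != 0 by rewrite -msupp_eq0 msuppX.
have pa := par_prod (fun i => parX (b i) (Ea i)).
have pb := par_prod (fun j => parX (c j) (Eb j)).
have Eab : \prod_i alpha i ^+ b i = - \prod_j beta j ^+ c j.
  by apply/eqP; rewrite -addr_eq0 E.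
rewrite Eab in pa; have := par_inj pa (parN pb).
rewrite [RHS]big1 => [|j _]; last first.
  case: (Hb j) => [Ej|/negbTE -> //].
  have := par_mpoly (u i0) (nzX (v j)); rewrite -Ej mlead_var => /(par_inj (Eb j)) ->.
  by rewrite eq_sym (negbTE (uv _ _)) andbF.
have eaE i : odd (b i) && ea i = odd (b i) && (i == i0).
  case: (Ha i) => [Ei|/negbTE -> //].
  have := par_mpoly (u i0) (nzX (u i)); rewrite -Ei mlead_var => /(par_inj (Ea i)) ->.
  by rewrite (inj_eq inju).
rewrite (bigD1 i0) //= big1 => [|i /negbTE ne]; rewrite eaE ?ne ?andbF //.
by rewrite eqxx andbT addbF => ->.
Qed.

Lemma mpoly_divX n (K : comNzRingType) (U : 'X_{1..n}) (f : {mpoly K[n]}) :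
  (forall mm, mm \in msupp f -> (U <= mm)%MM) ->
  exists f', f = 'X_[U] * f' /\
    forall mm, mm \in msupp f' -> (U + mm)%MM \in msupp f.
Proof.
move=> le_U; pose f' : {mpoly K[n]} := \sum_(mm <- msupp f) f@_mm *: 'X_[mm - U].
have E : f = 'X_[U] * f'.
  rewrite {1}(mpolyE f) mulr_sumr; apply: eq_big_seq => mm /le_U le.
  by rewrite -scalerAr -mpolyXD addmC submK.
exists f'; split=> // mm; rewrite !mcoeff_msupp E [_ * f']mulrC.
by rewrite mcoeffMX.
Qed.

Lemma const_power (L : fieldType) (natL : forall k, (k.+1%:R : L) != 0)
    (y : {poly L}) A (C u : L) :
  y != 0 -> (0 < A)%N -> C != 0 -> u%:P = C *: y ^+ A -> y^`() = 0.
Proof.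
move=> nzy A_gt0 nzC /(congr1 (@dg L)); apply: contra_eq => nz.
have : (0 < dg y)%N by rewrite lt0n (dg0_deriv natL).
rewrite -mul_polyC dgM ?polyC_eq0 ?expf_neq0 // dgX // /dg !size_polyC nzC /=.
by case: (u != 0) => /= gt0; rewrite add0n eq_sym -lt0n muln_gt0 A_gt0.
Qed.

Lemma mderiv_exp n (R : comNzRingType) (f : {mpoly R[n]}) k e :
  (f ^+ e)^`M(k) = (f^`M(k) * f ^+ e.-1) *+ e.
Proof.
elim: e => [|[|e] IH]; first by rewrite expr0 -mpolyC1 mderivC mulr0n.
  by rewrite expr1 expr0 mulr1n mulr1.
rewrite exprS mderivM IH /= mulrnAr mulrCA -exprS.
by rewrite [in RHS]mulrS.
Qed.

(** * Connected groups *)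

Section ZariskiClosed.
Variables (K : closedFieldType) (n : nat) (s : seq {mpoly K[n]}).
Local Notation V := (variety s).
Implicit Types C D : V -> Prop.

Lemma closed_poly (f : {mpoly K[n]}) : zariski_closed (fun v : V => f.@[coord v] = 0).
Proof. by exists (eq f) => v; split=> [v0 _ <- //|/(_ f erefl)]. Qed.

Lemma closed_ext C D : (forall v, C v <-> D v) -> zariski_closed C -> zariski_closed D.
Proof. by move=> CD [I CI]; exists I => v; rewrite -CD. Qed.

Lemma closed_forall (T : Type) (C : T -> V -> Prop) :
  (forall t, zariski_closed (C t)) -> zariski_closed (fun v => forall t, C t v).
Proof.
move=> cC; exists (fun f => exists t I, (forall v, C t v <-> (forall f, I f -> f.@[coord v] = 0)) /\ I f).
move=> v; split=> [Cv f [t [I [CI If]]]|Iv t]; first exact: (CI v).1 (Cv t) _ If.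
by have [I CI] := cC t; apply/CI => f If; apply: Iv; exists t, I.
Qed.

Lemma closed_false : zariski_closed (fun _ : V => False).
Proof.
exists (eq 1) => v; split=> // /(_ 1 erefl) /eqP; rewrite meval1.
by rewrite (negbTE (oner_neq0 K)).
Qed.

Lemma closed_or C D :
  zariski_closed C -> zariski_closed D -> zariski_closed (fun v => C v \/ D v).
Proof.
move=> [I CI] [J DJ]; exists (fun f => exists f1 f2, [/\ I f1, J f2 & f = f1 * f2]) => v.
split=> [CD f [f1 [f2 [I1 J2 ->]]]|IJ].
  rewrite mevalM; case: CD => [/CI/(_ _ I1)->|/DJ/(_ _ J2)->]; first exact: mul0r.
  exact: mulr0.
case: (classic (C v)) => [Cv|nC]; first by left.
right; apply/DJ => f2 J2; apply: NNPP => n2; apply: nC; apply/CI => f1 I1.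
have /eqP := IJ _ (ex_intro _ f1 (ex_intro _ f2 (And3 I1 J2 erefl))).
by rewrite mevalM mulf_eq0 => /orP [/eqP //|/eqP].
Qed.

Lemma closed_exists (T : finType) (P : pred T) (C : T -> V -> Prop) :
  (forall t, zariski_closed (C t)) -> zariski_closed (fun v => exists2 t, P t & C t v).
Proof.
move=> cC; apply: (@closed_ext (fun v => exists2 t, t \in enum P & C t v)).
  by move=> v; split=> [[t Pt Ct]|[t Pt Ct]]; exists t => //; move: Pt; rewrite mem_enum.
elim: (enum P) => [|t r IH].
  by apply: closed_ext closed_false => v; split=> // -[].
apply: closed_ext (closed_or (cC t) IH) => v; split.
  by case=> [Ct|[u ur Cu]]; [exists t|exists u]; rewrite // inE ?eqxx ?ur ?orbT.
case=> u; rewrite inE => /orP [/eqP ->|ur] Cu; first by left.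
by right; exists u.
Qed.

(** The complement of C t0 is the finite union of the other sets of the
    partition, hence is closed. *)
Lemma connected_partition (T : finType) (C : T -> V -> Prop) t0 v0 :
  zariski_connected s -> (forall t, zariski_closed (C t)) ->
  (forall v, exists t, C t v) -> (forall t u v, C t v -> C u v -> t = u) ->
  C t0 v0 -> forall v, C t0 v.
Proof.
move=> conn cC cover disj C0.
have [v|v [Ct [u /eqP ne Cu]]|//|D] :=
  conn (C t0) (fun v => exists2 t, t != t0 & C t v) (cC t0) (closed_exists _ cC).
- have [t Ct] := cover v; have [E|ne] := eqVneq t t0; first by left; rewrite -E.
  by right; exists t.
- by apply: ne; apply: disj Cu Ct.
by have [u /eqP ne Cu] := D v0; case: ne; apply: disj Cu C0.
Qed.

(** If f vanishes on C and g on D, where C and D cover the variety, then f g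
    vanishes everywhere. *)
Lemma irreducible_connected :
  (forall f g : {mpoly K[n]}, (forall v : V, f.@[coord v] * g.@[coord v] = 0) ->
     (forall v : V, f.@[coord v] = 0) \/ (forall v : V, g.@[coord v] = 0)) ->
  zariski_connected s.
Proof.
move=> irr C D [I CI] [J DJ] cover _.
case: (classic (forall v, C v)) => [|nC]; first by left.
right=> v; apply/DJ => g Jg; apply: NNPP => ng; apply: nC => w; apply/CI => f If.
have [u||] := irr f g; last 2 first.
- exact.
- by move=> g0; case: ng.
by case: (cover u) => [/CI/(_ _ If)->|/DJ/(_ _ Jg)->]; rewrite ?mul0r ?mulr0.
Qed.

End ZariskiClosed.

Section GroupAction.
Variables (K : closedFieldType) (n : nat) (s : seq {mpoly K[n]}).
Local Notation X := (variety s).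
Variables (G : algebraic_group K) (act : ag_point G -> X -> X).
Hypothesis actP : faithful_action act.

Lemma actK g : cancel (act g) (act (ag_inv g)).
Proof. by move=> x; rewrite -(act_mul actP) ag_mulV (act_one actP). Qed.

Lemma actVK g : cancel (act (ag_inv g)) (act g).
Proof. by move=> x; apply: (can_inj (actK (ag_inv g))); rewrite actK. Qed.

Lemma regular_act g : regular (act g).
Proof.
have [F FE] := act_regular actP.
pose gam i : {mpoly K[n]} := match split i with inl j => ((val g) 0 j)%:MP | inr k => 'X_k end.
exists (fun j => mmap (@mpolyC n K) gam (F j)) => v j.
rewrite FE meval_mmap; apply: meval_eq => i; rewrite /gam mxE.
by case: (split i) => k; rewrite ?mevalC ?mevalXU.
Qed.

Lemma closed_act x (h : {mpoly K[n]}) :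
  zariski_closed (fun g => h.@[coord (act g x)] = 0).
Proof.
have [F FE] := act_regular actP.
pose gam i : {mpoly K[ag_ambient G]} :=
  match split i with inl j => 'X_j | inr k => (coord x k)%:MP end.
have FgE g j : (mmap (@mpolyC _ K) gam (F j)).@[coord g] = coord (act g x) j.
  rewrite FE meval_mmap; apply: meval_eq => i; rewrite /gam mxE.
  by case: (split i) => k; rewrite ?mevalC ?mevalXU.
pose H := mmap (@mpolyC _ K) (fun j => mmap (@mpolyC _ K) gam (F j)) h.
have HE g : H.@[coord g] = h.@[coord (act g x)].
  by rewrite meval_mmap; apply: meval_eq => j; apply: FgE.
apply: (@closed_ext _ _ _ (fun g => H.@[coord g] = 0)) => [g|]; last exact: closed_poly.
by rewrite HE.
Qed.

Lemma closed_act_closed x (C : X -> Prop) :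
  zariski_closed C -> zariski_closed (fun g => C (act g x)).
Proof.
move=> [I CI]; apply: (@closed_ext _ _ _ (fun g => forall h, I h -> h.@[coord (act g x)] = 0)).
  by move=> g; rewrite CI.
by do 2![apply: closed_forall => ?]; apply: closed_act.
Qed.

Hypothesis conn : zariski_connected (ag_eqs G).

(** For a given t, the group elements are partitioned into finitely many
    closed subsets according to the u for which they map V t into V u. *)
Lemma connected_permutation (T : finType) (V : T -> X -> Prop) :
  (forall t, zariski_closed (V t)) ->
  (forall t u, (forall x, V t x -> V u x) -> t = u) ->
  (forall g t, exists u, forall x, V t x -> V u (act g x)) ->
  forall g t x, V t x <-> V t (act g x).
Proof.
move=> cV anti perm.
suff stab t g x : V t x -> V t (act g x).
  move=> g t x; split=> [|Vgx]; first exact: stab.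
  by have := stab t (ag_inv g) _ Vgx; rewrite actK.
apply: (@connected_partition _ _ _ T (fun u g => forall x, V t x -> V u (act g x))
  t (ag_one G) conn) => //.
- by move=> u; do 2![apply: closed_forall => ?]; apply: closed_act_closed.
- move=> u u' g' Vu Vu'; have [k Vk] := perm (ag_inv g') u.
  have Ek : t = k by apply: anti => y Vy; rewrite -(actK g' y); apply/Vk/Vu.
  by apply: anti => y Vy; rewrite -(actVK g' y); apply/Vu'; rewrite Ek; apply/Vk.
- by move=> y; rewrite (act_one actP).
Qed.

End GroupAction.

(** * Additive and multiplicative groups *)

(** Regularity of maps will be shown one coordinate at a time, by the
    stability of polynomial functions under the ring operations. *)
Section PolynomialFunctions.
Variables (K : closedFieldType) (T : Type) (N : nat) (e : T -> 'I_N -> K).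

Definition polyf (phi : T -> K) := exists f : {mpoly K[N]}, forall t, phi t = f.@[e t].

Lemma polyf_ext phi psi : (forall t, phi t = psi t) -> polyf phi -> polyf psi.
Proof. by move=> E [f Ef]; exists f => t; rewrite -E. Qed.

Lemma polyfC u : polyf (fun=> u).
Proof. by exists u%:MP => t; rewrite mevalC. Qed.

Lemma polyf_coord k : polyf (e^~ k).
Proof. by exists 'X_k => t; rewrite mevalXU. Qed.

Lemma polyfD phi psi : polyf phi -> polyf psi -> polyf (fun t => phi t + psi t).
Proof. by move=> [f Ef] [g Eg]; exists (f + g) => t; rewrite mevalD Ef Eg. Qed.

Lemma polyfM phi psi : polyf phi -> polyf psi -> polyf (fun t => phi t * psi t).
Proof. by move=> [f Ef] [g Eg]; exists (f * g) => t; rewrite mevalM Ef Eg. Qed.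

Lemma polyfN phi : polyf phi -> polyf (fun t => - phi t).
Proof. by move=> [f Ef]; exists (- f) => t; rewrite mevalN Ef. Qed.

Lemma polyfX phi k : polyf phi -> polyf (fun t => phi t ^+ k).
Proof. by move=> [f Ef]; exists (f ^+ k) => t; rewrite rmorphXn /= Ef. Qed.

Lemma polyf_sum (I : Type) (r : seq I) (phi : I -> T -> K) :
  (forall i, polyf (phi i)) -> polyf (fun t => \sum_(i <- r) phi i t).
Proof.
move=> pphi; elim: r => [|i r IH].
  by apply: (polyf_ext (phi := fun=> 0)) => [t|]; rewrite ?big_nil //; apply: polyfC.
by apply: polyf_ext (polyfD (pphi i) IH) => t; rewrite big_cons.
Qed.

Lemma polyf_meval n (f : {mpoly K[n]}) (phi : 'I_n -> T -> K) :
  (forall k, polyf (phi k)) -> polyf (fun t => f.@[fun k => phi k t]).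
Proof.
move=> /fin_all_exists [g Eg]; exists (mmap (@mpolyC N K) g f) => t.
by rewrite meval_mmap; apply: meval_eq => k; apply: Eg.
Qed.

End PolynomialFunctions.

Section Regular.
Variable K : closedFieldType.

Lemma regularP n k (s : seq {mpoly K[n]}) (t : seq {mpoly K[k]}) (f : variety s -> variety t) :
  (forall j, polyf (@coord K n s) (fun v => coord (f v) j)) -> regular f.
Proof. by move/fin_all_exists => [F EF]; exists F. Qed.

Definition coord2 n k (s : seq {mpoly K[n]}) (t : seq {mpoly K[k]})
  (vw : variety s * variety t) : 'I_(n + k) -> K := row_mx (val vw.1) (val vw.2) 0.

Lemma regular2P n k l (s : seq {mpoly K[n]}) (t : seq {mpoly K[k]}) (u : seq {mpoly K[l]})
    (f : variety s -> variety t -> variety u) :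
  (forall j, polyf (@coord2 n k s t) (fun vw => coord (f vw.1 vw.2) j)) -> regular2 f.
Proof.
by move/fin_all_exists => [F EF]; exists F => v w j; apply: (EF j (v, w)).
Qed.

Lemma polyf_fst n k (s : seq {mpoly K[n]}) (t : seq {mpoly K[k]}) i :
  polyf (@coord2 n k s t) (fun vw => coord vw.1 i).
Proof.
apply: polyf_ext (polyf_coord _ (lshift k i)) => vw.
by rewrite /coord2 row_mxEl.
Qed.

Lemma polyf_snd n k (s : seq {mpoly K[n]}) (t : seq {mpoly K[k]}) i :
  polyf (@coord2 n k s t) (fun vw => coord vw.2 i).
Proof.
apply: polyf_ext (polyf_coord _ (rshift n i)) => vw.
by rewrite /coord2 row_mxEr.
Qed.

Hypothesis charK0 : [pchar K] =i pred0.

Section Ga.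

Definition Gapt (t : K) : variety ([::] : seq {mpoly K[1]}) :=
  exist (fun v => vanish [::] v) (const_mx t) isT.
Definition Gaval (g : variety ([::] : seq {mpoly K[1]})) : K := coord g 0.

Lemma GaptK t : Gaval (Gapt t) = t.
Proof. by rewrite /Gaval /coord mxE. Qed.

Lemma GavalK : cancel Gaval Gapt.
Proof. by move=> g; apply/val_inj/rowP => k; rewrite (ord1 k) mxE. Qed.

Lemma Gaval_inj : injective Gaval. Proof. exact: can_inj GavalK. Qed.

Lemma coordGa g k : coord g k = Gaval g.
Proof. by rewrite (ord1 k). Qed.

Definition Ga : algebraic_group K.
Proof.
refine (@AlgebraicGroup K 1 [::] (fun g h => Gapt (Gaval g + Gaval h)) (Gapt 0)
  (fun g => Gapt (- Gaval g)) _ _ _ _ _).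
- by move=> g h i; rewrite !GaptK addrA.
- by move=> g; rewrite GaptK add0r GavalK.
- by move=> g; rewrite GaptK addNr.
- apply: regular2P => j; apply: (polyf_ext (phi := fun vw => coord vw.1 0 + coord vw.2 0)).
    by move=> vw; rewrite (coordGa (Gapt _)) GaptK.
  by apply: polyfD; [apply: polyf_fst|apply: polyf_snd].
- apply: regularP => j; apply: (polyf_ext (phi := fun v => - coord v 0)).
    by move=> v; rewrite (coordGa (Gapt _)) GaptK.
  by apply: polyfN; apply: polyf_coord.
Defined.

Lemma Ga_connected : zariski_connected (ag_eqs Ga).
Proof.
apply: irreducible_connected => f g fg.
have /eqP : f * g = 0.
  apply: (mpoly_vanish0 charK0) => v; rewrite mevalM -(fg (Gapt (v 0))).
  by congr (_ * _); apply: meval_eq => k; rewrite coordGa GaptK (ord1 k).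
by rewrite mulf_eq0 => /orP [] /eqP ->; [left|right] => v; rewrite meval0.
Qed.

End Ga.

Section Gm.

Definition Gmeq : {mpoly K[2]} := 'X_0 * 'X_1 - 1.
Local Notation Gmvar := (variety [:: Gmeq]).

Lemma Gmpt_proof (t : K) (nz : t != 0) :
  vanish [:: Gmeq] (\row_k (if k == 0 then t else t^-1)).
Proof.
rewrite /vanish /= andbT mevalB mevalM meval1 !mevalXU !mxE /=.
by rewrite mulfV // subrr.
Qed.

Definition Gmpt t nz : Gmvar := exist (fun v => vanish [:: Gmeq] v) _ (@Gmpt_proof t nz).
Definition Gmval (g : Gmvar) : K := coord g 0.

Lemma GmptK t (nz : t != 0) : Gmval (Gmpt nz) = t.
Proof. by rewrite /Gmval /coord mxE. Qed.

Lemma Gm_rel (g : Gmvar) : coord g 0 * coord g 1 = 1.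
Proof.
have := valP g; rewrite /vanish /= andbT mevalB mevalM meval1 !mevalXU subr_eq0.
by move/eqP.
Qed.

Lemma Gmval_neq0 g : Gmval g != 0.
Proof.
apply/eqP => g0; have := Gm_rel g; rewrite -/(Gmval g) g0 mul0r => /eqP.
by rewrite eq_sym (negbTE (oner_neq0 K)).
Qed.

Lemma coordGm1 g : coord g 1 = (Gmval g)^-1.
Proof.
apply: (mulfI (Gmval_neq0 g)); rewrite mulfV ?Gmval_neq0 //; exact: Gm_rel.
Qed.

Lemma ord2 (k : 'I_2) : k = 0 \/ k = 1.
Proof. by case: k => [[|[|k]] lt] //; [left|right]; apply/val_inj. Qed.

Lemma coordGm g k : coord g k = if k == 0 then Gmval g else (Gmval g)^-1.
Proof. by have [->|->] := ord2 k; rewrite ?coordGm1. Qed.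

Lemma Gmval_inj : injective Gmval.
Proof.
move=> g h E; apply/val_inj/rowP => k; have [->|->] := ord2 k; first exact: E.
by have := coordGm1 g; rewrite E -coordGm1.
Qed.

Lemma Gmmul_neq0 g h : Gmval g * Gmval h != 0.
Proof. by rewrite mulf_neq0 ?Gmval_neq0. Qed.
Lemma Gminv_neq0 g : (Gmval g)^-1 != 0.
Proof. by rewrite invr_eq0 Gmval_neq0. Qed.

Definition Gm : algebraic_group K.
Proof.
refine (@AlgebraicGroup K 2 [:: Gmeq] (fun g h => Gmpt (Gmmul_neq0 g h)) (Gmpt (oner_neq0 K))
  (fun g => Gmpt (Gminv_neq0 g)) _ _ _ _ _).
- by move=> g h i; apply: Gmval_inj; rewrite !GmptK mulrA.
- by move=> g; apply: Gmval_inj; rewrite !GmptK mul1r.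
- by move=> g; apply: Gmval_inj; rewrite !GmptK mulVf ?Gmval_neq0.
- apply: regular2P => j; apply: (polyf_ext (phi := fun vw => coord vw.1 j * coord vw.2 j)).
    by move=> vw; rewrite !coordGm; case: ifP => _; rewrite GmptK // invfM.
  by apply: polyfM; [apply: polyf_fst|apply: polyf_snd].
- apply: regularP => j; apply: (polyf_ext (phi := fun v => coord v (1 - j))).
    move=> v; have [->|->] := ord2 j; rewrite !coordGm GmptK ?subr0 ?subrr //=.
    by rewrite invrK.
  exact: polyf_coord.
Defined.

(** A function on Gm times a large power of the coordinate is a polynomial in
    the coordinate, so Gm inherits the irreducibility of the line. *)
Lemma Gm_connected : zariski_connected (ag_eqs Gm).
Proof.
have clear (f : {mpoly K[2]}) : exists N (u : {poly K}),
    forall g : Gmvar, u.[Gmval g] = Gmval g ^+ N * f.@[coord g].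
  elim/mmap_ind: f => [u|k|f1 f2 [N1 [u1 E1]] [N2 [u2 E2]]|f1 f2 [N1 [u1 E1]] [N2 [u2 E2]]].
  - by exists 0%N, u%:P => g; rewrite hornerC mevalC expr0 mul1r.
  - have [->|->] := ord2 k; first by exists 0%N, 'X => g; rewrite hornerX mevalXU expr0 mul1r.
    by exists 1%N, 1 => g; rewrite hornerC mevalXU expr1 Gm_rel.
  - exists (N1 + N2)%N, ('X^N2 * u1 + 'X^N1 * u2) => g.
    rewrite hornerD !hornerM !hornerXn E1 E2 mevalD exprD; ring.
  - exists (N1 + N2)%N, (u1 * u2) => g.
    rewrite hornerM E1 E2 mevalM exprD; ring.
apply: irreducible_connected => f g fg.
have [N1 [u1 E1]] := clear f; have [N2 [u2 E2]] := clear g.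
have /eqP : 'X * (u1 * u2) = 0.
  apply: poly_vanish0 => t; rewrite !hornerM hornerX.
  have [->|nz] := eqVneq t 0; first by rewrite mul0r.
  have := E1 (Gmpt nz); have := E2 (Gmpt nz); rewrite GmptK => -> ->.
  by rewrite mulrACA (fg (Gmpt nz)) !mulr0.
have zero u N (h : {mpoly K[2]}) : (forall g : Gmvar, u.[Gmval g] = Gmval g ^+ N * h.@[coord g]) ->
    u = 0 -> forall g : Gmvar, h.@[coord g] = 0.
  move=> E u0 g'; have /esym/eqP := E g'; rewrite u0 horner0 mulf_eq0 expf_eq0.
  by rewrite (negbTE (Gmval_neq0 _)) andbF => /eqP.
rewrite !mulf_eq0 polyX_eq0 /= => /orP [] /eqP u0; [left|right].
  exact: zero E1 u0.
exact: zero E2 u0.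
Qed.

End Gm.
End Regular.

(** * Reachability under Aut_alg *)

Section Reach.
Variables (K : closedFieldType) (n : nat) (s : seq {mpoly K[n]}).
Local Notation V := (variety s).

Definition reach (v w : V) := exists2 f, Aut_alg f & f v = w.

Lemma reach_refl v : reach v v.
Proof. by exists id => //; apply: Aut_alg_id. Qed.

Lemma reach_trans u v w : reach u v -> reach v w -> reach u w.
Proof. by move=> [f Af <-] [g Ag <-]; exists (g \o f) => //; apply: Aut_alg_comp. Qed.

Lemma reach_act (G : algebraic_group K) (act : ag_point G -> V -> V) g v :
  zariski_connected (ag_eqs G) -> faithful_action act -> reach v (act g v).
Proof.
move=> conn actP; exists (act g) => //.
apply: (@Aut_alg_gen _ _ _ (fun f => exists g, f =1 act g)); last by exists g.
exists G, act; split=> // f [g' Ef]; have [F FE] := regular_act actP g'.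
split; first by exists F => v' j; rewrite Ef FE.
exists (act (ag_inv g')); split; first exact: regular_act.
  by move=> x; rewrite Ef (actK actP).
by move=> x; rewrite Ef (actVK actP).
Qed.

(** The equivalence is stable under composition and inverses. For a generator,
    the converse implication is the invariance under the inverse group
    element. *)
Lemma Aut_alg_invariant (S : V -> Prop) :
  (forall (G : algebraic_group K) (act : ag_point G -> V -> V) g v,
     zariski_connected (ag_eqs G) -> faithful_action act -> S v -> S (act g v)) ->
  forall f, Aut_alg f -> forall v, S v <-> S (f v).
Proof.
move=> Sact f; elim=> {f} [H f [G [act [conn actP _ HE]]] Hf v| //|f g _ IHf _ IHg v|
    f g _ IH fK gK v].
- have [g Ef] := (HE f).1 Hf; rewrite Ef; split=> [|Sg]; first exact: Sact.
  by rewrite -(actK actP g v); apply: Sact.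
- by split=> [/(IHg v).1/(IHf (g v)).1|/(IHf (g v)).2/(IHg v).2].
- by have [IH1 IH2] := IH (g v); rewrite gK in IH1 IH2; split=> [/IH2|/IH1].
Qed.

End Reach.

Section Orbits.
Variables (K : closedFieldType) (n : nat) (s : seq {mpoly K[n]}).
Local Notation V := (variety s).

(** A nonempty set with these two properties is an orbit, and every orbit that
    meets it equals it. *)
Definition homogeneous (S : V -> Prop) :=
  (forall v w, S v -> S w -> reach v w) /\
  forall f, Aut_alg f -> forall v, S v <-> S (f v).

Lemma homogeneous_orbit S v0 : homogeneous S -> S v0 -> is_orbit S.
Proof.
move=> [Sreach Sinv] S0; exists v0 => v; split=> [/(Sreach _ _ S0) //|[f Af <-]].
exact: (Sinv f Af v0).1.
Qed.

Lemma orbit_homogeneous S T x : homogeneous T -> T x ->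
  (forall y, S y <-> reach x y) -> forall y, S y <-> T y.
Proof.
move=> [Treach Tinv] Tx Sx y; split=> [/Sx [f Af <-]|Ty]; first exact: (Tinv f Af x).1.
by apply/Sx; apply: Treach.
Qed.

End Orbits.

(** * Indices and exponents *)

Section Indices.
Variables m p q : nat.
Local Notation n := (ambient m p q).
Local Notation ix := (idx_x m p q).
Local Notation iy := (@idx_y m p q).
Local Notation iz := (@idx_z m p q).
Local Notation iss := (@idx_s m p q).

Inductive idx_spec : 'I_n -> Type :=
| IdxX : idx_spec ix
| IdxY i : idx_spec (iy i)
| IdxZ j : idx_spec (iz j)
| IdxS l : idx_spec (iss l).

Lemma idxP (k : 'I_n) : idx_spec k.
Proof.
case: (split_ordP k) => [k1 ->|k1 ->]; first by rewrite (ord1 k1); apply: IdxX.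
case: (split_ordP k1) => [i ->|k2 ->]; first exact: IdxY.
by case: (split_ordP k2) => [j ->|l ->]; [apply: IdxZ|apply: IdxS].
Qed.

Lemma idxE :
  (((forall i, (iy i == ix) = false) * (forall i, (ix == iy i) = false))
  * ((forall j, (iz j == ix) = false) * (forall j, (ix == iz j) = false))
  * ((forall l, (iss l == ix) = false) * (forall l, (ix == iss l) = false))
  * ((forall i j, (iy i == iz j) = false) * (forall i j, (iz j == iy i) = false))
  * ((forall i l, (iy i == iss l) = false) * (forall i l, (iss l == iy i) = false))
  * ((forall j l, (iz j == iss l) = false) * (forall j l, (iss l == iz j) = false))
  * ((forall i i', (iy i == iy i') = (i == i')) * (forall j j', (iz j == iz j') = (j == j'))
     * (forall l l', (iss l == iss l') = (l == l'))))%type.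
Proof.
by do !split => *; rewrite ?(eq_lrshift, eq_rlshift, eq_rshift, eq_lshift).
Qed.

Lemma big_idx (R : Type) (idx : R) (op : Monoid.com_law idx) (E : 'I_n -> R) :
  \big[op/idx]_(k < n) E k =
  op (E ix) (op (\big[op/idx]_(i < m) E (iy i))
    (op (\big[op/idx]_(j < p) E (iz j)) (\big[op/idx]_(l < q) E (iss l)))).
Proof.
by rewrite big_split_ord big_ord1 big_split_ord big_split_ord.
Qed.

End Indices.

Lemma dvdn_gcd_exp (p q : nat) (b : 'I_p -> nat) (c : 'I_q -> nat) :
  (forall j, gcd_exp b c %| b j)%N /\ (forall l, gcd_exp b c %| c l)%N.
Proof.
split=> i; rewrite /gcd_exp.
  by rewrite (dvdn_trans (dvdn_gcdl _ _)) // (bigD1 i) //= dvdn_gcdl.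
by rewrite (dvdn_trans (dvdn_gcdr _ _)) // (bigD1 i) //= dvdn_gcdl.
Qed.

Section Hypersurface.
Variable K : closedFieldType.
Hypothesis charK0 : [pchar K] =i pred0.
Variables (m p q : nat) (a : 'I_m -> nat) (b : 'I_p -> nat) (c : 'I_q -> nat).
Hypothesis p_ge1 : (1 <= p)%N.
Hypothesis a_ge2 : forall i, (2 <= a i)%N.
Hypothesis b_ge2 : forall j, (2 <= b j)%N.
Hypothesis c_ge2 : forall l, (2 <= c l)%N.
Hypothesis not_H4 : ~ type_H4 b c.

Local Notation n := (ambient m p q).
Local Notation M := {mpoly K[n]}.
Local Notation FM := {fraction M}.
Local Notation tf := (@tofrac M).
Local Notation ix := (idx_x m p q).
Local Notation iy := (@idx_y m p q).
Local Notation iz := (@idx_z m p q).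
Local Notation iss := (@idx_s m p q).
Local Notation F := (trinomial K a b c).
Local Notation X := (X_tri K a b c).

Let a_eq0 i : (a i == 0%N) = false. Proof. by rewrite gtn_eqF // ltnW. Qed.
Let b_eq0 j : (b j == 0%N) = false. Proof. by rewrite gtn_eqF // ltnW. Qed.
Let c_eq0 l : (c l == 0%N) = false. Proof. by rewrite gtn_eqF // ltnW. Qed.

(** * The coordinate ring of the hypersurface *)

Definition y_monomial : M := \prod_(i < m) 'X_(iy i) ^+ a i.
Local Notation mu := y_monomial.
Definition z_monomial : M := \prod_(j < p) 'X_(iz j) ^+ b j.
Local Notation fz := z_monomial.
Definition s_monomial : M := \prod_(l < q) 'X_(iss l) ^+ c l.
Local Notation gs := s_monomial.
Definition zs_sum : M := fz + gs.
Local Notation PP := zs_sum.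

Lemma trinomialE : F = 'X_ix * mu + PP.
Proof. by rewrite /trinomial /PP addrA. Qed.

Definition is_y (k : 'I_n) := [exists i, k == iy i].
Definition is_xy (k : 'I_n) := (k == ix) || is_y k.

Lemma indep_mu (S : pred 'I_n) : (forall i, ~~ S (iy i)) -> indep S mu.
Proof. by move=> Sy; apply: indep_prod => i _; apply: indepE; apply: indepX. Qed.

Lemma indep_PP (S : pred 'I_n) :
  (forall j, ~~ S (iz j)) -> (forall l, ~~ S (iss l)) -> indep S PP.
Proof.
by move=> Sz Ss; apply: indepD; apply: indep_prod => i _; apply: indepE; apply: indepX.
Qed.

Lemma is_y_iy i : is_y (iy i). Proof. by apply/existsP; exists i. Qed.
Lemma is_y_ix : is_y ix = false.
Proof. by apply/existsP => -[i]; rewrite idxE. Qed.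
Lemma is_y_iz j : is_y (iz j) = false.
Proof. by apply/existsP => -[i]; rewrite idxE. Qed.
Lemma is_y_is l : is_y (iss l) = false.
Proof. by apply/existsP => -[i]; rewrite idxE. Qed.

Lemma mu_neq0 : mu != 0.
Proof.
by apply/prodf_neq0 => i _; rewrite expf_neq0 // -msupp_eq0 msuppX.
Qed.

Lemma evalPP v : PP.@[v] =
  \prod_(j < p) v (iz j) ^+ b j + \prod_(l < q) v (iss l) ^+ c l.
Proof.
rewrite mevalD !rmorph_prod /=.
by congr (_ + _); apply: eq_bigr => i _; rewrite rmorphXn /= mevalXU.
Qed.

Lemma evalmu v : mu.@[v] = \prod_(i < m) v (iy i) ^+ a i.
Proof. by rewrite rmorph_prod; apply: eq_bigr => i _; rewrite rmorphXn /= mevalXU. Qed.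

Lemma evalF v : F.@[v] = v ix * mu.@[v] + PP.@[v].
Proof. by rewrite trinomialE mevalD mevalM mevalXU. Qed.

Lemma PP_neq0 : PP != 0.
Proof.
apply/eqP => /(congr1 (meval (fun k => if [exists l, k == iss l] then 1 else 0))).
rewrite meval0 evalPP (bigD1 (Ordinal p_ge1)) //=.
have -> : [exists l, iz (Ordinal p_ge1) == iss l] = false.
  by apply/existsP => -[l]; rewrite idxE.
rewrite expr0n b_eq0 mul0r add0r big1 => [|l _].
  by apply/eqP/oner_neq0.
by case: existsP => [_|[]]; [rewrite expr1n|exists l].
Qed.

Definition eta (k : 'I_n) : FM :=
  if k == ix then - (tf PP / tf mu) else tf 'X_k.

(** On the part of X where no y_i vanishes, x is the function - zs_sum /
    y_monomial of the other coordinates. The coordinate ring of X is therefore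
    handled as the image of eval_x, inside a field. *)
Definition eval_x : {rmorphism M -> FM} :=
  locked (mmap (tf \o @mpolyC n K) eta : {rmorphism M -> FM}).
Local Notation ev := eval_x.

Lemma evE f : ev f = mmap (tf \o @mpolyC n K) eta f.
Proof. by rewrite /ev -lock. Qed.

Lemma ev_indep (f : M) : indep (pred1 ix) f -> ev f = tf f.
Proof.
move=> If; rewrite evE -[in RHS](mmap_id f) mmap_comp /=.
by apply: If => k /negbTE /= nx; rewrite /eta nx.
Qed.

Lemma evX k : k != ix -> ev 'X_k = tf 'X_k.
Proof. by move=> /negbTE nx; rewrite evE mmapX mmap1U /eta nx. Qed.

Lemma ev_mu : ev mu = tf mu.
Proof. by apply/ev_indep/indep_mu => i /=; rewrite ?idxE. Qed.
Lemma ev_PP : ev PP = tf PP.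
Proof. by apply/ev_indep/indep_PP => i /=; rewrite ?idxE. Qed.

Lemma ev_x : ev 'X_ix = - (tf PP / tf mu).
Proof. by rewrite evE mmapX mmap1U /eta eqxx. Qed.

Lemma ev_x_neq0 : ev 'X_ix != 0.
Proof.
rewrite ev_x oppr_eq0 mulf_neq0 ?invr_eq0 ?tofrac_eq0 ?mu_neq0 //.
exact: PP_neq0.
Qed.

Lemma ev_F : ev F = 0.
Proof.
rewrite trinomialE rmorphD rmorphM /= ev_x ev_mu ev_PP.
by rewrite mulNr divfK ?addNr // tofrac_eq0 ?mu_neq0.
Qed.

(** Division by F in the variable x, in which the leading coefficient of F is
    the monomial in the y_i. *)
Lemma pseudo_div (f : M) :
  exists e h r, mu ^+ e * f = h * F + r /\ indep (pred1 ix) r.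
Proof.
have Imu e : indep (pred1 ix) (mu ^+ e).
  by apply/indepE/indep_mu => i /=; rewrite ?idxE.
elim/mmap_ind: f => [u|k|f g [e1 [h1 [r1 [E1 I1]]]] [e2 [h2 [r2 [E2 I2]]]]
                        |f g [e1 [h1 [r1 [E1 I1]]]] [e2 [h2 [r2 [E2 I2]]]]].
- by exists 0%N, 0, u%:MP; rewrite expr0 mul1r mul0r add0r; split=> //; apply: indepC.
- have [->|nx] := eqVneq k ix.
    exists 1%N, 1, (- PP); rewrite expr1 mul1r trinomialE; split; first by ring.
    rewrite -mulN1r -mpolyC1 -mpolyCN; apply: indepM; first exact: indepC.
    by apply: indep_PP => i /=; rewrite ?idxE.
  by exists 0%N, 0, 'X_k; rewrite expr0 mul1r mul0r add0r; split=> //; apply: indepX.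
- exists (e1 + e2)%N, (mu ^+ e2 * h1 + mu ^+ e1 * h2),
    (mu ^+ e2 * r1 + mu ^+ e1 * r2); split; last by apply: indepD; apply: indepM.
  have -> : mu ^+ (e1 + e2) * (f + g) =
    mu ^+ e2 * (mu ^+ e1 * f) + mu ^+ e1 * (mu ^+ e2 * g) by rewrite exprD; ring.
  by rewrite E1 E2; ring.
- exists (e1 + e2)%N, (h1 * h2 * F + h1 * r2 + r1 * h2), (r1 * r2).
  split; last exact: indepM.
  have -> : mu ^+ (e1 + e2) * (f * g) = (mu ^+ e1 * f) * (mu ^+ e2 * g)
    by rewrite exprD; ring.
  by rewrite E1 E2; ring.
Qed.

Lemma kill_F i : kill (iy i) F = PP.
Proof.
rewrite trinomialE rmorphD rmorphM /=.
rewrite (@kill_indep _ _ _ (pred1 (iy i)) PP) /=; last by rewrite eqxx.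
  rewrite /mu (bigD1 i) //= rmorphM rmorphXn /= (killX _ (iy i) (iy i)) eqxx.
  by rewrite expr0n a_eq0 mul0r mulr0 add0r.
by apply: indep_PP => j /=; rewrite ?idxE.
Qed.

(** F is nonzero modulo y_i, so the prime y_i divides the cofactor h. *)
Lemma cancel_y i f h : 'X_(iy i) * f = h * F -> exists h', f = h' * F.
Proof.
move=> E; have: kill (iy i) h = 0.
  have /(congr1 (kill (iy i))) := E.
  rewrite !rmorphM /= killX eqxx mul0r kill_F => /esym/eqP.
  by rewrite mulf_eq0 (negbTE PP_neq0) orbF => /eqP.
have [h' Eh] := kill_div (iy i) h => h0; rewrite {}h0 add0r in Eh.
exists h'; have nz_y : ('X_(iy i) : M) != 0 by rewrite -msupp_eq0 msuppX.
by apply: (mulfI nz_y); rewrite E Eh; ring.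
Qed.

Lemma cancel_mu e f h : mu ^+ e * f = h * F -> exists h', f = h' * F.
Proof.
have cancel_yn i k g h1 : 'X_(iy i) ^+ k * g = h1 * F -> exists h', g = h' * F.
  elim: k g h1 => [|k IH] g h1; first by rewrite expr0 mul1r; exists h1.
  by rewrite exprS -mulrA => /cancel_y [h2 /IH].
have cancel_mu1 g h1 : mu * g = h1 * F -> exists h', g = h' * F.
  rewrite /mu; elim: (index_enum _) g h1 => [|i s IH] g h1.
    by rewrite big_nil mul1r; exists h1.
  by rewrite big_cons -mulrA => /cancel_yn [h2 /IH].
elim: e f h => [|e IH] f h; first by rewrite expr0 mul1r; exists h.
by rewrite exprS -mulrA => /cancel_mu1 [h2 /IH].
Qed.

(** The remainder of f by F does not involve x and so is fixed by eval_x; the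
    power of the y_i introduced by the division can be cancelled. *)
Lemma ev_eq0 f : ev f = 0 <-> exists h, f = h * F.
Proof.
split=> [ef0|[h ->]]; last by rewrite rmorphM /= ev_F mulr0.
have [e [h [r [E Ir]]]] := pseudo_div f.
have /eqP : tf r = 0.
  have /(congr1 ev) := E; rewrite rmorphM rmorphD rmorphM /= ef0 ev_F !mulr0 add0r.
  by rewrite ev_indep // => <-.
by rewrite tofrac_eq0 => /eqP r0; move: E; rewrite r0 addr0; apply: cancel_mu.
Qed.

(** X is the closure of its part where no y_i vanishes: the remainder of f by
    F vanishes at all points of affine space with nonzero y_i, because such a
    point can be moved to X by a change of x. *)
Lemma vanish_div f :
  (forall v, F.@[v] = 0 -> mu.@[v] != 0 -> f.@[v] = 0) -> exists h, f = h * F.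
Proof.
move=> f0; have [e [h [r [E Ir]]]] := pseudo_div f.
suff r0 : r = 0 by move: E; rewrite r0 addr0; apply: cancel_mu.
have: r * mu = 0.
  apply: (mpoly_vanish0 charK0) => v; rewrite mevalM.
  have [->|nz_mu] := eqVneq mu.@[v] 0; first by rewrite mulr0.
  pose v' k := if k == ix then - (PP.@[v] / mu.@[v]) else v k.
  have eq_v k : ~~ pred1 ix k -> v k = v' k by rewrite /v' /= => /negbTE ->.
  have mu' : mu.@[v'] = mu.@[v].
    by symmetry; apply: (indep_meval _ eq_v); apply: indep_mu => i /=; rewrite ?idxE.
  have P' : PP.@[v'] = PP.@[v].
    by symmetry; apply: (indep_meval _ eq_v); apply: indep_PP => i /=; rewrite ?idxE.
  have F0 : F.@[v'] = 0 by rewrite evalF mu' P' /v' eqxx mulNr divfK // addNr.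
  rewrite (indep_meval Ir eq_v).
  have /(congr1 (meval v')) := E; rewrite mevalD !mevalM F0 f0 ?mu' //.
  by rewrite !mulr0 add0r => <-; rewrite mul0r.
by move/eqP; rewrite mulf_eq0 (negbTE mu_neq0) orbF => /eqP.
Qed.

(** * Homogeneous locally nilpotent derivations *)

Lemma natFM k : (k.+1%:R : FM) != 0.
Proof.
rewrite -(rmorph_nat tf) tofrac_eq0 -mpolyC_nat mpolyC_eq0.
exact: natK_neq0.
Qed.

(** The weight of the one-parameter group that scales y_i and compensates by
    x, so that F gets weight 0. *)
Definition wy (i : 'I_m) (k : 'I_n) : int :=
  if k == ix then - (a i)%:Z else (k == iy i)%:Z.

Lemma wy_x i : wy i ix = - (a i)%:Z. Proof. by rewrite /wy eqxx. Qed.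
Lemma wy_y i i' : wy i (iy i') = (i' == i)%:Z. Proof. by rewrite /wy !idxE. Qed.
Lemma wy_z i j : wy i (iz j) = 0. Proof. by rewrite /wy !idxE. Qed.
Lemma wy_s i l : wy i (iss l) = 0. Proof. by rewrite /wy !idxE. Qed.

Lemma wt_wy i mm : wt (wy i) mm = (mm (iy i))%:Z - (a i * mm ix)%:Z.
Proof.
rewrite /wt big_idx /= wy_x (bigD1 i) //= wy_y eqxx !big1 => [|l _|j _|i' ne].
- by rewrite !addr0 -[X in X + _ = _]mulr_natr -[X in _ + X = _]mulr_natr !natz; lia.
- by rewrite wy_s mul0rn.
- by rewrite wy_z mul0rn.
- by rewrite wy_y (negbTE ne) mul0rn.
Qed.

Lemma whom_prod w (I : finType) (E : I -> M) d :
  (forall i, whom w (d i) (E i)) -> whom w (\sum_i d i) (\prod_i E i).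
Proof.
move=> wE; elim/big_ind2: _ => // [mm|? ? ? ? ? ?]; last exact: whomM.
by rewrite msupp1 inE => /eqP ->; rewrite /wt big1 // => k _; rewrite mnm0E.
Qed.

Lemma whom_exp w (f : M) d k : whom w d f -> whom w (d *+ k) (f ^+ k).
Proof.
move=> wf; elim: k => [|k IH]; last by rewrite exprS mulrS; apply: whomM.
by move=> mm; rewrite expr0 msupp1 inE => /eqP ->; rewrite /wt big1 // => k _; rewrite mnm0E.
Qed.

Lemma F_hom i : whom (wy i) 0 F.
Proof.
have whomP (I : finType) (u : I -> 'I_n) e : (forall j, wy i (u j) = 0) ->
    whom (wy i) 0 (\prod_j 'X_(u j) ^+ e j : M).
  move=> w0; have {1}-> : 0 = \sum_(j : I) (0 : int) by rewrite big1.
  apply: whom_prod => j; rewrite -[0](mul0rn _ (e j)) -(w0 j).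
  by apply: whom_exp; apply: whomX.
rewrite trinomialE; apply: whomD; last by apply: whomD; apply: whomP => j; rewrite ?wy_z ?wy_s.
have {1}-> : 0 = wy i ix + \sum_i' wy i (iy i') *+ a i'.
  rewrite (bigD1 i) //= big1 => [|i' ne]; first by rewrite wy_x wy_y eqxx; lia.
  by rewrite wy_y (negbTE ne) mul0rn.
by apply: whomM; [apply: whomX|apply: whom_prod => i'; apply: whom_exp; apply: whomX].
Qed.

Lemma evX_neq0 k : ev 'X_k != 0.
Proof.
have [->|ne] := eqVneq k ix; first exact: ev_x_neq0.
by rewrite evX // tofrac_eq0 -msupp_eq0 msuppX.
Qed.

(** For a derivation that kills x, the flow moves the point (y, z, s) on a
    polynomial curve over the field of rational functions, and the value of x
    in that field becomes a constant. *)
Section Homogeneous.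
Variable g : 'I_n -> M.
Hypothesis tang : tangent ev g.
Hypothesis nilpX : forall k, nilp_at ev g 'X_k.
Hypothesis gx0 : ev (g ix) = 0.

Local Notation texp := (texp tang nilpX).

Lemma texp_nz k : texp 'X_k != 0.
Proof. by apply: texp_neq0; apply: evX_neq0. Qed.

Lemma texp_derX k : (texp 'X_k)^`() = texp (g k).
Proof. by rewrite (texp_deriv natFM) DerX. Qed.

Lemma texp_x : texp 'X_ix = (ev 'X_ix)%:P.
Proof. by apply: texp_const; rewrite DerX. Qed.

Lemma texp_const_mono (I : finType) (Q : pred I) (u : I -> 'I_n) e :
  (forall i, Q i -> ev (g (u i)) = 0) ->
  \prod_(i | Q i) texp 'X_(u i) ^+ e i = (\prod_(i | Q i) ev 'X_(u i) ^+ e i)%:P.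
Proof.
move=> gu0; rewrite rmorph_prod; apply: eq_bigr => i Qi.
by rewrite rmorphXn /= texp_const ?DerX ?gu0.
Qed.

Lemma texp_F :
  \prod_j texp 'X_(iz j) ^+ b j + \prod_l texp 'X_(iss l) ^+ c l =
  (- ev 'X_ix) *: \prod_i texp 'X_(iy i) ^+ a i.
Proof.
have : texp F = 0 by apply: texp_eq0; apply: ev_F.
have texp_mono (I : finType) (E : I -> M) e :
    texp (\prod_i E i ^+ e i) = \prod_i texp (E i) ^+ e i.
  by rewrite (texp_prod natFM); apply: eq_bigr => i _; rewrite (texpX natFM).
rewrite trinomialE !(texpD, texpM natFM) !texp_mono texp_x mul_polyC.
by move/eqP; rewrite addrC addr_eq0 scaleNr => /eqP.
Qed.

(** If the curve of the flow were not constant, mason would yield a relation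
    between the leading coefficients. There the resting coordinates are
    variables and the moving ones have exponent 2, so all exponents are even
    by even_exponents: this is type H_4. *)
Lemma flow_const (y : {poly FM}) A C :
  y != 0 -> (size y <= 2)%N -> (0 < A)%N -> C != 0 ->
  (forall j, exists u, texp (g (iz j)) = y ^+ A.-1 * u) ->
  (forall l, exists u, texp (g (iss l)) = y ^+ A.-1 * u) ->
  (- ev 'X_ix) *: \prod_i texp 'X_(iy i) ^+ a i = C *: y ^+ A ->
  [/\ forall j, ev (g (iz j)) = 0, forall l, ev (g (iss l)) = 0 & y^`() = 0].
Proof.
move=> nzy szy A_gt0 nzC zY sY E.
have [||[z0 s0]|[[Hz Hs [j0 Ej0] [l0 El0]] lc]] :=
  mason natFM b_ge2 c_ge2 (fun j => texp_nz (iz j)) (fun l => texp_nz (iss l))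
    nzy szy A_gt0 nzC _ _ (etrans texp_F E).
- by move=> j; have [u Eu] := zY j; exists u; rewrite texp_derX.
- by move=> l; have [u Eu] := sY l; exists u; rewrite texp_derX.
- have ez j : ev (g (iz j)) = 0 by rewrite -(texp_coef0 tang nilpX) -texp_derX z0 coef0.
  have es l : ev (g (iss l)) = 0 by rewrite -(texp_coef0 tang nilpX) -texp_derX s0 coef0.
  split=> //.
  have := etrans texp_F E.
  rewrite !texp_const_mono // -polyCD => EE.
  exact: (const_power natFM nzy A_gt0 nzC EE).
exfalso; apply: not_H4.
have lc_nz k : lead_coef (texp 'X_k) != 0 by rewrite lead_coef_eq0 texp_nz.
have lc_var k : k != ix -> dg (texp 'X_k) = 0%N -> lead_coef (texp 'X_k) = tf 'X_k.
  by move=> nx; rewrite lead_coefE -/(dg _) => ->; rewrite (texp_coef0 tang nilpX) evX.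
have Ha j : lead_coef (texp 'X_(iz j)) = tf 'X_(iz j) \/ ~~ odd (b j).
  by case: (Hz j) => [/lc_var E0|->]; [left; rewrite E0 ?idxE|right].
have Hb l : lead_coef (texp 'X_(iss l)) = tf 'X_(iss l) \/ ~~ odd (c l).
  by case: (Hs l) => [/lc_var E0|->]; [left; rewrite E0 ?idxE|right].
have inj_z : injective iz by move=> j j' /eqP; rewrite idxE => /eqP.
have inj_s : injective iss by move=> l l' /eqP; rewrite idxE => /eqP.
split; [exact: leq_ltn_trans (ltn_ord l0)| | |by exists j0|by exists l0].
- by apply: (even_exponents inj_z _ _ _ Ha Hb lc) => *; rewrite ?idxE ?lc_nz.
- rewrite addrC in lc.
  by apply: (even_exponents inj_s _ _ _ Hb Ha lc) => *; rewrite ?idxE ?lc_nz.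
Qed.

(** A monomial of positive weight contains y_i. *)
Lemma kill_nonneg i (f : M) d : whom (wy i) d f -> 0 < d -> exists h, f = 'X_(iy i) * h.
Proof.
move=> wf d_gt0; have [mm s_mm|h [E _]] := @mpoly_divX _ _ U_(iy i)%MM f; last by exists h.
by have := wf _ s_mm; rewrite wt_wy lep1mP; case: (mm (iy i)) => // ?; lia.
Qed.

Lemma kill_y i h : g (iy i) = 'X_(iy i) * h -> ev (g (iy i)) = 0.
Proof.
move=> E; rewrite -[g _]DerX; apply: (nilp_dvd natFM tang nilpX (h := h)).
by rewrite DerX E.
Qed.

(** When no y_i moves, the curve of the flow satisfies z ^ b + s ^ c =
    constant. *)
Lemma all_y_killed : (forall i, ev (g (iy i)) = 0) -> forall k, ev (g k) = 0.
Proof.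
move=> gy0; have [] := @flow_const 1 1 (- ev 'X_ix * \prod_i ev 'X_(iy i) ^+ a i).
- exact: oner_neq0.
- by rewrite size_poly1.
- by [].
- rewrite mulf_neq0 ?oppr_eq0 ?evX_neq0 //.
  by apply/prodf_neq0 => i _; rewrite expf_neq0 ?evX_neq0.
- by move=> j; exists (texp (g (iz j))); rewrite expr0 mul1r.
- by move=> l; exists (texp (g (iss l))); rewrite expr0 mul1r.
- rewrite texp_const_mono; last by move=> i _.
  by rewrite expr1 -alg_polyC scalerA.
by move=> z0 s0 _ k; case: (idxP k).
Qed.

Variable kappa : 'I_m -> int.
Hypothesis g_hom : forall i k, whom (wy i) (wy i k + kappa i) (g k).

Lemma nonneg_kills i : 0 <= kappa i -> ev (g (iy i)) = 0.
Proof.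
move=> ge0; have := @g_hom i (iy i); rewrite wy_y eqxx => /kill_nonneg [|h]; first by lia.
exact: kill_y.
Qed.

(** A monomial of weight -1 contains x, hence y_i at least a_i - 1 times. *)
Lemma weight_m1_div i (f : M) : whom (wy i) (-1) f ->
  exists h, f = 'X_(iy i) ^+ (a i).-1 * h.
Proof.
move=> wf; have [mm s_mm|h [E _]] := @mpoly_divX _ _ (U_(iy i) *+ (a i).-1)%MM f.
  have := wf _ s_mm; rewrite wt_wy => wmm; apply/mnm_lepP => k.
  rewrite mulmnE mnm1E; case: eqP => [<-|_]; last by rewrite mul0n.
  rewrite mul1n; have := a_ge2 i; case: (mm ix) wmm => [|e]; first by lia.
  by rewrite mulnS; lia.
by exists h; rewrite mpolyXn.
Qed.

(** Here y_i is the only one of the y's to move. Its second derivative has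
    weight -1, hence is divisible by y_i ^ (a_i - 1); so y_i is a linear
    polynomial in the time. The derivatives of the z_j and s_l have weight -1
    as well, and are divisible by the same power of y_i. *)
Lemma one_special i : kappa i = -1 -> (forall i', i' != i -> 0 <= kappa i') ->
  forall k, ev (g k) = 0.
Proof.
move=> ki other.
have y_other i' : i' != i -> ev (g (iy i')) = 0 by move/other/nonneg_kills.
pose y := texp 'X_(iy i).
have y2 : y^`()^`() = 0.
  have [h Eh] : exists h, Der g (g (iy i)) = 'X_(iy i) ^+ (a i).-1 * h.
    apply: weight_m1_div; have := @g_hom i (iy i); rewrite wy_y eqxx ki => w0.
    have := @whom_Der _ _ _ _ (-1) _ g _ w0; rewrite add0r; apply => k.
    by rewrite -ki.
  have E2 : y^`()^`() = y * (y ^+ (a i).-2 * texp h).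
    rewrite /y texp_derX (texp_deriv natFM) Eh (texpM natFM) (texpX natFM) mulrA -exprS.
    by have := a_ge2 i; case: (a i) => [|[|?]].
  have [//|nz2] := eqVneq y^`()^`() 0; exfalso.
  have nzu : y ^+ (a i).-2 * texp h != 0 by apply: contraNneq nz2 => u0; rewrite E2 u0 mulr0.
  have := congr1 (fun u : {poly _} => size u) E2.
  rewrite size_mul ?texp_nz // !(size_deriv0 natFM) (dg_size (texp_nz _)) (dg_size nzu).
  by rewrite /= -/y; move: (dg y) (dg _) => ? ? /=; lia.
have szy : (size y <= 2)%N.
  have := congr1 (fun u : {poly _} => size u) y2.
  by rewrite !(size_deriv0 natFM) size_poly0; case: (size y) => [|[|[]]].
pose C := - ev 'X_ix * \prod_(i' | i' != i) ev 'X_(iy i') ^+ a i'.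
have Ddiv (f : M) : whom (wy i) (-1) f -> exists u, texp f = y ^+ (a i).-1 * u.
  by move/weight_m1_div => [h ->]; exists (texp h); rewrite (texpM natFM) (texpX natFM).
have [] := @flow_const y (a i) C.
- exact: texp_nz.
- exact: szy.
- exact: ltnW.
- rewrite mulf_neq0 ?oppr_eq0 ?evX_neq0 //.
  by apply/prodf_neq0 => i' _; rewrite expf_neq0 ?evX_neq0.
- by move=> j; apply: Ddiv; have := @g_hom i (iz j); rewrite wy_z ki.
- by move=> l; apply: Ddiv; have := @g_hom i (iss l); rewrite wy_s ki.
- rewrite (bigD1 i) //= -/y.
  rewrite (texp_const_mono (u := iy)); last by move=> i' /y_other.
  by rewrite mulrC mul_polyC scalerA.
move=> z0 s0 y0 k; case: (idxP k) => // i'.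
have [->|/y_other //] := eqVneq i' i.
by rewrite -(texp_coef0 tang nilpX) -texp_derX -/y y0 coef0.
Qed.

End Homogeneous.

(** * Locally nilpotent derivations kill the y_i *)

(** A derivation that kills x and is divisible by x stays locally nilpotent
    after division, x being a nonzero constant of it. *)
Section Divide.
Variables (g g' : 'I_n -> M).
Hypothesis tang : tangent ev g.
Hypothesis gx0 : ev (g ix) = 0.
Hypothesis gE : forall k, g k = 'X_ix * g' k.

Lemma Der_divx f : Der g f = 'X_ix * Der g' f.
Proof. by rewrite /Der mulr_sumr; apply: eq_bigr => k _; rewrite gE mulrCA. Qed.

Lemma tangent_divx : tangent ev g'.
Proof.
apply: (tangentP ev_eq0); have /eqP := tang (ev_F).
by rewrite Der_divx rmorphM mulf_eq0 (negbTE (evX_neq0 _)) => /eqP.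
Qed.

Lemma iter_Der_divx f r :
  ev (iter r (Der g) f) = ev ('X_ix ^+ r * iter r (Der g') f).
Proof.
have Dx s : ev (Der g ('X_ix ^+ s)) = 0.
  elim: s => [|s IH]; first by rewrite expr0 Der1 rmorph0.
  by rewrite exprS DerM DerX rmorphD !rmorphM IH gx0 mul0r mulr0 addr0.
elim: r => [|r IH]; first by rewrite expr0 mul1r.
rewrite !iterS; set A := iter r _ f in IH *; set B := iter r _ f in IH *.
have : ev (Der g A - Der g ('X_ix ^+ r * B)) = 0.
  by rewrite -DerB; apply: tang; rewrite rmorphB IH subrr.
rewrite rmorphB => /eqP; rewrite subr_eq0 => /eqP ->.
rewrite DerM rmorphD [X in X + _]rmorphM Dx mul0r add0r Der_divx.
by rewrite mulrA -exprSr.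
Qed.

Lemma nilp_divx f : nilp_at ev g f -> nilp_at ev g' f.
Proof.
move=> [r]; rewrite iter_Der_divx rmorphM rmorphXn => /eqP.
by rewrite mulf_eq0 expf_eq0 (negbTE (evX_neq0 _)) andbF => /eqP ?; exists r.
Qed.

End Divide.

(** Unless all_y_killed or one_special applies, negative weights force x to
    divide all the components of the derivation. Division by x raises the
    weight kappa_i by a_i, so this can be done only finitely often. *)
Lemma homogeneous_kill_x N (g : 'I_n -> M) (kappa : 'I_m -> int) :
  tangent ev g -> (forall k, nilp_at ev g 'X_k) -> ev (g ix) = 0 ->
  (forall i k, whom (wy i) (wy i k + kappa i) (g k)) ->
  (forall i, - N%:Z <= kappa i) -> forall k, ev (g k) = 0.
Proof.
elim: N g kappa => [|N IH] g kappa tang nilpX gx0 g_hom leN.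
  apply: (all_y_killed tang nilpX gx0) => i.
  apply: (nonneg_kills tang nilpX g_hom).
  by have := leN i; rewrite oppr0.
have [/forallP ge0|] := boolP [forall i, 0 <= kappa i].
  apply: (all_y_killed tang nilpX gx0) => i.
  exact: (nonneg_kills tang nilpX g_hom).
rewrite negb_forall => /existsP [i]; rewrite -ltNge => lt0.
have [special|] := boolP ((kappa i == -1) && [forall i', (i' != i) ==> (0 <= kappa i')]).
  case/andP: special => /eqP ki /forallP other.
  apply: (one_special tang nilpX gx0 g_hom ki).
  by move=> i' /(implyP (other i')).
move=> nspecial.
have div_x k mm : mm \in msupp (g k) -> (U_(ix) <= mm)%MM.
  move=> s_mm; rewrite lep1mP.
  have neg i' : wy i' k + kappa i' < 0 -> mm ix != 0%N.
    by have := g_hom i' k _ s_mm; rewrite wt_wy //; case: (mm ix) => // E; move: E; lia.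
  case: (idxP k) s_mm neg => [|i1|j|l] s_mm neg.
  - by apply: (neg i); rewrite wy_x; lia.
  - have [Ei|ne] := eqVneq i1 i; last by apply: (neg i); rewrite wy_y (negbTE ne); lia.
    have [m1|nm1] := eqVneq (kappa i) (-1); last first.
      by apply: (neg i); rewrite wy_y Ei eqxx; move: lt0 nm1; lia.
    move: nspecial; rewrite m1 eqxx negb_forall => /existsP [i'].
    rewrite negb_imply -ltNge => /andP [ne lt]; apply: (neg i').
    by rewrite wy_y Ei eq_sym (negbTE ne); lia.
  - by apply: (neg i); rewrite wy_z; lia.
  - by apply: (neg i); rewrite wy_s; lia.
have [g' g'P] := fin_all_exists (fun k => mpoly_divX (div_x k)).
have gE k : g k = 'X_ix * g' k by have [] := g'P k.
suff g'0 k : ev (g' k) = 0 by move=> k; rewrite gE rmorphM g'0 mulr0.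
apply: (IH g' (fun i => kappa i + (a i)%:Z)).
- exact: tangent_divx gE.
- by move=> k'; apply: (nilp_divx tang gx0 gE).
- by move/eqP: gx0; rewrite gE rmorphM mulf_eq0 (negbTE (evX_neq0 _)) => /eqP.
- move=> i' k' mm s_mm; have [_ /(_ _ s_mm) s_mm'] := g'P k'.
  by have := g_hom i' _ _ s_mm'; rewrite wtD wt1 wy_x; lia.
- by move=> i'; have := leN i'; have := a_ge2 i'; lia.
Qed.

(** Otherwise the lowest component for the weight of y_i0 has negative degree:
    in nonnegative degree y_i0 would divide its derivative. That component
    kills x, since by its weight x divides the derivative of x. Lowest
    components for the other weights make it homogeneous in all of them
    without making it zero, against homogeneous_kill_x. *)
Lemma lnd_kills_y (g : 'I_n -> M) : tangent ev g ->
  (forall k, nilp_at ev g 'X_k) -> forall i, ev (g (iy i)) = 0.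
Proof.
move=> tang nilpX i0; have [//|nz] := eqVneq (ev (g (iy i0))) 0; exfalso.
have [e [fil_e nz_e]] := lowest_degree ev_eq0 (F_hom i0) (ex_intro _ (iy i0) nz).
have e_lt0 : e < 0.
  rewrite ltNge; apply/negP => ge0; case/eqP: nz.
  have [h wh] := fil_e (iy i0); rewrite wy_y eqxx in wh.
  have [mm s_mm|u [Eu _]] := @mpoly_divX _ _ U_(iy i0)%MM (g (iy i0) - h * F).
    have := wh _ s_mm; rewrite wt_wy // lep1mP.
    by case: (mm (iy i0)) => // ?; lia.
  rewrite -[g _]DerX; apply: (nilp_dvd natFM tang nilpX (h := u)).
  by rewrite DerX -Eu rmorphB [ev (h * F)]rmorphM ev_F mulr0 subr0.
pose good (s : seq 'I_m) (g1 : 'I_n -> M) :=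
  [/\ tangent ev g1, forall k, nilp_at ev g1 'X_k, exists k, ev (g1 k) != 0,
      forall k, whom (wy i0) (wy i0 k + e) (g1 k) &
      forall i, i \in s -> exists d, forall k, whom (wy i) (wy i k + d) (g1 k)].
have [g1 [tang1 nilp1 [k1 nz1] hom0 hom1]] : exists g1, good (enum 'I_m) g1.
  elim: (enum _) => [|i s [g1 [tang1 nilp1 nz1 hom0 hom1]]].
    exists (low (wy i0) g e); split=> //; [by move=> f; exact: (low_tangent ev_eq0 (F_hom i0) tang fil_e)| |].
      move=> k; exact: (low_nilp ev_eq0 (F_hom i0) tang fil_e nilpX k).
    by move=> k; apply: low_hom.
  have [d [fil_d nz_d]] := lowest_degree ev_eq0 (F_hom i) nz1.
  exists (low (wy i) g1 d); split=> //.
  - by move=> f; exact: (low_tangent ev_eq0 (F_hom i) tang1 fil_d).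
  - by move=> k; exact: (low_nilp ev_eq0 (F_hom i) tang1 fil_d nilp1 k).
  - by move=> k mm /msupp_wcomp [/hom0 ->].
  - move=> i'; rewrite inE => /orP [/eqP ->|/hom1 [d' hd']].
      by exists d => k; apply: low_hom.
    by exists d' => k mm /msupp_wcomp [/hd' ->].
have [kap kapP] := fin_all_exists (fun i => hom1 i (mem_enum _ i)).
pose kappa i := if i == i0 then e else kap i.
have hom i k : whom (wy i) (wy i k + kappa i) (g1 k).
  by rewrite /kappa; case: eqP => [->|_].
have gx0 : ev (g1 ix) = 0.
  have [mm s_mm|u [Eu _]] := @mpoly_divX _ _ U_(ix)%MM (g1 ix).
    have := hom0 _ _ s_mm; rewrite wt_wy // wy_x lep1mP.
    by case: (mm ix) => // ?; have := a_ge2 i0; lia.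
  rewrite -[g1 _]DerX; apply: (nilp_dvd natFM tang1 nilp1 (h := u)).
  by rewrite DerX {1}Eu.
case/eqP: nz1.
apply: (@homogeneous_kill_x (\sum_i absz (kappa i))%N g1 kappa) => // i.
by rewrite (bigD1 i) //=; lia.
Qed.

(** * Points and vector fields of the hypersurface *)

Lemma coord_F (v : X) : F.@[coord v] = 0.
Proof. by have := valP v; rewrite /vanish /= andbT => /eqP. Qed.

Lemma X_eq (v w : X) : (forall k, coord v k = coord w k) -> v = w.
Proof. by move=> E; apply: val_inj; apply/rowP => k; apply: E. Qed.

Lemma mkpt_proof (u : 'I_n -> K) : F.@[u] = 0 -> vanish [:: F] (\row_k u k).
Proof.
move=> u0; rewrite /vanish /= andbT -[X in _ == X]u0; apply/eqP.
by apply: meval_eq => k; rewrite mxE.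
Qed.

Definition mkpt (u : 'I_n -> K) (u0 : F.@[u] = 0) : X :=
  exist (fun v => vanish [:: F] v) _ (mkpt_proof u0).

Lemma coord_mkpt u (u0 : F.@[u] = 0) k : coord (mkpt u0) k = u k.
Proof. by rewrite /coord /= mxE. Qed.

Definition eqX (f g : M) := forall v : X, f.@[coord v] = g.@[coord v].

Lemma eqX0P f : eqX f 0 <-> ev f = 0.
Proof.
split=> [f0|/ev_eq0 [h ->] v]; last by rewrite mevalM coord_F mulr0 meval0.
apply/ev_eq0; apply: (vanish_div) => v v0 _.
have := f0 (mkpt v0); rewrite meval0 => <-.
by apply: meval_eq => k; rewrite coord_mkpt.
Qed.

Lemma eqX_dense f g : (forall v : X, mu.@[coord v] != 0 -> f.@[coord v] = g.@[coord v]) ->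
  eqX f g.
Proof.
move=> fg; have [v v0 nz|h E] := @vanish_div (f - g).
  have E u : u.@[v] = u.@[coord (mkpt v0)].
    by apply: meval_eq => k; rewrite coord_mkpt.
  by rewrite mevalB !E fg ?subrr // -E.
by move=> v; apply/eqP; rewrite -subr_eq0 -mevalB E mevalM coord_F mulr0.
Qed.

Lemma eqX_F f g : eqX f g -> exists h, f = g + h * F.
Proof.
move=> fg; have /eqX0P/ev_eq0 [h E] : eqX (f - g) 0.
  by move=> v; rewrite mevalB fg subrr meval0.
by exists h; rewrite -E addrC subrK.
Qed.

Lemma eqX_ev f g : eqX f g <-> ev f = ev g.
Proof.
split=> [/eqX_F [h ->]|E v].
  by rewrite rmorphD rmorphM /= ev_F mulr0 addr0.
have /eqX0P/(_ v) : ev (f - g) = 0 by rewrite rmorphB E subrr.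
by rewrite mevalB meval0 => /eqP; rewrite subr_eq0 => /eqP.
Qed.

Lemma mu_eq0P v : reflect (exists i, v (iy i) = 0) (mu.@[v] == 0).
Proof.
rewrite evalmu; apply: (iffP idP) => [/prodf_eq0 [i _]|[i vi]].
  by rewrite expf_eq0 => /andP [_ /eqP]; exists i.
apply/prodf_eq0; exists i => //; rewrite vi expf_eq0 eqxx andbT.
exact: leq_trans (a_ge2 i).
Qed.

(** The vector field of the additive group that translates the coordinate k
    with velocity y_monomial and adapts x. *)
Definition dk (k j : 'I_n) : M :=
  if j == ix then - PP^`M(k) else if j == k then mu else 0.

Lemma Der_dk k f : k != ix ->
  Der (dk k) f = f^`M(k) * mu - f^`M(ix) * PP^`M(k).
Proof.
move=> nx; rewrite /Der (bigD1 ix) // (bigD1 k) //= big1 => [|j /andP [nj nk]].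
  by rewrite /dk eqxx (negbTE nx) eqxx; ring.
by rewrite /dk (negbTE nj) (negbTE nk) mulr0.
Qed.

Lemma mu_deriv0 k : ~~ is_y k -> mu^`M(k) = 0.
Proof.
move=> ny; apply: (@indep_deriv _ _ (pred1 k)); last by rewrite /= eqxx.
by apply: indep_mu => i /=; apply: contraNneq ny => <-; apply: is_y_iy.
Qed.

Lemma PP_deriv0 k : is_xy k -> PP^`M(k) = 0.
Proof.
move=> xy; apply: (@indep_deriv _ _ is_xy) => //.
by apply: indep_PP => j; rewrite /is_xy ?is_y_iz ?is_y_is idxE.
Qed.

Lemma mderiv_F k : F^`M(k) = (ix == k)%:R * mu + 'X_ix * mu^`M(k) + PP^`M(k).
Proof. by rewrite trinomialE mderivD mderivM mderiv_var. Qed.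

Lemma mderiv_Fx : F^`M(ix) = mu.
Proof.
rewrite mderiv_F eqxx mu_deriv0 ?is_y_ix // PP_deriv0 /is_xy ?eqxx //.
by rewrite mulr0 !addr0 mul1r.
Qed.

Lemma Der_dk_F k : ~~ is_xy k -> Der (dk k) F = 0.
Proof.
rewrite /is_xy negb_or => /andP [nx ny]; rewrite Der_dk // mderiv_Fx.
by rewrite mderiv_F [ix == k]eq_sym (negbTE nx) mu_deriv0 // mulr0n; ring.
Qed.

Lemma dk_tangent k : ~~ is_xy k -> tangent ev (dk k).
Proof. by move=> nk; apply: (tangentP ev_eq0); rewrite Der_dk_F // rmorph0. Qed.

Lemma dk_nilp k f : ~~ is_xy k -> nilp_at ev (dk k) f.
Proof.
move=> nk; have tk := dk_tangent nk.
have nx : k != ix by apply: contraNneq nk => ->; rewrite /is_xy eqxx.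
have nilp_mu : nilp_at ev (dk k) mu.
  exists 1%N; rewrite /= Der_dk // !mu_deriv0 ?is_y_ix //.
    by rewrite !mul0r subrr rmorph0.
  by apply: contraNN nk; rewrite /is_xy orbC => ->.
have nilpX j : j != ix -> nilp_at ev (dk k) 'X_j.
  move=> nj; apply: nilp_at_Der; rewrite DerX /dk (negbTE nj).
  by case: eqP => // _; exists 0%N; rewrite /= rmorph0.
have nilpE u e : nilp_at ev (dk k) u -> nilp_at ev (dk k) (u ^+ e).
  move=> nu; elim: e => [|e IH]; first by rewrite expr0 -mpolyC1; apply: nilp_atC.
  by rewrite exprS; apply: nilp_atM.
have nilp_PP : nilp_at ev (dk k) PP.
  apply: nilp_atD => //; rewrite ?/z_monomial ?/s_monomial; elim/big_ind: _ => [|? ?|i _].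
  - by rewrite -mpolyC1; apply: nilp_atC.
  - exact: nilp_atM.
  - by apply/nilpE/nilpX; rewrite idxE.
  - by rewrite -mpolyC1; apply: nilp_atC.
  - exact: nilp_atM.
  - by apply/nilpE/nilpX; rewrite idxE.
(* The derivative of PP is - mu times that of x, and mu is a constant: so x
   inherits the nilpotency of PP. *)
apply: nilp_at_all => // j; have [->|] := eqVneq j ix; last exact: nilpX.
have [r r0] := nilp_PP; exists r.+1; move: r0; case: r => [|r].
  by rewrite /= => r0; exfalso; move/eqP: r0; rewrite ev_PP tofrac_eq0 (negbTE (@PP_neq0)).
have iter_mu s u : iter s (Der (dk k)) (u * mu) = iter s (Der (dk k)) u * mu.
  elim: s => //= s ->; rewrite DerM [Der _ mu]Der_dk // !mu_deriv0 ?is_y_ix //; first by ring.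
  by apply: contraNN nk; rewrite /is_xy orbC => ->.
have iterN s u : iter s (Der (dk k)) (- u) = - iter s (Der (dk k)) u.
  by elim: s => //= s ->; rewrite DerN.
rewrite iterSr [Der _ PP]Der_dk // [PP^`M(ix)]PP_deriv0 /is_xy ?eqxx //.
rewrite mul0r subr0 iter_mu rmorphM => /eqP; rewrite mulf_eq0 ev_mu tofrac_eq0.
rewrite (negbTE (@mu_neq0)) orbF => /eqP r0.
have dkx : dk k ix = - PP^`M(k) by rewrite /dk eqxx.
by rewrite iterSr DerX dkx iterN iterS rmorphN (tk _ r0) oppr0.
Qed.

(** * Automorphisms and the fibres of y *)

(** The segment joining two points of a fibre of y over a point where no y_i
    vanishes: x is a function of the other coordinates there. *)
Section FiberLine.
Variables v w : X.
Hypothesis nz_mu : mu.@[coord v] != 0.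
Hypothesis eq_y : forall i, coord v (iy i) = coord w (iy i).

Let mv := mu.@[coord v].
Let cc k := if is_xy k then 0 else coord w k - coord v k.
Let g0 k : {poly K} := (coord v k)%:P + cc k *: 'X.
Definition fline k := if k == ix then - mv^-1 *: mmap polyC g0 PP else g0 k.
Local Notation gam := fline.

Lemma fline_PP : mmap polyC gam PP = mmap polyC g0 PP.
Proof.
have IP : indep (pred1 ix) PP by apply: indep_PP => j /=; rewrite ?idxE.
by apply: IP => k /= nx; rewrite /fline (negbTE nx).
Qed.

Lemma fline_y i : gam (iy i) = (coord v (iy i))%:P.
Proof. by rewrite /fline idxE /g0 /cc /is_xy is_y_iy orbT scale0r addr0. Qed.

Lemma fline_mu : mmap polyC gam mu = mv%:P.
Proof.
rewrite rmorph_prod /mv evalmu rmorph_prod; apply: eq_bigr => i' _.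
by rewrite !rmorphXn /= mmapX mmap1U fline_y.
Qed.

Lemma fline_inX t : F.@[fun k => (gam k).[t]] = 0.
Proof.
rewrite -horner_mmap trinomialE mmapD rmorphM /= mmapX mmap1U fline_mu fline_PP.
rewrite {1}/fline eqxx mulrC mul_polyC scalerA mulrN mulfV // scaleN1r addNr.
by rewrite horner0.
Qed.

Definition fline_pt t : X := mkpt (fline_inX t).

Lemma fline_ptE (phi : M) t : phi.@[coord (fline_pt t)] = (mmap polyC gam phi).[t].
Proof. by rewrite horner_mmap; apply: meval_eq => k; rewrite coord_mkpt. Qed.

Lemma coord_fline_pt t k : coord (fline_pt t) k = (gam k).[t].
Proof. by rewrite coord_mkpt. Qed.

Lemma fline_ends t (v1 : X) : mu.@[coord v1] = mv ->
  (forall k, k != ix -> (g0 k).[t] = coord v1 k) -> fline_pt t = v1.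
Proof.
move=> mu1 E; apply: X_eq => k; rewrite coord_fline_pt /fline.
case: eqP => [->|/eqP /E //]; apply: (@mulIf _ mv) => //.
have -> : coord v1 ix * mv = - PP.@[coord v1].
  by have := coord_F v1; rewrite evalF mu1 => /eqP; rewrite addr_eq0 => /eqP.
rewrite hornerZ mulrAC mulNr mulVf // mulN1r horner_mmap; congr (- _).
apply: (@indep_meval _ _ (pred1 ix)) => [|k' /E //].
by apply: indep_PP => j /=; rewrite ?idxE.
Qed.

Lemma fline_pt0 : fline_pt 0 = v.
Proof.
by apply: fline_ends => // k _; rewrite hornerD hornerC hornerZ hornerX mulr0 addr0.
Qed.

Lemma fline_pt1 : fline_pt 1 = w.
Proof.
apply: fline_ends => [|k nx].
  by rewrite /mv !evalmu; apply: eq_bigr => i' _; rewrite eq_y.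
rewrite hornerD hornerC hornerZ hornerX mulr1 /cc.
case: (idxP k) nx => [|i'|j|l]; rewrite ?eqxx // => _.
- by rewrite /is_xy is_y_iy orbT addr0 eq_y.
- by rewrite /is_xy is_y_iz idxE addrC subrK.
- by rewrite /is_xy is_y_is idxE addrC subrK.
Qed.

(** The velocity of the segment is a combination of the vector fields dk, so
    phi has derivative 0 along it. *)
Lemma fline_const phi : (forall k, ~~ is_xy k -> eqX (Der (dk k) phi) 0) ->
  phi.@[coord v] = phi.@[coord w].
Proof.
move=> D0; have der_gam k : k != ix -> (gam k)^`() = (cc k)%:P.
  move=> nx; rewrite /fline (negbTE nx) derivD derivC derivZ derivX add0r.
  by rewrite alg_polyC.
have der_x : (gam ix)^`() = - mv^-1 *: \sum_(k | k != ix) mmap polyC gam PP^`M(k) * (cc k)%:P.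
  rewrite {1}/fline eqxx derivZ -fline_PP deriv_mmap (bigD1 ix) //=.
  rewrite PP_deriv0 ?/is_xy ?eqxx // mmap0 mul0r add0r; congr (_ *: _).
  by apply: eq_bigr => k nx; rewrite der_gam.
have dphi : (mmap polyC gam phi)^`() = 0.
  rewrite deriv_mmap (bigD1 ix) //= der_x.
  rewrite -scalerAr mulr_sumr scaler_sumr -big_split big1 // => k nx /=.
  rewrite der_gam //; have [xy|nxy] := boolP (is_xy k).
    by rewrite /cc xy !mulr0 scaler0 addr0.
  have : mmap polyC gam (Der (dk k) phi) = 0.
    by apply: poly_vanish0 => t; rewrite -fline_ptE D0 // meval0.
  rewrite Der_dk // rmorphB !rmorphM /= fline_mu => /eqP.
  rewrite subr_eq0 => /eqP E.
  have -> : mmap polyC gam phi^`M(k) =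
      (mv^-1)%:P * (mmap polyC gam phi^`M(ix) * mmap polyC gam PP^`M(k)).
    by rewrite -E mulrCA -polyCM mulVf // mulr1.
  by rewrite -!mul_polyC polyCN; ring.
have /eqP : dg (mmap polyC gam phi) == 0%N.
  by rewrite (dg0_deriv (natK_neq0 charK0)) dphi.
rewrite /dg => s1; have le1 : (size (mmap polyC gam phi) <= 1)%N.
  by move: s1; case: (size _) => [|[]].
by rewrite -fline_pt0 -fline_pt1 !fline_ptE (size1_polyC le1) !hornerC.
Qed.

End FiberLine.

(** Phi and Psi are polynomials that represent a pair of mutually inverse
    regular maps. *)
Section Pair.
Variables (f f' : X -> X) (Phi Psi : 'I_n -> M).
Hypothesis fE : forall v k, coord (f v) k = (Phi k).@[coord v].
Hypothesis f'E : forall v k, coord (f' v) k = (Psi k).@[coord v].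
Hypothesis fK : cancel f f'.
Hypothesis f'K : cancel f' f.

Lemma eval_f h v : (subst Phi h).@[coord v] = h.@[coord (f v)].
Proof. by rewrite meval_subst; apply: meval_eq => k; rewrite fE. Qed.

Lemma eval_f' h v : (subst Psi h).@[coord v] = h.@[coord (f' v)].
Proof. by rewrite meval_subst; apply: meval_eq => k; rewrite f'E. Qed.

(** The transport of the vector field d by f, the inverse of which has
    components Psi. *)
Definition conj_der (d : 'I_n -> M) k := subst Phi (Der d (Psi k)).

Section Conj.
Variable d : 'I_n -> M.
Hypothesis tang : tangent ev d.

Lemma conj_derE h : eqX (Der (conj_der d) h) (subst Phi (Der d (subst Psi h))).
Proof.
move=> v; rewrite Der_subst rmorph_sum {1}/Der !raddf_sum; apply: eq_bigr => k _ /=.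
rewrite mevalM [subst Phi _]rmorphM mevalM /conj_der !eval_f eval_f'; congr (_ * _).
by rewrite fK.
Qed.

Lemma eqX_Der g h : eqX g h -> eqX (Der d g) (Der d h).
Proof.
move=> /eqX_ev gh; apply/eqX_ev/eqP; rewrite -subr_eq0 -rmorphB -DerB.
by rewrite tang // rmorphB gh subrr.
Qed.

Lemma conj_tangent : tangent ev (conj_der d).
Proof.
move=> h h0; rewrite -(rmorph0 ev); apply/eqX_ev => v; rewrite conj_derE eval_f.
have h0X : eqX h 0 by apply/eqX_ev; rewrite h0 rmorph0.
have : eqX (subst Psi h) 0 by move=> w; rewrite eval_f' h0X !meval0.
by move/eqX_Der => ->; rewrite Der0 !meval0.
Qed.

Lemma conj_nilp : (forall k, nilp_at ev d (Psi k)) ->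
  forall k, nilp_at ev (conj_der d) 'X_k.
Proof.
move=> nd k; have [r r0] := nd k; exists r.
suff E s : eqX (iter s (Der (conj_der d)) 'X_k) (subst Phi (iter s (Der d) (Psi k))).
  rewrite -(rmorph0 ev); apply/eqX_ev => v; rewrite E eval_f meval0.
  have : eqX (iter r (Der d) (Psi k)) 0 by apply/eqX_ev; rewrite r0 rmorph0.
  by move->; rewrite meval0.
elim: s => [|s IH] v /=.
  by rewrite mevalXU eval_f -f'E fK.
set A := iter s _ _ in IH *; set B := iter s _ _ in IH *.
have : eqX (Der (conj_der d) A) (Der (conj_der d) (subst Phi B)).
  apply/eqX_ev/eqP; rewrite -subr_eq0 -rmorphB -DerB.
  by rewrite conj_tangent //; move/eqX_ev: IH => E; rewrite rmorphB E subrr.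
move->; rewrite conj_derE !eval_f; apply: eqX_Der => w.
by rewrite eval_f' eval_f f'K.
Qed.

End Conj.

(** The transport of dk by f is locally nilpotent, hence kills the y_i by
    lnd_kills_y. *)
Lemma replicas_kill_y k i : ~~ is_xy k -> eqX (Der (dk k) (Psi (iy i))) 0.
Proof.
move=> nk v; have tk := @dk_tangent k nk.
have ng k' := @dk_nilp k (Psi k') nk.
have tc : tangent ev (conj_der (dk k)) by move=> h; apply: conj_tangent.
have E := lnd_kills_y tc (conj_nilp tk ng) i.
have : eqX (conj_der (dk k) (iy i)) 0 by apply/eqX_ev; rewrite E rmorph0.
by move/(_ (f' v)); rewrite /conj_der eval_f f'K !meval0.
Qed.

Lemma replicas_y_const i (v w : X) : mu.@[coord v] != 0 ->
  (forall i', coord v (iy i') = coord w (iy i')) ->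
  coord (f' v) (iy i) = coord (f' w) (iy i).
Proof.
move=> nz_mu eq_y; rewrite !f'E; apply: (fline_const nz_mu eq_y) => k.
exact: replicas_kill_y.
Qed.

(** By replicas_y_const, y_i o f' is constant on the general fibres of y. So
    it may be computed along a section of y, and it is a polynomial in the
    y_i. *)
Section YSection.
Variable u0 : 'I_n -> K.
Hypothesis PPu0 : PP.@[u0] = 0.

Definition ysec (k : 'I_n) : M :=
  if k == ix then 0 else if is_y k then 'X_k else (u0 k)%:MP.

Lemma ysecE v k :
  (ysec k).@[v] = if k == ix then 0 else if is_y k then v k else u0 k.
Proof.
by rewrite /ysec; case: ifP => _; [rewrite meval0|case: ifP => _; rewrite ?mevalXU ?mevalC].
Qed.

Lemma ysec_inX (v : 'I_n -> K) : F.@[fun k => (ysec k).@[v]] = 0.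
Proof.
rewrite evalF ysecE eqxx mul0r add0r -[RHS]PPu0.
apply: (@indep_meval _ _ is_xy) => [|k].
  by apply: indep_PP => j; rewrite /is_xy ?is_y_iz ?is_y_is idxE.
by rewrite /is_xy negb_or ysecE => /andP [/negbTE -> /negbTE ->].
Qed.

Definition ysec_pt (v : 'I_n -> K) : X := mkpt (ysec_inX v).

Lemma ysec_pt_y v i : coord (ysec_pt v) (iy i) = v (iy i).
Proof. by rewrite coord_mkpt ysecE idxE is_y_iy. Qed.

Lemma y_ysec i (v : X) : coord (f' v) (iy i) = coord (f' (ysec_pt (coord v))) (iy i).
Proof.
have E : eqX (Psi (iy i)) (subst ysec (Psi (iy i))).
  apply: eqX_dense => v' nz_mu; rewrite -f'E (@replicas_y_const i _ (ysec_pt (coord v'))) //.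
    by rewrite f'E meval_subst; apply: meval_eq => k; rewrite coord_mkpt.
  by move=> i'; rewrite ysec_pt_y.
rewrite !f'E E meval_subst; apply: meval_eq => k; by rewrite coord_mkpt.
Qed.

End YSection.

End Pair.

(** * Automorphisms and singularities *)

Definition biregular (f f' : X -> X) :=
  [/\ regular f, regular f', cancel f f' & cancel f' f].

Lemma biregular_sym f f' : biregular f f' -> biregular f' f.
Proof. by case. Qed.

Lemma PP_root : exists u0, PP.@[u0] = 0.
Proof.
have j0 : 'I_p := Ordinal p_ge1.
have [r Er] : exists r : K, root ('X^(b j0) + 1%:P) r.
  by apply/closed_rootP; rewrite size_XnaddC ?(leq_trans _ (b_ge2 j0)) // eqSS -lt0n
    (leq_trans _ (b_ge2 j0)).
exists (fun k => if k == iz j0 then r else 1).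
rewrite evalPP (bigD1 j0) //= eqxx big1 => [|j /negbTE ne]; last first.
  by rewrite idxE ne expr1n.
rewrite big1 => [|l _]; last by rewrite idxE expr1n.
by move: Er; rewrite /root hornerD hornerXn hornerC mulr1 => /eqP.
Qed.

Section Bi.
Variables f f' : X -> X.
Hypothesis bi : biregular f f'.

Lemma y_ysec_bi u0 (PPu0 : PP.@[u0] = 0) i v :
  coord (f v) (iy i) = coord (f (ysec_pt PPu0 (coord v))) (iy i).
Proof.
have [[Phi fE] [Psi f'E] fK f'K] := bi.
exact: (y_ysec f'E fE f'K fK).
Qed.

(** By y_ysec_bi both sides are computed at the same point of a section of y. *)
Lemma y_same (v w : X) : (forall i, coord v (iy i) = coord w (iy i)) ->
  forall i, coord (f v) (iy i) = coord (f w) (iy i).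
Proof.
move=> E i; have [u0 u00] := PP_root; rewrite (y_ysec_bi u00 i v) (y_ysec_bi u00 i w).
congr (coord (f _) _); apply: X_eq => k; rewrite !coord_mkpt !ysecE.
case: ifP => // _; case: ifP => // /existsP [i' /eqP ->]; exact: E.
Qed.

(** Vanishing of the gradient of the defining polynomial. *)
Definition singular (v : X) := forall k, F^`M(k).@[coord v] = 0.

(** At a singular point multiples of F have zero gradient, so the Jacobian
    matrices of f and of its inverse are inverse to each other, and the
    gradient of F at the image is killed by an invertible matrix. *)
Lemma singular_bi v : singular v -> singular (f v).
Proof.
move=> sv; have [[Phi fE] [Psi f'E] fK f'K] := bi.
pose A : 'M[K]_n := \matrix_(i, j) (Psi i)^`M(j).@[coord (f v)].
pose B : 'M[K]_n := \matrix_(j, k) (Phi j)^`M(k).@[coord v].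
have chain h k : (subst Phi h)^`M(k).@[coord v] =
    \sum_j h^`M(j).@[coord (f v)] * B j k.
  rewrite mderiv_subst raddf_sum; apply: eq_bigr => j _ /=.
  by rewrite mevalM (eval_f fE) mxE.
have multF h k : (h * F)^`M(k).@[coord v] = 0.
  by rewrite mderivM mevalD !mevalM coord_F sv !mulr0 addr0.
have AB : A *m B = 1%:M.
  apply/matrixP => i k; rewrite !mxE.
  under eq_bigr => j _ do rewrite mxE.
  have [h E] : exists h, subst Phi (Psi i) = 'X_i + h * F.
    by apply: eqX_F => w; rewrite (eval_f fE) -f'E fK mevalXU.
  rewrite -chain E mderivD mevalD multF addr0 mderiv_var.
  by case: eqP => _; rewrite ?meval1 ?meval0.
have gB : (\row_j F^`M(j).@[coord (f v)]) *m B = 0.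
  apply/rowP => k; rewrite !mxE; under eq_bigr => j _ do rewrite mxE.
  have [h E] : exists h, subst Phi F = 0 + h * F.
    by apply: eqX_F => w; rewrite (eval_f fE) coord_F meval0.
  by rewrite -chain E add0r multF.
move=> k; have : (\row_j F^`M(j).@[coord (f v)]) = 0.
  by rewrite -[LHS]mulmx1 -(mulmx1C AB) mulmxA gB mul0mx.
by move/rowP/(_ k); rewrite !mxE.
Qed.

End Bi.

Lemma mono_deriv_root (I : finType) (u : I -> 'I_n) (e : I -> nat) i0 k v :
  (2 <= e i0)%N -> v (u i0) = 0 ->
  (\prod_i ('X_(u i) : M) ^+ e i)^`M(k).@[v] = 0.
Proof.
move=> e2 v0; rewrite (bigD1 i0) //= mderivM mevalD !mevalM mderiv_exp.
rewrite rmorphMn /= !mevalM !rmorphXn /= mevalXU v0 !expr0n.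
by case: (e i0) e2 => [|[|e']] // _; rewrite /= mulr0 mul0rn !mul0r addr0.
Qed.

Lemma mono_deriv (I : finType) (u : I -> 'I_n) (e : I -> nat) i0 v :
  injective u ->
  v (u i0) * (\prod_i ('X_(u i) : M) ^+ e i)^`M(u i0).@[v] =
  (\prod_i v (u i) ^+ e i) *+ e i0.
Proof.
move=> inju; rewrite (bigD1 i0) //= mderivM.
have -> : (\prod_(i | i != i0) ('X_(u i) : M) ^+ e i)^`M(u i0) = 0.
  apply: (@indep_deriv _ _ (pred1 (u i0))); last by rewrite /= eqxx.
  by apply: indep_prod => i ne; apply/indepE/indepX; rewrite /= (inj_eq inju).
rewrite mulr0 addr0 mevalM mderiv_exp mderiv_var eqxx mul1r rmorphMn rmorphXn /=.
rewrite mevalXU mulrA mulrnAr -exprS [in RHS](bigD1 i0) //= rmorph_prod.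
under eq_bigr => i _ do rewrite rmorphXn /= mevalXU.
by case: (e i0) => [|e']; rewrite ?mulr0n ?mul0r // -mulrnAl.
Qed.

Lemma prodX_eq0 (I : finType) (u : I -> 'I_n) (e : I -> nat) (v : 'I_n -> K) :
  \prod_i v (u i) ^+ e i = 0 -> exists i, v (u i) = 0.
Proof.
by move/eqP/prodf_eq0 => [i _]; rewrite expf_eq0 => /andP [_ /eqP]; exists i.
Qed.

(** The derivative in x is the monomial in the y_i, and z_j times the
    derivative in z_j is b_j times the monomial in the z_j; the equation of X
    then makes the last monomial vanish. *)
Lemma singularP v : singular v <->
  [/\ exists i, coord v (iy i) = 0, exists j, coord v (iz j) = 0 &
      exists l, coord v (iss l) = 0].
Proof.
split=> [sv|[[i vi] [j vj] [l vl]] k].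
  have mu0 : mu.@[coord v] = 0 by have := sv ix; rewrite mderiv_Fx.
  have [i vi] : exists i, coord v (iy i) = 0 by apply/mu_eq0P/eqP.
  have z0 : (\prod_j coord v (iz j) ^+ b j) = 0.
    pose j := Ordinal p_ge1; have := sv (iz j).
    have inj_z : injective iz by move=> j1 j2 /eqP; rewrite idxE => /eqP.
    have gs0 : gs^`M(iz j) = 0.
      apply: (@indep_deriv _ _ (pred1 (iz j))); last by rewrite /= eqxx.
      by apply: indep_prod => l _; apply/indepE/indepX; rewrite /= idxE.
    rewrite mderiv_F idxE mu_deriv0 ?is_y_iz // mderivD gs0 addr0 mulr0 mulr0n mul0r !add0r.
    move/(congr1 ( *%R (coord v (iz j)))); rewrite mono_deriv // mulr0 => /eqP.
    rewrite -mulr_natr mulf_eq0 => /orP [/eqP //|].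
    by have := b_ge2 j; case: (b j) => // e _; rewrite (negbTE (natK_neq0 charK0 _)).
  have s0 : (\prod_l coord v (iss l) ^+ c l) = 0.
    have := coord_F v; rewrite evalF mu0 mulr0 add0r evalPP z0 add0r.
    exact.
  by split; [exists i|exact: prodX_eq0 z0|exact: prodX_eq0 s0].
rewrite mderiv_F !mevalD !mevalM mevalXU mderivD mevalD.
have -> : mu.@[coord v] = 0 by apply/eqP/(mu_eq0P); exists i.
rewrite /y_monomial (mono_deriv_root k (a_ge2 i) vi) (mono_deriv_root k (b_ge2 j) vj).
by rewrite (mono_deriv_root k (c_ge2 l) vl) !mulr0 !addr0.
Qed.

Lemma nontrivial_root_of_unity e : (2 <= e)%N -> exists2 r : K, r ^+ e = 1 & r != 1.
Proof.
move=> e2; pose Q : {poly K} := \sum_(i < e) 'X^i.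
have [r /eqP Qr] : exists r, root Q r.
  apply/closed_rootP; suff -> : Q = \poly_(i < e) 1 by rewrite size_poly_eq ?oner_neq0 ?gtn_eqF.
  by rewrite poly_def; apply: eq_bigr => i _; rewrite scale1r.
exists r.
  have := subrX1 r e; have -> : \sum_(i < e) r ^+ i = Q.[r].
    by rewrite horner_sum; apply: eq_bigr => i _; rewrite hornerXn.
  by rewrite Qr mulr0 => /eqP; rewrite subr_eq0 => /eqP.
apply/eqP => r1; have : Q.[r] = e%:R.
  rewrite horner_sum r1 (eq_bigr (fun=> 1)) => [|i _]; last by rewrite hornerXn expr1n.
  by rewrite sumr_const card_ord.
rewrite Qr; case: e e2 {Q Qr} => // e _ /esym/eqP.
by rewrite (negbTE (natK_neq0 charK0 _)).
Qed.

Lemma nonvanishing_const (u : {poly K}) t t' : (forall t, u.[t] != 0) -> u.[t] = u.[t'].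
Proof.
move=> nz; have [s1|s1] := eqVneq (size u) 1%N.
  by rewrite (size1_polyC (eq_leq s1)) !hornerC.
by have [r /eqP ur] := closed_rootP u s1; have := nz r; rewrite ur eqxx.
Qed.

(** If q > 0, the singular locus is mapped by y onto the points with
    y_monomial = 0, and f preserves it. If q = 0 and y_monomial vanishes at v
    but not at f v, then z_j0 has no zero on the fibre of v and takes two
    values there; but the image of this fibre is a fibre of the second kind,
    whose points are joined by segments, and on these a polynomial without
    zeros is constant. *)
Lemma mu0_bi f f' v : biregular f f' -> mu.@[coord v] = 0 -> mu.@[coord (f v)] = 0.
Proof.
move=> bi /eqP mv0; have [i vi] := mu_eq0P _ mv0.
apply/eqP; have [q0|q_gt0] := posnP q; last first.
  have u00 : PP.@[fun=> 0] = 0.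
    rewrite evalPP (bigD1 (Ordinal p_ge1)) //= (bigD1 (Ordinal q_gt0)) //=.
    by rewrite !expr0n b_eq0 c_eq0 !mul0r addr0.
  have /(singular_bi bi)/singularP [[i' Ei'] _ _] :
      singular (ysec_pt u00 (coord v)).
    apply/singularP; split; first by exists i; rewrite ysec_pt_y.
      by exists (Ordinal p_ge1); rewrite coord_mkpt ysecE is_y_iz idxE.
    by exists (Ordinal q_gt0); rewrite coord_mkpt ysecE is_y_is idxE.
  by apply/mu_eq0P; exists i'; rewrite (y_ysec_bi bi u00).
apply/negPn/negP => nz; have [[Phi fE] [Psi f'E] fK f'K] := bi.
have bi' := biregular_sym bi; set w := f v in nz.
have [u0 u00] := PP_root; pose j0 := Ordinal p_ge1.
have gs1 u : \prod_(l < q) u (iss l) ^+ c l = 1 :> K.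
  by rewrite big1 // => l; have := ltn_ord l; rewrite {2}q0.
have [r rb r1] := nontrivial_root_of_unity (b_ge2 j0).
pose u1 k := if k == iz j0 then r * u0 k else u0 k.
have u10 : PP.@[u1] = 0.
  rewrite -u00 !evalPP !gs1; congr (_ + _).
  rewrite (bigD1 j0) //= [RHS](bigD1 j0) //= /u1 eqxx exprMn rb mul1r.
  by congr (_ * _); apply: eq_bigr => j /negbTE ne; rewrite idxE ne.
pose v1 := ysec_pt u00 (coord v); pose v2 := ysec_pt u10 (coord v).
have y1 : forall i', coord (f v1) (iy i') = coord w (iy i').
  by move=> i'; apply: (y_same bi) => i2; rewrite ysec_pt_y.
have y2 : forall i', coord (f v1) (iy i') = coord (f v2) (iy i').
  by move=> i'; apply: (y_same bi) => i2; rewrite !ysec_pt_y.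
have nz1 : mu.@[coord (f v1)] != 0.
  by rewrite evalmu (eq_bigr (fun i' => coord w (iy i') ^+ a i')) -?evalmu // => i' _; rewrite y1.
pose h := mmap polyC (fline (f v1) (f v2)) (Psi (iz j0)).
have hE t : h.[t] = coord (f' (fline_pt (f v2) nz1 t)) (iz j0).
  by rewrite f'E fline_ptE.
have : h.[0] = h.[1].
  apply: nonvanishing_const => t; rewrite hE; set w' := fline_pt _ _ _.
  have mw0 : mu.@[coord (f' w')] = 0.
    apply/eqP/(mu_eq0P); exists i.
    rewrite (@y_same _ _ bi' w' (f v1)) => [|i2]; last first.
      by rewrite coord_fline_pt fline_y hornerC.
    by rewrite fK ysec_pt_y.
  apply: contraTneq (oner_neq0 K) => zj0; rewrite negbK; apply/eqP.
  have := coord_F (f' w'); rewrite evalF mw0 mulr0 add0r evalPP gs1 (bigD1 j0) //= zj0.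
  by rewrite expr0n b_eq0 mul0r add0r.
rewrite !hE fline_pt0 (fline_pt1 nz1 y2) !fK !coord_mkpt !ysecE is_y_iz idxE /u1 eqxx.
move/eqP; rewrite -subr_eq0 -{1}[u0 _]mul1r -mulrBl mulf_eq0 subr_eq0 eq_sym (negbTE r1) /=.
move=> /eqP z0; have := u00; rewrite evalPP gs1 (bigD1 j0) //= z0.
rewrite expr0n b_eq0 mul0r add0r => /eqP.
by rewrite (negbTE (oner_neq0 K)).
Qed.

(** * Divisors and strata preserved by automorphisms *)

Definition zeroed (S : pred 'I_n) (k : 'I_n) : M := if S k then 0 else 'X_k.

Lemma zeroedE S v k : (zeroed S k).@[v] = if S k then 0 else v k.
Proof. by rewrite /zeroed; case: ifP => _; rewrite ?meval0 ?mevalXU. Qed.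

Lemma prod_vanish (I : finType) (E : I -> M) :
  (forall v, exists i, (E i).@[v] = 0) -> exists i, E i = 0.
Proof.
move=> E0; suff /eqP/prodf_eq0 [i _ /eqP] : \prod_i E i = 0 by exists i.
apply: (mpoly_vanish0 charK0) => v; rewrite rmorph_prod /=; have [i Ei] := E0 v.
by rewrite (bigD1 i) //= Ei mul0r.
Qed.

Lemma closed_coord0 k : zariski_closed (fun v : X => coord v k = 0).
Proof.
apply: (@closed_ext _ _ _ (fun v => ('X_k : M).@[coord v] = 0)); last exact: closed_poly.
by move=> v; rewrite mevalXU.
Qed.

Lemma closed_and (C D : X -> Prop) :
  zariski_closed C -> zariski_closed D -> zariski_closed (fun v => C v /\ D v).
Proof.
move=> cC cD; apply: (@closed_ext _ _ _ (fun v => forall b : bool, if b then C v else D v)).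
  by move=> v; split=> [CD|[Cv Dv] []//]; split; [apply: (CD true)|apply: (CD false)].
by apply: closed_forall => -[].
Qed.

(** On y_i = 0 the y-coordinates of the image are polynomials in y by
    y_ysec_bi, and the product of them vanishes there by mu0_bi; hence one of
    them is zero. *)
Lemma biregular_y f f' i : biregular f f' ->
  exists i', forall v : X, coord v (iy i) = 0 -> coord (f v) (iy i') = 0.
Proof.
move=> bi; have [u0 u00] := PP_root.
have [[Phi fE] _ _ _] := bi.
pose S := pred1 (iy i).
pose r i' := subst (zeroed S) (subst (ysec u0) (Phi (iy i'))).
have rE i' (v : 'I_n -> K) : v (iy i) = 0 ->
    (r i').@[v] = coord (f (ysec_pt u00 v)) (iy i').
  move=> vi; rewrite fE !meval_subst; apply: meval_eq => k; rewrite coord_mkpt.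
  apply: meval_eq => k'; rewrite zeroedE /S /=; case: eqP => // ->.
  by rewrite vi.
have [v|i' ri'] := @prod_vanish _ r.
  pose v' k := if S k then 0 else v k.
  have v'i : v' (iy i) = 0 by rewrite /v' /S /= eqxx.
  have [i' Ei'] : exists i', coord (f (ysec_pt u00 v')) (iy i') = 0.
    apply/mu_eq0P/eqP/(mu0_bi bi).
    by apply/eqP/(mu_eq0P); exists i; rewrite ysec_pt_y.
  exists i'; rewrite -Ei' -rE // meval_subst [RHS]meval_subst.
  by apply: meval_eq => k; rewrite !zeroedE /v'; case: ifP.
exists i' => v vi; rewrite (y_ysec_bi bi u00) -rE //.
by rewrite ri' meval0.
Qed.

(** The irreducible components of the singular locus. *)
Definition stratum (t : 'I_m * 'I_p * 'I_q) (v : X) :=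
  [/\ coord v (iy t.1.1) = 0, coord v (iz t.1.2) = 0 & coord v (iss t.2) = 0].

Lemma closed_stratum t : zariski_closed (stratum t).
Proof.
apply: (@closed_ext _ _ _ (fun v : X => coord v (iy t.1.1) = 0 /\
    (coord v (iz t.1.2) = 0 /\ coord v (iss t.2) = 0))).
  by move=> v; split=> [[? [? ?]]|[? ? ?]].
by do 2?[apply: closed_and]; apply: closed_coord0.
Qed.

Lemma F_root3 (u : 'I_n -> K) i j l :
  u ix * u (iy i) = 0 -> u (iz j) = 0 -> u (iss l) = 0 -> F.@[u] = 0.
Proof.
move=> u1 uj ul; rewrite evalF evalPP (bigD1 j) //= (bigD1 l) //= uj ul.
rewrite evalmu (bigD1 i) //= !expr0n b_eq0 c_eq0.
have -> : u (iy i) ^+ a i = u (iy i) * u (iy i) ^+ (a i).-1.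
  by rewrite -exprS prednK // (leq_trans _ (a_ge2 i)).
by rewrite !mulrA u1 !mul0r !addr0.
Qed.

Definition in_stratum (t : 'I_m * 'I_p * 'I_q) : pred 'I_n :=
  fun k => [|| k == iy t.1.1, k == iz t.1.2 | k == iss t.2].

Lemma stratum_inX t (v : 'I_n -> K) : F.@[fun k => (zeroed (in_stratum t) k).@[v]] = 0.
Proof.
apply: (@F_root3 _ t.1.1 t.1.2 t.2); rewrite !zeroedE /in_stratum !idxE !eqxx //.
exact: mulr0.
Qed.

Definition stratum_pt t v : X := mkpt (stratum_inX t v).

Lemma coord_stratum_pt t v k :
  coord (stratum_pt t v) k = if in_stratum t k then 0 else v k.
Proof. by rewrite coord_mkpt zeroedE. Qed.

Lemma stratum_ptP t v : stratum t (stratum_pt t v).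
Proof. by split; rewrite coord_stratum_pt /in_stratum !idxE !eqxx. Qed.

Lemma stratum_singular t v : stratum t v -> singular v.
Proof.
case=> yi zj sl; apply/singularP.
by split; [exists t.1.1|exists t.1.2|exists t.2].
Qed.

Lemma stratum_pt_id t (v : X) : stratum t v -> stratum_pt t (coord v) = v.
Proof.
case=> yi zj sl; apply: X_eq => k; rewrite coord_stratum_pt.
by case: ifP => // /or3P [] /eqP ->.
Qed.

Lemma stratum_anti t u : (forall v, stratum t v -> stratum u v) -> t = u.
Proof.
move/(_ _ (stratum_ptP t (fun=> 1))) => [].
rewrite !coord_stratum_pt /in_stratum !idxE ?orbF /=.
have n1 : (1 : K) = 0 -> False by move/eqP; rewrite (negbTE (oner_neq0 K)).
case: (eqVneq u.1.1 t.1.1) => [y1|_ /n1 //] _.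
case: (eqVneq u.1.2 t.1.2) => [z1|_ /n1 //] _.
case: (eqVneq u.2 t.2) => [s1|_ /n1 //] _.
by move: t u y1 z1 s1 => [[? ?] ?] [[? ?] ?] /= -> -> ->.
Qed.

(** A stratum is an affine space mapped into the singular locus, so among the
    y-coordinates of the map, as among the z- and the s-coordinates, one is
    identically zero. *)
Lemma biregular_stratum f f' t : biregular f f' ->
  exists u, forall v, stratum t v -> stratum u (f v).
Proof.
move=> bi; have [[Phi fE] _ _ _] := bi.
have fsing v := (singularP _).1
  (singular_bi bi (stratum_singular (stratum_ptP t v))).
pose r k := subst (zeroed (in_stratum t)) (Phi k).
have rE k v : (r k).@[v] = coord (f (stratum_pt t v)) k.
  by rewrite fE meval_subst; apply: meval_eq => k'; rewrite coord_mkpt.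
have [v|i Ei] := @prod_vanish _ (fun i => r (iy i)).
  by have [[i Ei] _ _] := fsing v; exists i; rewrite rE.
have [v|j Ej] := @prod_vanish _ (fun j => r (iz j)).
  by have [_ [j Ej] _] := fsing v; exists j; rewrite rE.
have [v|l El] := @prod_vanish _ (fun l => r (iss l)).
  by have [_ _ [l El]] := fsing v; exists l; rewrite rE.
exists (i, j, l) => v /stratum_pt_id <-.
by split; rewrite -rE /= ?Ei ?Ej ?El meval0.
Qed.

(** Euler derivation of the one-parameter group scaling y_i and x. *)
Definition euler i (k : 'I_n) : M :=
  if k == ix then - ('X_ix *+ a i) else if k == iy i then 'X_(iy i) else 0.

Lemma Der_euler i f : Der (euler i) f =
  f^`M(iy i) * 'X_(iy i) - f^`M(ix) * ('X_ix *+ a i).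
Proof.
rewrite /Der (bigD1 ix) // (bigD1 (iy i)) ?idxE //= big1 => [|j /andP [nj nk]].
  by rewrite /euler eqxx idxE eqxx; ring.
by rewrite /euler (negbTE nj) (negbTE nk) mulr0.
Qed.

Lemma euler_tangent i : tangent ev (euler i).
Proof.
apply: (tangentP ev_eq0); suff -> : Der (euler i) F = 0 by rewrite rmorph0.
rewrite Der_euler mderiv_Fx mderiv_F idxE mulr0n mul0r add0r PP_deriv0 ?addr0; last first.
  by rewrite /is_xy is_y_iy orbT.
suff E : mu^`M(iy i) * 'X_(iy i) = mu *+ a i.
  by rewrite -mulrA E !mulrnAr mulrC subrr.
rewrite /y_monomial (bigD1 i) //= mderivM mderiv_exp mderiv_var eqxx mul1r.
have -> : (\prod_(i' | i' != i) ('X_(iy i') : M) ^+ a i')^`M(iy i) = 0.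
  apply: (@indep_deriv _ _ (pred1 (iy i))); last by rewrite /= eqxx.
  by apply: indep_prod => i' ne; apply/indepE/indepX; rewrite /= idxE.
rewrite mulr0 addr0 mulrAC -mulrnAl; congr (_ * _).
by rewrite mulrnAl -exprSr prednK // (leq_trans _ (a_ge2 i)).
Qed.

(** The vector field preserves the equation of X. On x = z_j = s_l = 0 the two
    monomials in z and s vanish to second order, so the product of the
    x-component and the monomial in y is zero there, and the latter is not a
    zero divisor. *)
Lemma tangent_x_stratum g (v : X) j l : tangent ev g ->
  coord v ix = 0 -> coord v (iz j) = 0 -> coord v (iss l) = 0 ->
  (g ix).@[coord v] = 0.
Proof.
move=> tang vx vz vs.
pose S : pred 'I_n := fun k => [|| k == ix, k == iz j | k == iss l].
have inX (u : 'I_n -> K) : F.@[fun k => (zeroed S k).@[u]] = 0.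
  rewrite evalF zeroedE /S eqxx mul0r add0r evalPP (bigD1 j) //= (bigD1 l) //=.
  rewrite !zeroedE !idxE !eqxx /= !expr0n.
  by rewrite b_eq0 c_eq0 !mul0r addr0.
have DF : eqX (Der g F) 0.
  by apply/eqX_ev; rewrite tang ?rmorph0 // ev_F.
have EF : Der g F = g ix * mu + 'X_ix * Der g mu + Der g PP.
  by rewrite trinomialE DerD DerM DerX.
have: subst (zeroed S) (g ix) * mu = 0.
  apply: (mpoly_vanish0 charK0) => u; rewrite mevalM.
  have := DF (mkpt (inX u)); rewrite meval0 => E.
  have cE k : coord (mkpt (inX u)) k = (zeroed S k).@[u] by rewrite coord_mkpt.
  rewrite EF !mevalD !mevalM mevalXU cE zeroedE in E.
  have Sx : S ix by rewrite /S eqxx.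
  rewrite Sx mul0r addr0 in E.
  have D0 : (Der g PP).@[coord (mkpt (inX u))] = 0.
    rewrite /Der raddf_sum big1 //= => k _; rewrite mevalM mderivD mevalD.
    rewrite (mono_deriv_root k (b_ge2 j)) ?(mono_deriv_root k (c_ge2 l)) ?addr0 ?mul0r //.
      by rewrite cE zeroedE /S eqxx !orbT.
    by rewrite cE zeroedE /S eqxx !orbT.
  rewrite D0 addr0 in E; rewrite -[RHS]E meval_subst; congr (_ * _).
    by apply: meval_eq => k; rewrite cE.
  rewrite !evalmu; apply: eq_bigr => i _.
  by rewrite cE zeroedE /S !idxE.
move/eqP; rewrite mulf_eq0 (negbTE (@mu_neq0)) orbF => /eqP g0.
have := congr1 (meval (coord v)) g0; rewrite meval0 meval_subst => <-.
apply: meval_eq => k; rewrite zeroedE /S.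
by case: ifP => // /or3P [] /eqP ->.
Qed.

(** * Invariants of connected groups *)

Local Notation d := (gcd_exp b c).

Lemma gcd_exp_gt0 : (0 < d)%N.
Proof.
have [/(_ (Ordinal p_ge1)) dvd _] := dvdn_gcd_exp b c.
by apply: dvdn_gt0 dvd; apply: ltnW.
Qed.

Lemma divd_b j : (0 < b j %/ d)%N.
Proof.
have [dvd _] := dvdn_gcd_exp b c.
by rewrite divn_gt0 ?gcd_exp_gt0 // dvdn_leq // ltnW.
Qed.

Lemma divd_c l : (0 < c l %/ d)%N.
Proof.
have [_ dvd] := dvdn_gcd_exp b c.
by rewrite divn_gt0 ?gcd_exp_gt0 // dvdn_leq // ltnW.
Qed.

Definition Zd (v : 'I_n -> K) := \prod_(j < p) v (iz j) ^+ (b j %/ d).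
Definition Sd (v : 'I_n -> K) := \prod_(l < q) v (iss l) ^+ (c l %/ d).

Lemma PP_d v : PP.@[v] = Zd v ^+ d + Sd v ^+ d.
Proof.
have [db dc] := dvdn_gcd_exp b c.
rewrite evalPP /Zd /Sd -!prodrXl; congr (_ + _); apply: eq_bigr => i _.
  by rewrite -exprM divnK.
by rewrite -exprM divnK.
Qed.

Lemma roots_m1 : exists rs : seq K, uniq rs /\ forall r, (r \in rs) = (r ^+ d == -1).
Proof.
have [rs E] := closed_field_poly_normal ('X^d + 1%:P : {poly K}).
exists (undup rs); split=> [|r]; first exact: undup_uniq.
have nz : ('X^d + 1%:P : {poly K}) != 0.
  by rewrite -size_poly_gt0 size_XnaddC ?gcd_exp_gt0.
rewrite mem_undup -root_prod_XsubC -(@rootZ _ _ (lead_coef ('X^d + 1%:P : {poly K}))).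
  by rewrite -E /root hornerD hornerXn hornerC addr_eq0.
by rewrite lead_coef_eq0.
Qed.

Lemma eps_neq0 (eps : K) : eps ^+ d = -1 -> eps != 0.
Proof.
move=> E; apply/eqP => e0; move/eqP: E; rewrite e0 expr0n gtn_eqF ?gcd_exp_gt0 //.
by rewrite eq_sym oppr_eq0 (negbTE (oner_neq0 K)).
Qed.

Lemma Zd_eq0 v j : v (iz j) = 0 -> Zd v = 0.
Proof.
by move=> vj; rewrite /Zd (bigD1 j) //= vj expr0n gtn_eqF ?divd_b // mul0r.
Qed.

Section GroupInvariants.
Variables (G : algebraic_group K) (act : ag_point G -> X -> X).
Hypothesis actP : faithful_action act.
Hypothesis conn : zariski_connected (ag_eqs G).

Lemma biregular_act g : biregular (act g) (act (ag_inv g)).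
Proof. by split; [apply: regular_act|apply: regular_act|apply: actK|apply: actVK]. Qed.

Lemma act_y g i v : (coord (act g v) (iy i) == 0) = (coord v (iy i) == 0).
Proof.
have [u0 u00] := PP_root.
have := @connected_permutation _ _ _ _ _ actP conn _
  (fun i (v : X) => coord v (iy i) = 0) _ _ _ g i v.
case=> [i1|i1 i2 sub|g1 i1|H1 H2].
- exact: closed_coord0.
- have := sub (ysec_pt u00 (fun k => if k == iy i1 then 0 else 1)).
  rewrite !ysec_pt_y eqxx idxE => /(_ erefl).
  by case: eqP => [->|_ /eqP] //; rewrite (negbTE (oner_neq0 K)).
- exact: (biregular_y i1 (biregular_act g1)).
by apply/eqP/eqP.
Qed.

Lemma act_stratum g t v : stratum t v <-> stratum t (act g v).
Proof.
apply: (@connected_permutation _ _ _ _ _ actP conn _ stratum).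
- exact: closed_stratum.
- by move=> t1 t2; apply: (stratum_anti).
- move=> g1 t1.
  exact: (biregular_stratum t1 (biregular_act g1)).
Qed.

Lemma act_singular g v : singular v <-> singular (act g v).
Proof.
split=> [|sv]; first exact: (singular_bi (biregular_act g)).
rewrite -(actK actP g v).
exact: (singular_bi (biregular_sym (biregular_act g))).
Qed.

Lemma act_z g j v : singular v -> (coord (act g v) (iz j) == 0) = (coord v (iz j) == 0).
Proof.
move=> /[dup] sv /singularP [[i vi] _ [l vl]].
have /singularP [[i' wi] _ [l' wl]] := (act_singular g v).1 sv.
apply/eqP/eqP => [wj|vj].
  by have [//|_ vj _] := (act_stratum g (i', j, l') v).2.
by have [//|_ wj _] := (act_stratum g (i, j, l) v).1.
Qed.

Lemma act_s g l v : singular v -> (coord (act g v) (iss l) == 0) = (coord v (iss l) == 0).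
Proof.
move=> /[dup] sv /singularP [[i vi] [j vj] _].
have /singularP [[i' wi] [j' wj] _] := (act_singular g v).1 sv.
apply/eqP/eqP => [wl|vl].
  by have [//|_ _ vl] := (act_stratum g (i', j', l) v).2.
by have [//|_ _ wl] := (act_stratum g (i, j, l) v).1.
Qed.

(** The group element g maps the line in the direction of x through v to the
    line in the direction of x through its image, with nonzero derivative. If
    x = 0 at v, every vector field tangent to X has x-component 0 at v, by
    tangent_x_stratum. Applied to the transport to v of the Euler field, whose
    x-component at the image of v is a nonzero multiple of x, this shows that
    x vanishes at the image. *)
Lemma act_x g v : singular v -> coord v ix = 0 -> coord (act g v) ix = 0.
Proof.
move=> sv vx; have /singularP [[i vi] [j vj] [l vl]] := sv.
set w := act g v; have [[Phi fE] [Psi f'E] fK f'K] := biregular_act g.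
have wi : coord w (iy i) = 0 by apply/eqP; rewrite act_y vi.
pose L (u : X) (xi : K) k := if k == ix then xi else coord u k.
have LX (u : X) xi : coord u (iy i) = 0 -> coord u (iz j) = 0 -> coord u (iss l) = 0 ->
    F.@[L u xi] = 0.
  move=> ui uj ul.
  by apply: (F_root3 (i := i) (j := j) (l := l)); rewrite /L !idxE ?ui ?mulr0.
have Lv xi := LX v xi vi vj vl.
have wj : coord w (iz j) = 0 by apply/eqP; rewrite act_z // vj.
have wl : coord w (iss l) = 0 by apply/eqP; rewrite act_s // vl.
have Lw xi := LX w xi wi wj wl.
pose gam (u : X) k : {poly K} := if k == ix then 'X else (coord u k)%:P.
have gamE (u : X) (h : M) xi : (mmap polyC (gam u) h).[xi] = h.@[L u xi].
  rewrite horner_mmap; apply: meval_eq => k; rewrite /gam /L.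
  by case: ifP => _; rewrite ?hornerX ?hornerC.
have fLv xi k : (mmap polyC (gam v) (Phi k)).[xi] = coord (act g (mkpt (Lv xi))) k.
  by rewrite gamE fE; apply: meval_eq => k'; rewrite coord_mkpt.
have L0 : mkpt (Lv 0) = v.
  by apply: X_eq => k; rewrite coord_mkpt /L; case: eqP => // ->.
have sL xi : singular (mkpt (Lv xi)).
  apply/singularP; split; [exists i|exists j|exists l]; rewrite coord_mkpt /L idxE //.
have patt k xi : k != ix -> (coord (act g (mkpt (Lv xi))) k == 0) = (coord v k == 0).
  by case: (idxP k) => [|i1|j1|l1]; rewrite ?eqxx // => _;
    rewrite ?act_y ?act_z ?act_s // coord_mkpt /L idxE.
pose A := mmap polyC (gam v) (Phi ix); pose B := mmap polyC (gam w) (Psi ix).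
have fL xi : act g (mkpt (Lv xi)) = mkpt (Lw A.[xi]).
  apply: X_eq => k; rewrite [RHS]coord_mkpt {2}/L; case: eqP => [->|/eqP nx].
    by rewrite -fLv.
  have [v0|nz] := eqVneq (coord v k) 0.
    have /eqP -> : coord (act g (mkpt (Lv xi))) k == 0 by rewrite patt // v0.
    by apply/esym/eqP; rewrite /w -{1}L0 patt // v0.
  rewrite -fLv (@nonvanishing_const _ xi 0) => [|t]; first by rewrite fLv L0.
  by rewrite fLv patt.
have BA : B \Po A = 'X.
  apply/eqP; rewrite -subr_eq0; apply/eqP/poly_vanish0 => xi.
  rewrite hornerD hornerN hornerX horner_comp gamE.
  have -> : (Psi ix).@[L w A.[xi]] = coord (act (ag_inv g) (mkpt (Lw A.[xi]))) ix.
    by rewrite f'E; apply: meval_eq => k; rewrite coord_mkpt.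
  by rewrite -fL fK coord_mkpt /L eqxx subrr.
have A0 : A.[0] = coord w ix by rewrite fLv L0.
have dB : B^`().[coord w ix] != 0.
  have := congr1 (fun u => u^`().[0]) BA; rewrite deriv_comp hornerM horner_comp A0.
  rewrite derivX hornerC => E; apply: contra_eq_neq E => ->.
  by rewrite mul0r eq_sym oner_neq0.
have dBE : B^`().[coord w ix] = (Psi ix)^`M(ix).@[coord w].
  rewrite deriv_mmap (bigD1 ix) //= big1 => [|k nx]; last first.
    by rewrite /gam (negbTE nx) derivC mulr0.
  rewrite {2}/gam eqxx derivX mulr1 addr0 gamE; apply: meval_eq => k.
  by rewrite /L; case: eqP => // ->.
have tE : tangent ev (@euler i) by apply: euler_tangent.
have tc : tangent ev (conj_der Phi Psi (@euler i)).
  by move=> h; apply: (conj_tangent fE f'E fK); apply: tE.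
have := tangent_x_stratum tc vx vj vl.
rewrite /conj_der (eval_f fE) Der_euler mevalB !mevalM mevalXU -/w wi mulr0 sub0r -dBE.
rewrite rmorphMn /= mevalXU => /eqP; rewrite oppr_eq0 mulf_eq0 (negbTE dB) /=.
rewrite -mulr_natr mulf_eq0 => /orP [/eqP //|].
by have := a_ge2 i; case: (a i) => // e _; rewrite (negbTE (natK_neq0 charK0 _)).
Qed.

(** The quotient of the two monomials is a d-th root of -1 all along the group
    orbit, so it is constant, the group being connected. *)
Lemma act_eps g (M0 : {set 'I_m}) eps (v : X) : M0 != set0 -> eps ^+ d = -1 ->
  orbit_eps M0 eps v -> orbit_eps M0 eps (act g v).
Proof.
move=> M0_n0 epsd [My Ez Es]; rewrite -/(Zd (coord v)) -/(Sd (coord v)) in Ez Es.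
have nsing : ~ singular v.
  by move/singularP => [_ [j vj] _]; move: Es; rewrite -Ez (Zd_eq0 vj) eqxx.
have [i iM] := set0Pn _ M0_n0.
have vi : coord v (iy i) == 0 by rewrite My.
have relation g1 : Zd (coord (act g1 v)) ^+ d = - Sd (coord (act g1 v)) ^+ d.
  apply/eqP; rewrite -addr_eq0 -PP_d -(coord_F (act g1 v)) evalF.
  have /eqP -> : mu.@[coord (act g1 v)] == 0.
    by apply/mu_eq0P; exists i; apply/eqP; rewrite act_y.
  by rewrite mulr0 add0r.
have Sd_nz g1 : Sd (coord (act g1 v)) != 0.
  apply/eqP => S0; apply: nsing; apply/(act_singular g1).
  apply/singularP; split; first by exists i; apply/eqP; rewrite act_y.
    have : Zd (coord (act g1 v)) = 0.
      apply/eqP; have /eqP := relation g1; rewrite S0 expr0n gtn_eqF ?gcd_exp_gt0 //.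
      by rewrite oppr0 expf_eq0 gcd_exp_gt0.
    exact: prodX_eq0.
  exact: prodX_eq0 S0.
have [rs [uniq_rs rsP]] := roots_m1.
pose Zp : M := \prod_(j < p) 'X_(iz j) ^+ (b j %/ d).
pose Sp : M := \prod_(l < q) 'X_(iss l) ^+ (c l %/ d).
have ZpE u : Zp.@[u] = Zd u.
  by rewrite rmorph_prod; apply: eq_bigr => j _; rewrite rmorphXn /= mevalXU.
have SpE u : Sp.@[u] = Sd u.
  by rewrite rmorph_prod; apply: eq_bigr => j _; rewrite rmorphXn /= mevalXU.
have eps_rs : eps \in rs by rewrite rsP epsd.
pose t0 : 'I_(size rs) := Ordinal (etrans (index_mem eps rs) eps_rs).
pose C (t : 'I_(size rs)) g1 := Zd (coord (act g1 v)) = rs`_t * Sd (coord (act g1 v)).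
have C0 : C t0 (ag_one G) by rewrite /C (act_one actP) /= nth_index.
have : forall g1, C t0 g1.
  apply: (connected_partition conn _ _ _ C0) => [t|g1|t u g1].
  - apply: (@closed_ext _ _ _ (fun g1 => (Zp - rs`_t *: Sp).@[coord (act g1 v)] = 0)).
      move=> g1; rewrite mevalB mevalZ ZpE SpE /C.
      by split=> [/eqP|->]; rewrite ?subrr // subr_eq0 => /eqP.
    exact: closed_act.
  - have r_rs : Zd (coord (act g1 v)) / Sd (coord (act g1 v)) \in rs.
      by rewrite rsP expr_div_n relation mulNr mulfV ?expf_neq0.
    exists (Ordinal (etrans (index_mem _ rs) r_rs)); rewrite /C /= nth_index //.
    by rewrite divfK.
  - rewrite /C => -> /(mulIf (Sd_nz g1)) E; apply/val_inj/eqP.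
    by rewrite /= -(nth_uniq 0 _ _ uniq_rs) ?E.
move=> /(_ g); rewrite /C /= nth_index // => Eg.
split; first by move=> i'; rewrite act_y My.
  exact: Eg.
by apply: mulf_neq0; [apply: eps_neq0|apply: (Sd_nz g)].
Qed.

End GroupInvariants.

(** * One-parameter groups of the hypersurface *)

Section Weights.
Variables (w : 'I_n -> int) (D : int).
Hypothesis wx : w ix + \sum_i w (iy i) *+ a i = D.
Hypothesis wz : \sum_j w (iz j) *+ b j = D.
Hypothesis ws : \sum_l w (iss l) *+ c l = D.

Lemma exprz_sum (I : finType) (t : K) (e : I -> int) (k : I -> nat) : t != 0 ->
  \prod_i (t ^ e i) ^+ k i = t ^ (\sum_i e i *+ k i).
Proof.
move=> nz; have E i : (t ^ e i) ^+ k i = t ^ (e i *+ k i).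
  by elim: (k i) => [|r IH]; rewrite ?mulr0n ?expr0z // exprS mulrS expfzDr // IH.
under eq_bigr => i _ do rewrite E.
by elim/big_rec2: _ => [|i u v _ ->]; rewrite ?expr0z // expfzDr.
Qed.

Lemma torus_inX (t : K) (v : X) : t != 0 -> F.@[fun k => t ^ w k * coord v k] = 0.
Proof.
move=> nz; suff -> : F.@[fun k => t ^ w k * coord v k] = t ^ D * F.@[coord v].
  by rewrite coord_F mulr0.
have scale (I : finType) (u : I -> 'I_n) (e : I -> nat) :
    \prod_i (t ^ w (u i) * coord v (u i)) ^+ e i =
    t ^ (\sum_i w (u i) *+ e i) * \prod_i coord v (u i) ^+ e i.
  by rewrite -exprz_sum // -big_split; apply: eq_bigr => i _; rewrite exprMn.
rewrite !evalF !evalPP !evalmu !scale wz ws mulrACA -expfzDr // wx; ring.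
Qed.

(** The integral powers of the parameter, as polynomials on the group. *)
Definition gpow (g : ag_point (Gm K)) (e : int) : K :=
  match e with Posz r => coord g 0 ^+ r | Negz r => coord g 1 ^+ r.+1 end.

Lemma gpowE (g : ag_point (Gm K)) e : gpow g e = Gmval g ^ e.
Proof. by case: e => r //=; rewrite coordGm1 exprVn. Qed.

Definition torus_act (g : ag_point (Gm K)) (v : X) : X :=
  mkpt (torus_inX v (Gmval_neq0 g)).

Lemma coord_torus g v k : coord (torus_act g v) k = Gmval g ^ w k * coord v k.
Proof. by rewrite coord_mkpt. Qed.

Lemma X_ones : F.@[fun k => if k == ix then - PP.@[fun=> 1] else 1] = 0.
Proof.
rewrite evalF eqxx evalmu big1 ?mulr1 => [|i _]; last by rewrite idxE expr1n.
apply/eqP; rewrite addrC subr_eq0 !evalPP; apply/eqP;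
  congr (_ + _).
Qed.

(* Bezout certificate that the weights of the coordinates other than x, which
   may all be equal to 1, have no common divisor: so the action is faithful. *)
Hypothesis prim : exists k1 k2 u1 u2,
  [/\ k1 != ix, k2 != ix & u1 * w k1 + u2 * w k2 = 1].

Lemma torus_faithful : faithful_action torus_act.
Proof.
split.
- apply: regular2P => j.
  apply: (polyf_ext (phi := fun vw => gpow vw.1 (w j) * coord vw.2 j)).
    by move=> vw; rewrite coord_torus gpowE.
  apply: polyfM; last exact: polyf_snd.
  by rewrite /gpow; case: (w j) => r; apply/polyfX/polyf_fst.
- by move=> v; apply: X_eq => k; rewrite coord_torus GmptK exp1rz mul1r.
- by move=> g h v; apply: X_eq => k; rewrite !coord_torus GmptK exprzMl ?mulrA
    ?unitfE ?Gmval_neq0.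
move=> g h E; apply: Gmval_inj.
have [k1 [k2 [u1 [u2 [n1 n2 Eu]]]]] := prim.
have Ew k : k != ix -> Gmval g ^ w k = Gmval h ^ w k.
  move=> nk; have := congr1 (fun v => coord v k) (E (mkpt X_ones)).
  by rewrite !coord_torus coord_mkpt (negbTE nk) !mulr1.
rewrite -[Gmval g]expr1z -[Gmval h]expr1z -Eu !expfzDr ?Gmval_neq0 //.
by rewrite ![_ * w _]mulrC -!exprz_exp !Ew.
Qed.

End Weights.

Lemma X_eq_mu (v w : X) : mu.@[coord v] != 0 ->
  (forall k, k != ix -> coord v k = coord w k) -> v = w.
Proof.
move=> nz E; have E' (S : pred 'I_n) f : indep S f -> S ix -> f.@[coord v] = f.@[coord w].
  move=> If Sx; apply: (indep_meval If) => k nk; apply: E.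
  by apply: contraNneq nk => ->.
have Emu : mu.@[coord v] = mu.@[coord w].
  by apply: (E' (pred1 ix)); [apply: indep_mu => i; by []|by []].
have EPP : PP.@[coord v] = PP.@[coord w].
  rewrite !evalPP; congr (_ + _); by apply: eq_bigr => i _; rewrite E.
apply: X_eq => k; have [->|] := eqVneq k ix; last exact: E.
apply: (mulIf nz); have := coord_F v; rewrite -(coord_F w) !evalF -EPP -Emu.
exact: addIr.
Qed.

Section Slide.
Variables (k : 'I_n) (A B : M) (e : nat).
Hypothesis nkx : k != ix.
Hypothesis k_mu : indep (pred2 k ix) mu.
Hypothesis indA : indep (pred2 k ix) A.
Hypothesis indB : indep (pred2 k ix) B.
Hypothesis PPE : PP = A * 'X_k ^+ e + B.

(** Translation of the coordinate k by t y_monomial. The monomial containing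
    it changes by A ((v_k + t y_monomial) ^ e - v_k ^ e); this is divisible by
    y_monomial, so the change can be absorbed by x. *)
Definition slide_pt (t : K) (v : 'I_n -> K) (k' : 'I_n) : K :=
  if k' == k then v k + t * mu.@[v]
  else if k' == ix then
    v ix - t * A.@[v] * \sum_(i < e) (v k + t * mu.@[v]) ^+ (e.-1 - i) * v k ^+ i
  else v k'.

Lemma slide_indep t v f : indep (pred2 k ix) f -> f.@[slide_pt t v] = f.@[v].
Proof.
move=> If; apply: (indep_meval If) => k' /norP [nk nx].
by rewrite /slide_pt (negbTE nk) (negbTE nx).
Qed.

Lemma slide_inX t (v : X) : F.@[slide_pt t (coord v)] = 0.
Proof.
rewrite -(coord_F v) !evalF PPE !mevalD !mevalM !rmorphXn /= !mevalXU.
rewrite !slide_indep // {1 2}/slide_pt eqxx eq_sym (negbTE nkx) eqxx.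
set u := coord v k; set mm := mu.@[_]; set AA := A.@[_].
have := subrXX (u + t * mm) u e; set S := \sum_(i < e) _.
by rewrite addrAC subrr add0r => /(canRL (subrK _)) ->; ring.
Qed.

Definition slide (g : ag_point (Ga K)) (v : X) : X := mkpt (slide_inX (Gaval g) v).

Lemma coord_slide g v k' : coord (slide g v) k' = slide_pt (Gaval g) (coord v) k'.
Proof. by rewrite coord_mkpt. Qed.

Lemma slide_k g v : coord (slide g v) k = coord v k + Gaval g * mu.@[coord v].
Proof. by rewrite coord_slide /slide_pt eqxx. Qed.

Lemma slide_x0 g v : mu.@[coord v] = 0 ->
  coord (slide g v) ix = coord v ix - Gaval g * (A.@[coord v] * coord v k ^+ e.-1 *+ e).
Proof.
move=> m0; rewrite coord_slide /slide_pt eq_sym (negbTE nkx) eqxx m0 mulr0 addr0.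
under eq_bigr => i _.
  rewrite -exprD subnK; last by case: (e) i => [[]//|e' i]; rewrite -ltnS.
  over.
by rewrite sumr_const card_ord -mulrnAr mulrA.
Qed.

Lemma slide_other g v k' : k' != k -> k' != ix -> coord (slide g v) k' = coord v k'.
Proof. by move=> nk nx; rewrite coord_slide /slide_pt (negbTE nk) (negbTE nx). Qed.

Lemma slide_mu g v f : indep (pred2 k ix) f -> f.@[coord (slide g v)] = f.@[coord v].
Proof.
move=> If; rewrite -[RHS](slide_indep (Gaval g) _ If).
by apply: meval_eq => k'; rewrite coord_slide.
Qed.

(** Where y_monomial is nonzero, the coordinate x is determined by the others,
    so the group law need only be checked on these; where it vanishes, the
    group translates x along a fixed vector. *)
Lemma slide_faithful : faithful_action slide.
Proof.
split.
- apply: regular2P => j.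
  have mP (f : M) : polyf (@coord2 K 1 n [::] [:: F]) (fun vw => f.@[coord vw.2]).
    by apply: polyf_meval => k'; apply: polyf_snd.
  have gP : polyf (@coord2 K 1 n [::] [:: F]) (fun vw => Gaval vw.1).
    exact: (polyf_fst _ _ (0 : 'I_1)).
  have kP : polyf (@coord2 K 1 n [::] [:: F]) (fun vw => coord vw.2 k + Gaval vw.1 * mu.@[coord vw.2]).
    by apply: polyfD; [apply: polyf_snd|apply: polyfM].
  apply: (polyf_ext (phi := fun vw => slide_pt (Gaval vw.1) (coord vw.2) j)).
    by move=> vw; rewrite coord_slide.
  rewrite /slide_pt; case: (j == k) => //; case: (j == ix); last exact: polyf_snd.
  apply: polyfD; first exact: polyf_snd.
  apply/polyfN/polyfM; first exact: polyfM.
  apply: polyf_sum => i; apply: polyfM; first exact: polyfX.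
  by apply: polyfX; apply: polyf_snd.
- move=> v; apply: X_eq => k'; rewrite coord_slide /slide_pt GaptK !mul0r subr0 addr0.
  by case: eqP => [->//|_]; case: eqP => [->|].
- move=> g h v; have E k' : k' != ix ->
      coord (slide (ag_mul g h) v) k' = coord (slide g (slide h v)) k'.
    have [->|nk] := eqVneq k' k; last by move=> nx; rewrite !slide_other.
    by move=> _; rewrite !slide_k slide_mu // GaptK; ring.
  have [m0|nz] := eqVneq (mu.@[coord v]) 0; last first.
    by apply: X_eq_mu => //; rewrite slide_mu.
  apply: X_eq => k'; have [->|] := eqVneq k' ix; last exact: E.
  rewrite slide_x0 // [RHS]slide_x0 ?slide_mu // slide_x0 // slide_k m0 GaptK.
  by rewrite mulr0 addr0; ring.
move=> g h /(_ (mkpt (X_ones))) E; apply: Gaval_inj.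
have := congr1 (fun v => coord v k) E; rewrite !slide_k => /addrI.
have -> : mu.@[coord (mkpt (X_ones))] = 1.
  by rewrite evalmu big1 // => i _; rewrite coord_mkpt idxE expr1n.
by rewrite !mulr1.
Qed.

Lemma slide_reach t v : reach v (slide (Gapt t) v).
Proof. by apply: reach_act slide_faithful; apply: Ga_connected. Qed.

End Slide.

Lemma slide_z j (A : M := \prod_(j' < p | j' != j) 'X_(iz j') ^+ b j') :
  [/\ iz j != ix, indep (pred2 (iz j) ix) mu, indep (pred2 (iz j) ix) A,
      indep (pred2 (iz j) ix) gs & PP = A * 'X_(iz j) ^+ b j + gs].
Proof.
split; rewrite ?idxE //.
- by apply: indep_mu => i; rewrite /= !idxE.
- by apply: indep_prod => j' ne; apply/indepE/indepX; rewrite /= !idxE orbF.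
- by apply: indep_prod => l _; apply/indepE/indepX; rewrite /= !idxE.
by rewrite /zs_sum /z_monomial (bigD1 j) //= mulrC.
Qed.

Lemma reach_k k (u : K) (v : X) : ~~ is_xy k -> mu.@[coord v] != 0 ->
  exists v', [/\ reach v v', coord v' k = u &
    forall k', k' != k -> k' != ix -> coord v' k' = coord v k'].
Proof.
move=> nk nz.
suff [A [B [e [nkx k_mu indA indB PPE]]]] : exists (A B : M) e,
    [/\ k != ix, indep (pred2 k ix) mu, indep (pred2 k ix) A, indep (pred2 k ix) B
      & PP = A * 'X_k ^+ e + B].
  pose t := (u - coord v k) / mu.@[coord v].
  exists (slide nkx k_mu indA indB PPE (Gapt t) v); split.
  - exact: slide_reach.
  - by rewrite slide_k GaptK divfK // addrC subrK.
  - by move=> k' ? ?; rewrite slide_other.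
move: nk; case: (idxP k) => [|i|j|l]; rewrite /is_xy ?eqxx ?is_y_iy ?orbT // => _.
- by exists (\prod_(j' < p | j' != j) 'X_(iz j') ^+ b j'), gs, (b j); apply: slide_z.
exists (\prod_(l' < q | l' != l) 'X_(iss l') ^+ c l'), fz, (c l); split.
- by rewrite idxE.
- by apply: indep_mu => i; rewrite /= !idxE.
- by apply: indep_prod => l' ne; apply/indepE/indepX; rewrite /= !idxE orbF.
- by apply: indep_prod => j _; apply/indepE/indepX; rewrite /= !idxE.
- by rewrite /zs_sum /s_monomial (bigD1 l) //= mulrC addrC.
Qed.

(** Where y_monomial vanishes, the additive group moves x with constant
    velocity: up to sign, the partial derivative of zs_sum in z_j. *)
Lemma reach_x (j : 'I_p) (v : X) x1 : mu.@[coord v] = 0 -> (forall j', coord v (iz j') != 0) ->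
  exists v', [/\ reach v v', coord v' ix = x1 & forall k, k != ix -> coord v' k = coord v k].
Proof.
move=> m0 vz; pose A : M := \prod_(j' < p | j' != j) 'X_(iz j') ^+ b j'.
have [nkx k_mu indA indB PPE] := slide_z j.
pose r := A.@[coord v] * coord v (iz j) ^+ (b j).-1 *+ b j.
have r_nz : r != 0.
  rewrite /r -mulr_natr !mulf_neq0 //.
  - rewrite rmorph_prod; apply/prodf_neq0 => j' _.
    by rewrite rmorphXn /= mevalXU expf_neq0.
  - by rewrite expf_neq0.
  - by have := b_ge2 j; case: (b j) => // e _; apply: natK_neq0.
pose t := (coord v ix - x1) / r.
exists (slide nkx k_mu indA indB PPE (Gapt t) v); split.
- exact: slide_reach.
- by rewrite slide_x0 // GaptK -/r divfK // subKr.
- move=> k nk; have [->|ne] := eqVneq k (iz j); last by rewrite slide_other.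
  by rewrite slide_k m0 mulr0 addr0.
Qed.

(** * Scalings of the coordinates *)

(** The scaling vectors realised by Aut_alg. As they are stable under
    products, it is enough to exhibit one-parameter groups. *)
Definition scal (r : 'I_n -> K) := (forall k, r k != 0) /\
  forall v : X, exists2 v', reach v v' & forall k, coord v' k = r k * coord v k.

Lemma scal_ext r r' : (forall k, r k = r' k) -> scal r -> scal r'.
Proof.
move=> E [nz sr]; split=> [k|v]; first by rewrite -E.
by have [v' vv' Ev'] := sr v; exists v' => // k; rewrite -E.
Qed.

Lemma scal1 : scal (fun=> 1).
Proof.
split=> [k|v]; first exact: oner_neq0.
by exists v => [|k]; [apply: reach_refl|rewrite mul1r].
Qed.

Lemma scalM r r' : scal r -> scal r' -> scal (fun k => r k * r' k).
Proof.
move=> [nz sr] [nz' sr']; split=> [k|v]; first by rewrite mulf_neq0.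
have [v1 vv1 E1] := sr' v; have [v2 v12 E2] := sr v1.
by exists v2 => [|k]; [apply: reach_trans v12|rewrite E2 E1 mulrA].
Qed.

Lemma scal_prod (I : finType) (r : I -> 'I_n -> K) :
  (forall i, scal (r i)) -> scal (fun k => \prod_i r i k).
Proof.
move=> sr; elim: (index_enum I) => [|i s IH].
  by apply: scal_ext scal1 => k; rewrite big_nil.
by apply: scal_ext (scalM (sr i) IH) => k; rewrite big_cons.
Qed.

Lemma scal_torus (w : 'I_n -> int) D t : t != 0 ->
  w ix + \sum_i w (iy i) *+ a i = D -> \sum_j w (iz j) *+ b j = D ->
  \sum_l w (iss l) *+ c l = D ->
  (exists k1 k2 u1 u2, [/\ k1 != ix, k2 != ix & u1 * w k1 + u2 * w k2 = 1]) ->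
  scal (fun k => t ^ w k).
Proof.
move=> nz wx wz ws prim; split=> [k|v]; first exact: expfz_neq0.
exists (torus_act wx wz ws (Gmpt nz) v) => [|k]; last by rewrite coord_torus GmptK.
by apply: reach_act (torus_faithful wx wz ws prim); apply: Gm_connected.
Qed.

Lemma scal_y i t : t != 0 ->
  scal (fun k => if k == ix then t ^- a i else if k == iy i then t else 1).
Proof.
move=> nz; pose w (k : 'I_n) : int := if k == ix then - (a i)%:Z else (k == iy i)%:Z.
apply: (@scal_ext (fun k => t ^ w k)) => [k|].
  by rewrite /w; case: (k == ix); [rewrite -exprnN|case: (k == iy i)].
apply: (@scal_torus _ 0 _ nz).
- rewrite /w eqxx (bigD1 i) //= idxE eqxx big1 => [|i' ne]; first by rewrite addr0 natz addNr.
  by rewrite !idxE (negbTE ne) mul0rn.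
- by rewrite big1 // => j _; rewrite /w !idxE mul0rn.
- by rewrite big1 // => l _; rewrite /w !idxE mul0rn.
by exists (iy i), (iy i), 1, 0; rewrite /w !idxE eqxx; split.
Qed.

Lemma scal_ys (rho : 'I_m -> K) : (forall i, rho i != 0) ->
  exists r, [/\ scal r, forall i, r (iy i) = rho i, forall j, r (iz j) = 1
    & forall l, r (iss l) = 1].
Proof.
move=> nz; exists (fun k => \prod_i (if k == ix then rho i ^- a i
  else if k == iy i then rho i else 1)); split.
- by apply: scal_prod => i; apply: scal_y.
- move=> i; rewrite (bigD1 i) //= big1 ?idxE ?eqxx ?mulr1 // => i' ne.
  by rewrite !idxE eq_sym (negbTE ne).
- by move=> j; rewrite big1 // => i _; rewrite !idxE.
- by move=> l; rewrite big1 // => i _; rewrite !idxE.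
Qed.

(** The coordinates z and s are indexed together; the exponents of s, counted
    negatively, turn the equality of the weights of the two monomials into the
    vanishing of one sum. *)
Definition zs (k : 'I_(p + q)) : 'I_n := rshift 1 (rshift m k).

Definition expo (k : 'I_(p + q)) : int :=
  match split k with inl j => (b j %/ d)%:Z | inr l => - (c l %/ d)%:Z end.

Lemma expo_z j : expo (lshift q j) = (b j %/ d)%:Z.
Proof. by rewrite /expo (unsplitK (inl j)). Qed.

Lemma expo_s l : expo (rshift p l) = - (c l %/ d)%:Z.
Proof. by rewrite /expo (unsplitK (inr l)). Qed.

Lemma expo_neq0 k : expo k != 0.
Proof.
case: (split_ordP k) => [j ->|l ->]; rewrite ?expo_z ?expo_s ?oppr_eq0.
  by have := divd_b j; lia.
by have := divd_c l; lia.
Qed.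

Lemma zs_eq k k' : (zs k == zs k') = (k == k').
Proof. by rewrite !eq_rshift. Qed.

Lemma zs_x k : (zs k == ix) = false.
Proof. by rewrite eq_rlshift. Qed.

Lemma zs_y k i : (iy i == zs k) = false.
Proof. by rewrite eq_rshift eq_lrshift. Qed.

(** The weights expo k2 at k1 and - expo k1 at k2 cancel against the
    exponents. Division by their gcd g makes them coprime, hence the action
    faithful; the parameter is then t ^ g. *)
Lemma scal_pair k1 k2 t : t != 0 -> exists r, [/\ scal r, forall i, r (iy i) = 1
  & forall k, r (zs k) = t ^ ((k == k1)%:Z * expo k2 - (k == k2)%:Z * expo k1)].
Proof.
move=> nz; have [->|ne] := eqVneq k1 k2.
  by exists (fun=> 1); split=> [||k] //; [apply: scal1|rewrite subrr expr0z].
have ne' : (k2 == k1) = false by rewrite eq_sym (negbTE ne).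
pose g := gcdz (expo k2) (expo k1).
have [al Eal] : exists al, expo k2 = al * g by apply/dvdzP; apply: dvdz_gcdl.
have [be Ebe] : exists be, expo k1 = be * g by apply/dvdzP; apply: dvdz_gcdr.
have g_nz : g != 0 by rewrite /g gcdz_eq0 (negbTE (expo_neq0 _)).
have [u1 [u2 Eu]] : exists u1 u2, u1 * al + u2 * be = 1.
  have [u1 [u2 Eu]] := Bezoutz (expo k2) (expo k1); exists u1, u2.
  by apply: (mulIf g_nz); rewrite mul1r -[RHS]Eu Eal Ebe; ring.
pose w0 (k : 'I_n) : int := (k == zs k1)%:Z * al - (k == zs k2)%:Z * be.
pose D : int := \sum_j w0 (iz j) *+ b j.
pose w (k : 'I_n) := if k == ix then D else w0 k.
have ng : t ^ g != 0 by apply: expfz_neq0.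
have w0_zs k : w (zs k) = (k == k1)%:Z * al - (k == k2)%:Z * be.
  by rewrite /w zs_x /w0 !zs_eq.
exists (fun k => (t ^ g) ^ w k); split.
- apply: (@scal_torus _ D _ ng).
  + rewrite /w eqxx big1 ?addr0 // => i _.
    by rewrite idxE /w0 !zs_y !mul0r subrr mul0rn.
  + by apply: eq_bigr => j _; rewrite /w idxE.
  + have : \sum_k w (zs k) * (expo k * d%:Z) = 0.
      rewrite (bigD1 k1) //= (bigD1 k2) /=; last by rewrite eq_sym.
      rewrite big1 => [|k /andP [n1 n2]].
        by rewrite !w0_zs !eqxx ne' (negbTE ne) Eal Ebe /=; ring.
      by rewrite w0_zs (negbTE n1) (negbTE n2) !mul0r.
    have [db dc] := dvdn_gcd_exp b c.
    rewrite big_split_ord /= => /eqP; rewrite addr_eq0 => /eqP E.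
    rewrite [D](_ : _ = \sum_j w (zs (lshift q j)) * (expo (lshift q j) * d%:Z)).
      rewrite E -sumrN; apply: eq_bigr => l _.
      by rewrite expo_s mulNr mulrN opprK -PoszM divnK // -mulr_natr natz.
    apply: eq_bigr => j _; rewrite expo_z -PoszM divnK // -mulr_natr natz.
    by rewrite /w zs_x.
  exists (zs k1), (zs k2), u1, (- u2); rewrite !zs_x !w0_zs !eqxx ne' (negbTE ne).
  by split=> //; rewrite -[RHS]Eu /=; ring.
- by move=> i; rewrite /w idxE /w0 !zs_y !mul0r subrr expr0z.
- by move=> k; rewrite w0_zs exprz_exp Eal Ebe; congr (_ ^ _); ring.
Qed.

Lemma root_expz (e : int) (u : K) : e != 0 -> u != 0 -> exists2 t, t != 0 & t ^ e = u.
Proof.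
have rootN k (u' : K) : (0 < k)%N -> u' != 0 -> exists2 t, t != 0 & t ^+ k = u'.
  move=> k0 nz; have /closed_rootP [t] : size ('X^k - u'%:P : {poly K}) != 1%N.
    by rewrite size_XnsubC // eqSS -lt0n.
  rewrite /root hornerD hornerN hornerXn hornerC subr_eq0 => /eqP E.
  by exists t => //; move: nz; rewrite -E expf_eq0 k0.
case: e => k nk nu; last first.
  have [|t nt E] := @rootN k.+1 u^-1 isT; first by rewrite invr_eq0.
  by exists t; rewrite // NegzE -exprnN E invrK.
by have [|t nt E] := @rootN k u _ nu; [case: k nk|exists t].
Qed.

Lemma bezout_expo : exists u : 'I_(p + q) -> int, \sum_k u k * expo k = 1.
Proof.
pose comb (g : nat) := exists u : 'I_(p + q) -> int, \sum_k u k * (expo k * d%:Z) = g%:Z.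
have comb_k k (g : nat) (e : int) : e * (expo k * d%:Z) = g%:Z -> comb g.
  move=> E; exists (fun k' => (k' == k)%:Z * e).
  rewrite (bigD1 k) //= big1 => [|k' ne]; last by rewrite (negbTE ne) !mul0r.
  by rewrite eqxx mul1r addr0.
have comb_gcd g h : comb g -> comb h -> comb (gcdn g h).
  move=> [u Eu] [v Ev]; have [x [x' Exy]] := Bezoutz g h.
  exists (fun k => x * u k + x' * v k).
  have -> : (gcdn g h)%:Z = gcdz g h by [].
  rewrite -Exy -Eu -Ev !mulr_sumr -big_split /=.
  by apply: eq_bigr => k _; rewrite mulrDl !mulrA.
have comb0 : comb 0%N by exists (fun=> 0); rewrite big1 // => k _; rewrite mul0r.
have [db dc] := dvdn_gcd_exp b c.
have [u Eu] : comb d.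
  rewrite /gcd_exp; apply: (comb_gcd); apply: (big_ind comb comb0 comb_gcd) => i _.
    apply: (@comb_k (lshift q i) _ 1).
    by rewrite mul1r expo_z -PoszM divnK.
  apply: (@comb_k (rshift p i) _ (-1)).
  by rewrite expo_s mulN1r mulNr opprK -PoszM divnK.
exists u; have d_nz : d%:Z != 0 by have := gcd_exp_gt0; lia.
apply: (mulIf d_nz); rewrite mul1r -[RHS]Eu mulr_suml.
by apply: eq_bigr => k _; rewrite mulrA.
Qed.

Lemma expz_prod (I : finType) (rho : I -> K) (e : int) :
  (\prod_i rho i) ^ e = \prod_i rho i ^ e.
Proof. exact: (big_morph (fun x => x ^ e) (fun x y => expfzMl x y e) (exp1rz K e)). Qed.

Lemma expz_sum (I : finType) (t : K) (e : I -> int) : t != 0 ->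
  t ^ (\sum_i e i) = \prod_i t ^ e i.
Proof. by move=> nz; apply: (big_morph (fun x => t ^ x) (fun x y => expfzDr x y nz) (expr0z t)). Qed.

(** Let u be the coefficients of bezout_expo, and for each pair (k1, k2) use
    scal_pair with parameter rho k1 ^ u k2. The coordinate k is multiplied by
    the product of the rho k ^ (u k2 * expo k2), which is rho k, and by a
    power of the product of the rho k1 ^ expo k1, which is 1. *)
Lemma scal_zs (rho : 'I_(p + q) -> K) : (forall k, rho k != 0) ->
  \prod_k rho k ^ expo k = 1 ->
  exists r, [/\ scal r, forall i, r (iy i) = 1 & forall k, r (zs k) = rho k].
Proof.
move=> nz rho1; have [u Eu] := bezout_expo.
have /fin_all_exists [R RP] : forall x : 'I_(p + q) * 'I_(p + q), exists r,
    [/\ scal r, forall i, r (iy i) = 1 & forall k, r (zs k) =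
      (rho x.1 ^ u x.2) ^ ((k == x.1)%:Z * expo x.2 - (k == x.2)%:Z * expo x.1)].
  by move=> x; apply: scal_pair; apply: expfz_neq0.
exists (fun k => \prod_x R x k); split.
- by apply: scal_prod => x; have [] := RP x.
- by move=> i; rewrite big1 // => x _; have [_ -> _] := RP x.
move=> k; transitivity (\prod_k1 \prod_k2 R (k1, k2) (zs k)).
  by rewrite pair_bigA; apply: eq_bigr => -[].
have E k1 k2 : R (k1, k2) (zs k) =
    (if k1 == k then rho k ^ (u k2 * expo k2) else 1) *
    (if k2 == k then (rho k1 ^ expo k1) ^ (- u k) else 1).
  have [_ _ ->] := RP (k1, k2); rewrite /= exprz_exp mulrBr expfzDr //.
  rewrite ![_ == k]eq_sym; congr (_ * _).
    by case: eqP => [->|_]; rewrite ?mul1r // mul0r mulr0 expr0z.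
  case: eqP => [->|_]; last by rewrite mul0r mulr0 oppr0 expr0z.
  by rewrite exprz_exp; congr (_ ^ _); rewrite mul1r; ring.
under eq_bigr => k1 _ do under eq_bigr => k2 _ do rewrite E.
under eq_bigr => k1 _.
  rewrite big_split /= -[X in _ * X]big_mkcond big_pred1_eq; over.
rewrite big_split /= -expz_prod rho1 exp1rz mulr1.
rewrite (bigD1 k) //= [X in _ * X]big1 => [|k1 ne]; last first.
  by apply: big1 => k2 _; rewrite (negbTE ne).
by rewrite eqxx -expz_sum // Eu expr1z mulr1.
Qed.

(** When one coordinate vanishes, scaling it compensates for a free choice of
    the factors of the others. *)
Lemma scal_free k0 (rho : 'I_(p + q) -> K) : (forall k, rho k != 0) ->
  exists r, [/\ scal r, forall i, r (iy i) = 1 & forall k, k != k0 -> r (zs k) = rho k].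
Proof.
move=> nz; have /fin_all_exists [R RP] : forall k1 : 'I_(p + q), exists r,
    [/\ scal r, forall i, r (iy i) = 1
      & forall k, k != k0 -> r (zs k) = if k == k1 then rho k else 1].
  move=> k1; have [t nt Et] := root_expz (expo_neq0 k0) (nz k1).
  have [r [sr ry rz]] := scal_pair k1 k0 nt; exists r; split=> // k nk.
  rewrite rz (negbTE nk) mul0r subr0.
  by case: eqP => [->|_]; rewrite ?mul1r // mul0r expr0z.
exists (fun k => \prod_x R x k); split.
- by apply: scal_prod => x; have [] := RP x.
- by move=> i; rewrite big1 // => x _; have [_ -> _] := RP x.
move=> k nk; rewrite (bigD1 k) //= big1 => [|k1 ne].
  by have [_ _ ->] := RP k; rewrite // eqxx mulr1.
by have [_ _ ->] := RP k1; rewrite // eq_sym (negbTE ne).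
Qed.

(** * Transitivity and the description of the orbits *)

Lemma zsP (k : 'I_n) : [\/ k = ix, exists i, k = iy i | exists k', k = zs k'].
Proof.
case: (idxP k) => [|i|j|l]; first by constructor 1.
- by constructor 2; exists i.
- by constructor 3; exists (lshift q j).
- by constructor 3; exists (rshift p l).
Qed.

Definition ratio (u v : K) := if v == 0 then 1 else u / v.

Lemma ratio_neq0 u v : (v == 0) = (u == 0) -> ratio u v != 0.
Proof.
rewrite /ratio => E; case: eqP E => [_ _|/eqP nv E]; first exact: oner_neq0.
by rewrite mulf_neq0 ?invr_eq0 // -E.
Qed.

Lemma ratioK u v : (v == 0) = (u == 0) -> ratio u v * v = u.
Proof.
rewrite /ratio => E; case: eqP E => [-> /esym/eqP ->|/eqP nv _]; first by rewrite mulr0.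
by rewrite divfK.
Qed.

Lemma reach_same_y (v w : X) :
  (forall i, (coord v (iy i) == 0) = (coord w (iy i) == 0)) ->
  exists v' D, [/\ reach v v', D != 0, coord v' ix = D * coord v ix,
    forall i, coord v' (iy i) = coord w (iy i)
  & forall k, coord v' (zs k) = coord v (zs k)].
Proof.
move=> E; have [|r [[nz sr] ry rz rs]] := @scal_ys
  (fun i => ratio (coord w (iy i)) (coord v (iy i))).
  by move=> i; apply: ratio_neq0.
have [v' vv' Ev'] := sr v; exists v', (r ix); split=> // [i|k].
  by rewrite Ev' ry ratioK.
by rewrite Ev'; case: (split_ordP k) => [j ->|l ->]; rewrite ?rz ?rs mul1r.
Qed.

Lemma mu_same_y (v w : X) : (forall i, coord v (iy i) = coord w (iy i)) ->
  mu.@[coord v] = mu.@[coord w].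
Proof. by move=> E; rewrite !evalmu; apply: eq_bigr => i _; rewrite E. Qed.

(** Scale the y_i, then translate the z_j and the s_l; this determines x. *)
Lemma reach_open (v w : X) : orbit_open v -> orbit_open w -> reach v w.
Proof.
move=> vy wy; have [i|v1 [D [vv1 _ _ v1y _]]] := @reach_same_y v w.
  by rewrite (negbTE (vy i)) (negbTE (wy i)).
have mu_w : mu.@[coord w] != 0.
  by apply/negP => /(mu_eq0P) [i /eqP]; rewrite (negbTE (wy i)).
have [v2 [vv2 v2y v2z]] : exists v2, [/\ reach v v2,
    forall i, coord v2 (iy i) = coord w (iy i)
  & forall k, k \in enum 'I_(p + q) -> coord v2 (zs k) = coord w (zs k)].
  elim: (enum _) => [|k s [v2 [vv2 v2y v2z]]]; first by exists v1.
  have [||v3 [v23 v3k v3o]] := @reach_k (zs k) (coord w (zs k)) v2.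
  - by rewrite /is_xy zs_x; apply/existsP => -[i]; rewrite eq_sym zs_y.
  - by rewrite (mu_same_y v2y).
  exists v3; split=> [|i|k']; first exact: reach_trans v23.
    by rewrite v3o ?zs_y // idxE.
  rewrite inE; case: eqP => [->//|/eqP ne /= k's].
  by rewrite v3o ?zs_eq ?zs_x // v2z.
suff <- : v2 = w by [].
apply: X_eq_mu => [|k nk]; first by rewrite (mu_same_y v2y).
have [E|[i ->]|[k' ->]] := zsP k; first by rewrite E eqxx in nk.
  exact: v2y.
by rewrite v2z // mem_enum.
Qed.

Lemma Sd_eq0 (v : 'I_n -> K) l : v (iss l) = 0 -> Sd v = 0.
Proof.
by move=> vl; rewrite /Sd (bigD1 l) //= vl expr0n gtn_eqF ?divd_c // mul0r.
Qed.

Lemma prod_expo (v : 'I_n -> K) :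
  \prod_k v (zs k) ^ expo k = Zd v / Sd v.
Proof.
rewrite big_split_ord /= -prodfV; congr (_ * _); apply: eq_bigr => i _.
  by rewrite expo_z.
by rewrite expo_s -exprnN.
Qed.

(** Scale the y_i. The ratios of the z_j and s_l satisfy the relation of
    scal_zs because both points belong to the same eps. Finally x can be moved
    freely, by reach_x. *)
Lemma reach_eps M0 eps (v w : X) : M0 != set0 -> eps ^+ d = -1 ->
  orbit_eps M0 eps v -> orbit_eps M0 eps w -> reach v w.
Proof.
move=> /set0Pn [i0 i0M] epsd [vy vE vn] [wy wE wn].
rewrite -/(Zd (coord v)) -/(Sd (coord v)) in vE vn.
rewrite -/(Zd (coord w)) -/(Sd (coord w)) in wE wn.
have nonzero (u : X) : eps * Sd (coord u) != 0 ->
    Zd (coord u) = eps * Sd (coord u) ->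
    (forall k, coord u (zs k) != 0) /\ Zd (coord u) / Sd (coord u) = eps.
  move=> nz E; have nS : Sd (coord u) != 0.
    by apply: contraNneq nz => ->; rewrite mulr0.
  split; last by rewrite E mulfK.
  move=> k; case: (split_ordP k) => [j ->|l ->].
    apply: contraNneq nz => uj.
    by rewrite -E (@Zd_eq0 _ j).
  by apply: contraNneq nS => ul; rewrite (@Sd_eq0 _ l).
have [v_nz v_eps] := nonzero v vn vE; have [w_nz w_eps] := nonzero w wn wE.
have [i|v1 [D [vv1 _ _ v1y v1z]]] := @reach_same_y v w; first by rewrite vy wy.
pose rho k := coord w (zs k) / coord v (zs k).
have [||r [[_ sr] ry rz]] := @scal_zs rho.
- by move=> k; rewrite mulf_neq0 ?invr_eq0.
- rewrite (eq_bigr (fun k => coord w (zs k) ^ expo k / coord v (zs k) ^ expo k)).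
    rewrite big_split /= prodfV !prod_expo v_eps w_eps mulfV //.
    exact: (eps_neq0 epsd).
  by move=> k _; rewrite expfzMl exprz_inv invr_expz.
have [v2 v12 v2E] := sr v1.
have v2y i : coord v2 (iy i) = coord w (iy i) by rewrite v2E ry mul1r v1y.
have v2z k : coord v2 (zs k) = coord w (zs k) by rewrite v2E rz v1z divfK.
have [||v3 [v23 v3x v3o]] := @reach_x (Ordinal p_ge1) v2 (coord w ix).
- by apply/eqP/(mu_eq0P); exists i0; rewrite v2y; apply/eqP; rewrite wy.
- by move=> j; rewrite (v2z (lshift q j)); apply: w_nz.
suff <- : v3 = w by apply: reach_trans v23; apply: reach_trans v12.
apply: X_eq => k; have [->//|[i ->]|[k' ->]] := zsP k.
  by rewrite v3o ?idxE.
by rewrite v3o ?zs_x.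
Qed.

(** The coordinates y_i0 and k0 vanish at both points. Scaling k0 leaves the
    other z and s free by scal_free, and scaling y_i0 corrects x. *)
Lemma reach_singular (v w : X) i0 k0 :
  (forall i, (coord v (iy i) == 0) = (coord w (iy i) == 0)) ->
  (forall k, (coord v (zs k) == 0) = (coord w (zs k) == 0)) ->
  (coord v ix == 0) = (coord w ix == 0) ->
  coord v (iy i0) = 0 -> coord v (zs k0) = 0 -> reach v w.
Proof.
move=> Ey Ez Ex vi vk.
have [v1 [D [vv1 D_nz v1x v1y v1z]]] := reach_same_y Ey.
have [|r [[r_nz sr] ry rz]] := @scal_free k0
    (fun k => ratio (coord w (zs k)) (coord v (zs k))).
  by move=> k; apply: ratio_neq0.
have [v2 v12 v2E] := sr v1.
have v2x : (coord v2 ix == 0) = (coord w ix == 0).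
  by rewrite v2E v1x !mulf_eq0 (negbTE D_nz) (negbTE (r_nz _)).
have [||t t_nz Et] := @root_expz (- (a i0)%:Z) (ratio (coord w ix) (coord v2 ix)).
- by rewrite oppr_eq0; have := a_ge2 i0; lia.
- exact: ratio_neq0.
have [_ /(_ v2) [v3 v23 v3E]] := @scal_y i0 t t_nz.
suff <- : v3 = w by apply: reach_trans v23; apply: reach_trans v12.
apply: X_eq => k; rewrite v3E; have [->|[i ->]|[k' ->]] := zsP k.
- by rewrite eqxx exprnN Et ratioK.
- rewrite idxE v2E ry mul1r v1y; case: eqP => [->|_]; last by rewrite mul1r.
  have -> : coord w (iy i0) = 0 by apply/eqP; rewrite -Ey vi.
  by rewrite mulr0.
- rewrite zs_x eq_sym zs_y mul1r v2E v1z.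
  have [->|ne] := eqVneq k' k0; last by rewrite rz // ratioK.
  by rewrite vk mulr0; apply/esym/eqP; rewrite -Ez vk.
Qed.

Section Points.
Variables (x0 : K) (y0 : 'I_m -> K) (z0 : 'I_p -> K) (s0 : 'I_q -> K).

Definition vec (k : 'I_n) : K :=
  match split k with
  | inl _ => x0
  | inr k1 => match split k1 with
    | inl i => y0 i
    | inr k2 => match split k2 with inl j => z0 j | inr l => s0 l end
    end
  end.

Lemma vec_x : vec ix = x0.
Proof. by rewrite /vec (unsplitK (inl ord0)). Qed.
Lemma vec_y i : vec (iy i) = y0 i.
Proof. by rewrite /vec (unsplitK (inr _)) (unsplitK (inl _)). Qed.
Lemma vec_z j : vec (iz j) = z0 j.
Proof. by rewrite /vec !(unsplitK (inr _)) (unsplitK (inl _)). Qed.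
Lemma vec_s l : vec (iss l) = s0 l.
Proof. by rewrite /vec !(unsplitK (inr _)). Qed.

End Points.

Lemma indicator0 (b0 : bool) : ((if b0 then 0 else 1 : K) == 0) = b0.
Proof. by case: b0; rewrite ?eqxx // oner_eq0. Qed.

Lemma open_nonempty : exists v : X, orbit_open v.
Proof.
exists (mkpt (X_ones)) => i.
by rewrite coord_mkpt idxE oner_eq0.
Qed.

Lemma eps_nonempty (M0 : {set 'I_m}) eps : M0 != set0 -> eps ^+ d = -1 ->
  exists v : X, orbit_eps M0 eps v.
Proof.
move=> /set0Pn [i0 i0M] epsd; have eps_nz := eps_neq0 epsd.
pose j0 := Ordinal p_ge1.
have [|//|z z_nz Ez] := @root_expz (b j0 %/ d)%:Z eps.
  by have := divd_b j0; lia.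
pose u := vec 0 (fun i => if i \in M0 then 0 else 1) (fun j => if j == j0 then z else 1) (fun=> 1).
have Zu : Zd u = eps.
  rewrite /Zd (bigD1 j0) //= big1 => [|j ne]; last by rewrite /u vec_z (negbTE ne) expr1n.
  by rewrite /u vec_z eqxx mulr1.
have Su : Sd u = 1 by rewrite /Sd big1 // => l _; rewrite /u vec_s expr1n.
have u0 : F.@[u] = 0 by rewrite evalF {1}/u vec_x mul0r add0r PP_d Zu Su epsd expr1n addNr.
exists (mkpt u0); split.
- by move=> i; rewrite coord_mkpt /u vec_y indicator0.
- under eq_bigr do rewrite coord_mkpt; rewrite -/(Zd u) Zu.
  by under eq_bigr do rewrite coord_mkpt; rewrite -/(Sd u) Su mulr1.
by under eq_bigr do rewrite coord_mkpt; rewrite -/(Sd u) Su mulr1.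
Qed.

Lemma singular_nonempty (M0 : {set 'I_m}) (P0 : {set 'I_p}) (Q0 : {set 'I_q}) x0 :
  M0 != set0 -> P0 != set0 -> Q0 != set0 ->
  exists v : X, [/\ y_vanish M0 v, z_vanish P0 v, s_vanish Q0 v & coord v ix = x0].
Proof.
move=> /set0Pn [i iM] /set0Pn [j jP] /set0Pn [l lQ].
pose u := vec x0 (fun i => if i \in M0 then 0 else 1) (fun j => if j \in P0 then 0 else 1)
  (fun l => if l \in Q0 then 0 else 1).
have u0 : F.@[u] = 0.
  by apply: (F_root3 (i := i) (j := j) (l := l));
    rewrite /u ?vec_x ?vec_y ?vec_z ?vec_s ?iM ?jP ?lQ ?mulr0.
exists (mkpt u0); split=> [i'|j'|l'|]; rewrite coord_mkpt /u ?vec_x ?vec_y ?vec_z ?vec_s //;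
  exact: indicator0.
Qed.

Lemma reach_orbit_12 (M0 : {set 'I_m}) (P0 : {set 'I_p}) (Q0 : {set 'I_q}) (v w : X) :
  M0 != set0 -> P0 != set0 ->
  [/\ y_vanish M0 v, z_vanish P0 v & s_vanish Q0 v] ->
  [/\ y_vanish M0 w, z_vanish P0 w & s_vanish Q0 w] ->
  (coord v ix == 0) = (coord w ix == 0) -> reach v w.
Proof.
move=> /set0Pn [i iM] /set0Pn [j jP] [vy vz vs] [wy wz ws] Ex.
apply: (@reach_singular v w i (lshift q j)) => // [i'|k||].
- by rewrite vy wy.
- case: (split_ordP k) => [j' ->|l' ->]; first by rewrite (vz j') (wz j').
  by rewrite (vs l') (ws l').
- by apply/eqP; rewrite vy.
- by apply/eqP; rewrite (vz j).
Qed.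

Local Notation Aut_inv := (@Aut_alg_invariant K n [:: F]).

Lemma orbit_open_homogeneous : homogeneous (@orbit_open K m p q a b c).
Proof.
split; first exact: (reach_open).
apply: Aut_inv => G act g v conn actP vy i.
by rewrite (act_y actP conn).
Qed.

Lemma orbit_eps_homogeneous M0 eps : M0 != set0 -> eps ^+ d = -1 ->
  homogeneous (@orbit_eps K m p q a b c M0 eps).
Proof.
move=> M0_nz epsd; split.
  by move=> v w; apply: (reach_eps M0_nz epsd).
apply: Aut_inv => G act g v conn actP.
exact: (act_eps actP conn).
Qed.

Lemma vanish_singular M0 P0 Q0 (v : X) : M0 != set0 -> P0 != set0 -> Q0 != set0 ->
  y_vanish M0 v -> z_vanish P0 v -> s_vanish Q0 v -> singular v.
Proof.
move=> /set0Pn [i iM] /set0Pn [j jP] /set0Pn [l lQ] vy vz vs.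
apply/singularP.
by split; [exists i|exists j|exists l]; apply/eqP; rewrite ?vy ?vz ?vs.
Qed.

Lemma orbit_12_homogeneous M0 P0 Q0 : M0 != set0 -> P0 != set0 -> Q0 != set0 ->
  homogeneous (@orbit_1 K m p q a b c M0 P0 Q0) /\
  homogeneous (@orbit_2 K m p q a b c M0 P0 Q0).
Proof.
move=> M0n P0n Q0n.
have inv (G : algebraic_group K) (act : ag_point G -> X -> X) g v :
    zariski_connected (ag_eqs G) -> faithful_action act ->
    y_vanish M0 v -> z_vanish P0 v -> s_vanish Q0 v ->
    [/\ y_vanish M0 (act g v), z_vanish P0 (act g v), s_vanish Q0 (act g v)
      & coord (act g v) ix = 0 <-> coord v ix = 0].
  move=> conn actP vy vz vs; have sv := vanish_singular M0n P0n Q0n vy vz vs.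
  split=> [i|j|l|].
  - by rewrite (act_y actP conn).
  - by rewrite (act_z actP conn).
  - by rewrite (act_s actP conn).
  split=> [wx|].
    rewrite -(actK actP g v); apply: (act_x) => //.
    exact: (act_singular actP g v).1.
  exact: (act_x).
split; split.
- move=> v w [vy vz vs vx] [wy wz ws wx].
  apply: (reach_orbit_12 M0n P0n (Q0 := Q0)) => //.
  by rewrite (negbTE vx) (negbTE wx).
- apply: Aut_inv => G act g v conn actP [vy vz vs vx].
  have [wy wz ws E] := inv G act g v conn actP vy vz vs.
  by split=> //; apply: contraNneq vx => /E ->.
- move=> v w [vy vz vs vx] [wy wz ws wx].
  by apply: (reach_orbit_12 M0n P0n (Q0 := Q0)); rewrite ?vx ?wx.
- apply: Aut_inv => G act g v conn actP [vy vz vs vx].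
  have [wy wz ws E] := inv G act g v conn actP vy vz vs.
  by split=> //; apply/E.
Qed.

Lemma orbits_cover (v : X) : [\/ orbit_open v,
  exists (M0 : {set 'I_m}) (eps : K), [/\ M0 != set0, eps ^+ d = -1 & orbit_eps M0 eps v]
  | exists (M0 : {set 'I_m}) (P0 : {set 'I_p}) (Q0 : {set 'I_q}),
      [/\ M0 != set0, P0 != set0, Q0 != set0 & orbit_1 M0 P0 Q0 v \/ orbit_2 M0 P0 Q0 v]].
Proof.
pose M0 := [set i | coord v (iy i) == 0].
have [M0_0|M0n] := eqVneq M0 set0.
  constructor 1 => i; have : i \notin M0 by rewrite M0_0 inE.
  by rewrite inE.
have vy : y_vanish M0 v by move=> i; rewrite inE.
have rel : Zd (coord v) ^+ d = - Sd (coord v) ^+ d.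
  apply/eqP; rewrite -addr_eq0 -PP_d -(coord_F v) evalF.
  have /eqP -> : mu.@[coord v] == 0.
    have /set0Pn [i] := M0n; rewrite inE => /eqP vi.
    by apply/mu_eq0P; exists i.
  by rewrite mulr0 add0r.
have d0 := gcd_exp_gt0.
have [S0|S_nz] := eqVneq (Sd (coord v)) 0.
  pose P0 := [set j | coord v (iz j) == 0]; pose Q0 := [set l | coord v (iss l) == 0].
  have Z0 : Zd (coord v) = 0.
    by apply/eqP; move: rel; rewrite S0 expr0n gtn_eqF // oppr0 => /eqP; rewrite expf_eq0 d0.
  have P0n : P0 != set0.
    by have [j vj] := prodX_eq0 Z0; apply/set0Pn; exists j; rewrite inE vj.
  have Q0n : Q0 != set0.
    by have [l vl] := prodX_eq0 S0; apply/set0Pn; exists l; rewrite inE vl.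
  constructor 3; exists M0, P0, Q0; split=> //.
  have vz : z_vanish P0 v by move=> j; rewrite inE.
  have vs : s_vanish Q0 v by move=> l; rewrite inE.
  by have [vx|vx] := eqVneq (coord v ix) 0; [right|left].
constructor 2; exists M0, (Zd (coord v) / Sd (coord v)); split=> //.
  by rewrite expr_div_n rel mulNr mulfV ?expf_neq0.
have E : Zd (coord v) / Sd (coord v) * Sd (coord v) = Zd (coord v).
  by rewrite divfK.
split=> //; rewrite -/(Sd (coord v)) E //.
by apply/eqP => Z0; move/eqP: rel; rewrite Z0 expr0n gtn_eqF // eq_sym oppr_eq0 expf_eq0 d0 (negbTE S_nz).
Qed.

End Hypersurface.

Theorem theorem5p3 (K : closedFieldType) (charK0 : [pchar K] =i pred0)
    (m p q : nat) (a : 'I_m -> nat) (b : 'I_p -> nat) (c : 'I_q -> nat)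
    (m_ge1 : (1 <= m)%N) (p_ge1 : (1 <= p)%N)
    (a_ge2 : forall i, (2 <= a i)%N)
    (b_ge2 : forall j, (2 <= b j)%N)
    (c_ge2 : forall l, (2 <= c l)%N)
    (not_H4 : ~ type_H4 b c) :
  [/\ is_orbit (@orbit_open K m p q a b c),
      (forall (M : {set 'I_m}) (eps : K),
         M != set0 -> eps ^+ gcd_exp b c = -1 ->
         is_orbit (@orbit_eps K m p q a b c M eps)),
      (forall (M : {set 'I_m}) (P : {set 'I_p}) (Q : {set 'I_q}),
         M != set0 -> P != set0 -> Q != set0 ->
         is_orbit (@orbit_1 K m p q a b c M P Q) /\
         is_orbit (@orbit_2 K m p q a b c M P Q))
    & (forall S : X_tri K a b c -> Prop, is_orbit S ->
         [\/ (forall v, S v <-> orbit_open v),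
             (exists (M : {set 'I_m}) (eps : K),
                [/\ M != set0, eps ^+ gcd_exp b c = -1
                  & forall v, S v <-> orbit_eps M eps v])
           | (exists (M : {set 'I_m}) (P : {set 'I_p}) (Q : {set 'I_q}),
                [/\ M != set0, P != set0, Q != set0
                  & (forall v, S v <-> orbit_1 M P Q v) \/
                    (forall v, S v <-> orbit_2 M P Q v)])])].
Proof.
have openH := orbit_open_homogeneous charK0 p_ge1 a_ge2 b_ge2 c_ge2 not_H4.
have epsH := orbit_eps_homogeneous charK0 p_ge1 a_ge2 b_ge2 c_ge2 not_H4.
have singH := orbit_12_homogeneous charK0 p_ge1 a_ge2 b_ge2 c_ge2 not_H4.
split.
- have [v v_open] := open_nonempty K a b c.
  exact: homogeneous_orbit openH v_open.
- move=> M0 eps M0n epsd.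
  have [v v_eps] := eps_nonempty a p_ge1 b_ge2 M0n epsd.
  exact: homogeneous_orbit (epsH M0 eps M0n epsd) v_eps.
- move=> M0 P0 Q0 M0n P0n Q0n; have [H1 H2] := singH M0 P0 Q0 M0n P0n Q0n.
  have [v1 [y1 z1 s1 x1]] := singular_nonempty a_ge2 b_ge2 c_ge2 (1 : K) M0n P0n Q0n.
  have [v2 [y2 z2 s2 x2]] := singular_nonempty a_ge2 b_ge2 c_ge2 (0 : K) M0n P0n Q0n.
  split; [apply: homogeneous_orbit H1 _|apply: homogeneous_orbit H2 _]; last by split; eassumption.
  by split; [exact: y1|exact: z1|exact: s1|rewrite x1 oner_neq0].
move=> S [x Sx]; case: (orbits_cover p_ge1 a_ge2 b_ge2 x).
- by move=> x_open; constructor 1; apply: orbit_homogeneous openH x_open Sx.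
- move=> [M0 [eps [M0n epsd x_eps]]]; constructor 2; exists M0, eps; split=> //.
  exact: orbit_homogeneous (epsH M0 eps M0n epsd) x_eps Sx.
move=> [M0 [P0 [Q0 [M0n P0n Q0n x_sing]]]]; constructor 3; exists M0, P0, Q0; split=> //.
have [H1 H2] := singH M0 P0 Q0 M0n P0n Q0n.
by case: x_sing => x_sing; [left|right]; [apply: orbit_homogeneous H1 x_sing Sx|apply: orbit_homogeneous H2 x_sing Sx].
Qed.
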